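(* Let $m,n\ge 1$, let $a^{(i)}_j\in\mathbb{C}$ ($1\le i\le m$, $1\le j\le n$), and let $\ell_i(x)=a^{(i)}_1x_1+\cdots+a^{(i)}_nx_n$, $i=1,\ldots,m$, be linear forms in $x=(x_1,\ldots,x_n)$. Let $\mathcal{A}$ be the $n\times m$ matrix whose $i$-th column is $a^{(i)}=(a^{(i)}_1,\ldots,a^{(i)}_n)^\top$. For generic parameters $s\in(\mathbb{C}\setminus\{0\})^m$, $\nu\in(\mathbb{C}\setminus\{1\})^n$ and every twisted $n$-cycle $\Gamma$, let $$\phi(c)=\int_\Gamma\prod_{i=1}^m(\ell_i(x)-c_i)^{s_i}\,x_1^{\nu_1}\cdots x_n^{\nu_n}\,\frac{dx_1}{x_1}\wedge\cdots\wedge\frac{dx_n}{x_n}.$$ Define the following elements of $D(s,\nu)$, writing $D_j=\sum_{k=1}^m a^{(k)}_j\partial_{c_k}$ for $j=1,\ldots,n$: (i) $H=c_1\partial_{c_1}+\cdots+c_m\partial_{c_m}-\big(\sum_{i=1}^n\nu_i+\sum_{j=1}^m s_j\big)$; (ii) for $i=1,\ldots,m$, $$L_i=-\frac{\partial_{c_i}}{s_i}\sum_{j=1}^n a^{(i)}_j\prod_{l\ne j}\frac{D_l}{\nu_l-1}+c_i\frac{\partial_{c_i}}{s_i}\prod_{l=1}^n\frac{D_l}{\nu_l-1}-\prod_{l=1}^n\frac{D_l}{\nu_l-1};$$ (iii) the operators $P$: for every subset $C=\{i_1,\ldots,i_k\}\subseteq[m]$ whose columns $a^{(i_1)},\ldots,a^{(i_k)}$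 are linearly dependent and every vector $p=(p_{i_1},\ldots,p_{i_k})\in\mathbb{C}^k$ in the kernel of the submatrix $\mathcal{A}_C=[a^{(i_1)}|\cdots|a^{(i_k)}]$, the operator $$P=\sum_{j=1}^k p_{i_j}s_{i_j}\partial_{\widehat{i_j}}-\Big(\sum_{j=1}^k p_{i_j}c_{i_j}\Big)\partial_{c_{i_1}}\cdots\partial_{c_{i_k}};$$ (iv) the operators $Q$: for every subset $\{i_1,\ldots,i_k\}\subseteq[m]$ and every tuple of polynomials $p_{i_1},\ldots,p_{i_k}\in\mathbb{C}[c_1,\ldots,c_m]$ with $\sum_{j=1}^k p_{i_j}(\ell_{i_j}(x)-c_{i_j})=0$ in $\mathbb{C}[c_1,\ldots,c_m,x_1,\ldots,x_n]$, the operator $Q=\sum_{j=1}^k p_{i_j}s_{i_j}\partial_{\widehat{i_j}}$. Then the left $D(s,\nu)$-ideal generated by $H$, $L_1,\ldots,L_m$, all operators $P$ of type (iii) and all operators $Q$ of type (iv) is contained in $\operatorname{Ann}_{D(s,\nu)}(\phi)$.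
   Context: A twisted $n$-cycle is an element $\Gamma\in H_n\big((\mathbb{C}^* )^n\setminus V(\prod_{i=1}^m(\ell_i-c_i)),\mathcal{L}_\omega\big)$, homology with coefficients in the local system $\mathcal{L}_\omega$ of flat sections of $\nabla_{-\omega}=d-\omega\wedge$, where $\omega=\mathrm{dlog}\big(x^\nu\prod_i(\ell_i-c_i)^{s_i}\big)$ and $d$ is the differential in the $x$-variables. $D(s,\nu)=\mathbb{C}(s,\nu)[c_1,\ldots,c_m]\langle\partial_{c_1},\ldots,\partial_{c_m}\rangle$ is the Weyl algebra over the field $\mathbb{C}(s_1,\ldots,s_m,\nu_1,\ldots,\nu_n)$, with relations $\partial_{c_i}c_i-c_i\partial_{c_i}=1$ and all other generators commuting. $\operatorname{Ann}_{D(s,\nu)}(\phi)$ is the left ideal of all operators annihilating $\phi$. For a subset $\{i_1,\ldots,i_k\}$, $\partial_{\widehat{i_j}}$ denotes the product $\partial_{c_{i_1}}\cdots\partial_{c_{i_k}}$ with the factor $\partial_{c_{i_j}}$ omitted. Polynomial coefficients are placed to the left of the derivatives. *)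

(* Defs.v *)
From HB Require Import structures.
From mathcomp Require Import all_boot all_order all_algebra.
From mathcomp Require mpoly.

Set Implicit Arguments.
Unset Strict Implicit.
Unset Printing Implicit Defensive.

Import GRing.Theory.
Local Open Scope ring_scope.

(* mpoly is imported only inside sections: its notations clash with those of
   MathComp-Analysis, which is imported after them. *)

(* The ring A<del_1, ..., del_m> of differential operators over a commutative
   ring A with commuting derivations d_1, ..., d_m.  The operator
   \sum_b a_b del^b, coefficients on the left, is encoded by the polynomial
   \sum_b a_b 'X_[b] of {mpoly A[m]}. *)
Section DiffOp.
Import mpoly.
Variables (A : comNzRingType) (m : nat) (d : 'I_m -> {additive A -> A}).
Implicit Types (P Q S : {mpoly A[m]}) (i j : 'I_m) (b : 'X_{1..m}).

(* del_i * (a del^b) = a del_i del^b + d_i(a) del^b *)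
Definition dop_partial i Q : {mpoly A[m]} := Q * 'X_i + map_mpoly (d i) Q.

Definition dop_partials b Q : {mpoly A[m]} :=
  foldr (fun i => iter (b i) (dop_partial i)) Q (enum 'I_m).

Definition dop_mul P Q : {mpoly A[m]} :=
  \sum_(b <- msupp P) P@_b *: dop_partials b Q.

Hypothesis dM : forall i p q, d i (p * q) = d i p * q + p * d i q.
Hypothesis dC : forall i j p, d i (d j p) = d j (d i p).

Let d1 i : d i 1 = 0.
Proof.
by apply: (addIr (d i 1)); rewrite add0r -{3}[1]mulr1 dM mulr1 mul1r.
Qed.

Fact dop_partialD i : {morph dop_partial i : P Q / P + Q}.
Proof. by move=> P Q; rewrite /dop_partial mulrDl raddfD /= addrACA. Qed.

Fact dop_partial0 i : dop_partial i 0 = 0.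
Proof. by rewrite /dop_partial mul0r raddf0 addr0. Qed.

Fact dop_partialZ i a Q :
  dop_partial i (a *: Q) = a *: dop_partial i Q + d i a *: Q.
Proof.
rewrite /dop_partial -scalerAl scalerDr -addrA; congr (_ + _).
apply/mpolyP => b; rewrite mcoeffD !mcoeffZ !mcoeff_map_mpoly mcoeffZ dM addrC.
by [].
Qed.

Fact map_d_MX i j Q :
  map_mpoly (d i) (Q * 'X_j) = map_mpoly (d i) Q * 'X_j.
Proof.
rewrite [Q]mpolyE mulr_suml !raddf_sum mulr_suml; apply: eq_bigr => b _ /=.
rewrite -scalerAl -mpolyXD; apply/mpolyP => c.
rewrite mcoeff_map_mpoly mcoeffZ mcoeffX mulr_natr raddfMn /= -mulr_natr.
have -> : map_mpoly (d i) (Q@_b *: 'X_[b]) = d i Q@_b *: 'X_[b].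
  apply/mpolyP => e; rewrite mcoeff_map_mpoly !mcoeffZ mcoeffX.
  by rewrite !mulr_natr raddfMn.
by rewrite -scalerAl -mpolyXD mcoeffZ mcoeffX.
Qed.

Fact dop_partialC i j Q :
  dop_partial i (dop_partial j Q) = dop_partial j (dop_partial i Q).
Proof.
have eX : Q * 'X_j * 'X_i = Q * 'X_i * 'X_j by rewrite mulrAC.
have eD : map_mpoly (d i) (map_mpoly (d j) Q) = map_mpoly (d j) (map_mpoly (d i) Q).
  by apply/mpolyP => b; rewrite !mcoeff_map_mpoly dC.
rewrite /dop_partial !mulrDl !raddfD /= !map_d_MX eX eD.
by rewrite -2!addrA; congr (_ + _); rewrite addrCA.
Qed.

Fact dop_partialsD b : {morph dop_partials b : P Q / P + Q}.
Proof.
rewrite /dop_partials => P Q; elim: (enum _) => //= i s ->.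
by elim: (b i) => //= k ->; rewrite dop_partialD.
Qed.

Fact dop_partials0 b : dop_partials b 0 = 0.
Proof. by apply: (addIr (dop_partials b 0)); rewrite -dop_partialsD !add0r. Qed.

Fact dop_partials_0 Q : dop_partials 0%MM Q = Q.
Proof. by rewrite /dop_partials; elim: (enum _) => //= i s ->; rewrite mnm0E. Qed.

Fact dop_partialsU i b Q :
  dop_partials (U_(i) + b)%MM Q = dop_partial i (dop_partials b Q).
Proof.
rewrite /dop_partials; have := enum_uniq 'I_m; have := mem_enum 'I_m i.
rewrite inE; elim: (enum _) => //= j s IH; rewrite inE => /orP[/eqP <-|si] /andP[js us].
  rewrite mnmDE mnm1E eqxx /=; congr (dop_partial _ (iter _ _ _)).
  elim: s js {IH us} => //= k s IH; rewrite inE negb_or => /andP[ik /IH ->].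
  by rewrite mnmDE mnm1E (negbTE ik).
rewrite IH // mnmDE mnm1E; have /negbTE -> : i != j by apply: contraNneq js => <-.
by elim: (b j) => [//|k /= ->]; exact: dop_partialC.
Qed.

Fact mnm_ind (T : 'X_{1..m} -> Prop) :
  T 0%MM -> (forall i b, T b -> T (U_(i) + b)%MM) -> forall b, T b.
Proof.
move=> T0 TU b; move: {2}(mdeg b) (erefl (mdeg b)) => k.
elim: k b => [|k IH] b db; first by move/eqP: db; rewrite mdeg_eq0 => /eqP ->.
have [i bi] : exists i, b i != 0%N.
  apply/existsP; apply: contraPT db => /existsPn b0.
  suff -> : b = 0%MM by rewrite mdeg0.
  by apply/mnmP => i; rewrite mnm0E; apply/eqP; rewrite -[_ == _]negbK b0.
have le : (U_(i) <= b)%MM by rewrite lep1mP.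
rewrite -(submK le) addmC; apply/TU/IH.
by move: db; rewrite -{1}(submK le) mdegD mdeg1 addn1 => -[].
Qed.

Fact dop_partialsX b : dop_partials b 1 = 'X_[b].
Proof.
have dX i c : dop_partial i 'X_[c] = 'X_[(U_(i) + c)].
  rewrite /dop_partial -mpolyXD addmC -[RHS]addr0; congr (_ + _).
  apply/mpolyP => e; rewrite mcoeff_map_mpoly mcoeffX mcoeff0.
  by rewrite raddfMn /= d1 mul0rn.
elim/mnm_ind: b => [|i b IH]; last by rewrite dop_partialsU IH dX.
by rewrite dop_partials_0 mpolyX0.
Qed.

Fact dop_mulEw (s : seq 'X_{1..m}) P Q : uniq s -> {subset msupp P <= s} ->
  dop_mul P Q = \sum_(b <- s) P@_b *: dop_partials b Q.
Proof.
move=> us sPs; rewrite [RHS](bigID (fun b => b \in msupp P)) /= [X in _ + X]big1 ?addr0.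
  rewrite -big_filter; apply: perm_big; apply: uniq_perm.
  - exact: msupp_uniq.
  - exact: filter_uniq.
  by move=> b; rewrite mem_filter; case: (boolP (b \in msupp P)) => //= /sPs ->.
by move=> b /memN_msupp_eq0 ->; rewrite scale0r.
Qed.

Fact dop_mulDl : left_distributive dop_mul +%R.
Proof.
move=> P Q S; set s := undup (msupp P ++ msupp Q ++ msupp (P + Q)).
have us : uniq s by exact: undup_uniq.
rewrite !(@dop_mulEw s) // -?big_split /=.
- by apply: eq_bigr => b _; rewrite mcoeffD scalerDl.
all: by move=> b bs; rewrite mem_undup !mem_cat bs ?orbT.
Qed.

Fact dop_mulDr : right_distributive dop_mul +%R.
Proof.
move=> P Q S; rewrite /dop_mul -big_split /=.
by apply: eq_bigr => b _; rewrite dop_partialsD scalerDr.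
Qed.

Fact dop_mul0l Q : dop_mul 0 Q = 0.
Proof. by rewrite /dop_mul msupp0 big_nil. Qed.

Fact dop_mulZl a P Q : dop_mul (a *: P) Q = a *: dop_mul P Q.
Proof.
rewrite (@dop_mulEw (msupp P)) ?msupp_uniq //; last exact: msuppZ_le.
by rewrite scaler_sumr; apply: eq_bigr => b _; rewrite mcoeffZ scalerA.
Qed.

Fact dop_mulXl b Q : dop_mul 'X_[b] Q = dop_partials b Q.
Proof. by rewrite /dop_mul msuppX big_seq1 mcoeffX eqxx scale1r. Qed.

Fact dop_mul1l : left_id 1 dop_mul.
Proof. by move=> Q; rewrite -mpolyX0 dop_mulXl dop_partials_0. Qed.

Fact dop_mul1r : right_id 1 dop_mul.
Proof.
move=> P; rewrite /dop_mul [RHS]mpolyE.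
by apply: eq_bigr => b _; rewrite dop_partialsX.
Qed.

Fact dop_mul_suml (I : Type) (r : seq I) (F : I -> {mpoly A[m]}) Q :
  dop_mul (\sum_(x <- r) F x) Q = \sum_(x <- r) dop_mul (F x) Q.
Proof.
by apply: (big_morph (dop_mul^~ Q)) => [P S|]; [exact: dop_mulDl|exact: dop_mul0l].
Qed.

Fact dop_mul_partial i P Q : dop_mul (dop_partial i P) Q = dop_partial i (dop_mul P Q).
Proof.
have dps (I : Type) (r : seq I) (F : I -> {mpoly A[m]}) :
    dop_partial i (\sum_(x <- r) F x) = \sum_(x <- r) dop_partial i (F x).
  exact: (big_morph _ (dop_partialD i) (dop_partial0 i)).
rewrite [P]mpolyE dps !dop_mul_suml dps; apply: eq_bigr => b _.
rewrite dop_partialZ dop_mulZl dop_partialZ dop_mulDl !dop_mulZl; congr (_ *: _ + _).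
rewrite /dop_partial; have -> : map_mpoly (d i) 'X_[b] = 0.
  apply/mpolyP => c; rewrite mcoeff_map_mpoly mcoeffX mcoeff0.
  by rewrite raddfMn /= d1 mul0rn.
by rewrite addr0 -mpolyXD addmC !dop_mulXl dop_partialsU.
Qed.

Fact dop_mulA : associative dop_mul.
Proof.
have pA b P Q : dop_mul (dop_partials b P) Q = dop_partials b (dop_mul P Q).
  elim/mnm_ind: b => [|i b IH]; first by rewrite !dop_partials_0.
  by rewrite !dop_partialsU dop_mul_partial IH.
move=> P Q S; rewrite [dop_mul P Q]/dop_mul dop_mul_suml.
by apply: eq_bigr => b _; rewrite dop_mulZl pA.
Qed.

End DiffOp.

Section Weyl.
Import mpoly.
Variables (K : comNzRingType) (m : nat).

(* The Weyl algebra K[c_1, ..., c_m]<del_1, ..., del_m>.  Only the additive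
   structure is that of the polynomials: the product is dop_mul; see weyl_ddC,
   weyl_polyM and weyl_dc for the defining relations. *)
Definition weyl : Type := {mpoly {mpoly K[m]}[m]}.
HB.instance Definition _ := GRing.Zmodule.copy weyl {mpoly {mpoly K[m]}[m]}.


Let D i : {additive {mpoly K[m]} -> {mpoly K[m]}} := @mderiv m K i.

Let DM i p q : D i (p * q) = D i p * q + p * D i q.
Proof. exact: mderivM. Qed.

Let DC i j p : D i (D j p) = D j (D i p).
Proof. exact: mderiv_comm. Qed.

Fact weyl_1_neq0 : (1 : {mpoly {mpoly K[m]}[m]}) != 0.
Proof. exact: oner_neq0. Qed.

HB.instance Definition _ := GRing.Zmodule_isNzRing.Build weyl
  (dop_mulA DM DC) (dop_mul1l D) (dop_mul1r DM DC) (dop_mulDl D) (dop_mulDr D)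
  weyl_1_neq0.

Definition weyl_poly (p : {mpoly K[m]}) : weyl := p%:MP.
Definition weyl_const (k : K) : weyl := weyl_poly k%:MP.
Definition weyl_c (i : 'I_m) : weyl := weyl_poly 'X_i.
Definition weyl_d (i : 'I_m) : weyl := ('X_i : {mpoly {mpoly K[m]}[m]}).

Fact weyl_poly_mul p (Q : weyl) :
  weyl_poly p * Q = (p *: (Q : {mpoly {mpoly K[m]}[m]})).
Proof.
rewrite /weyl_poly -[p%:MP]alg_mpolyC; exact: etrans (dop_mulZl _ _ _ _) (congr1 _ (dop_mul1l _ _)).
Qed.

Fact weyl_polyD : {morph weyl_poly : p q / p + q}.
Proof. exact: mpolyCD. Qed.

Fact weyl_polyM : {morph weyl_poly : p q / p * q}.
Proof. by move=> p q; rewrite weyl_poly_mul -mul_mpolyC /weyl_poly mpolyCM. Qed.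

Fact weyl_ddC i j : weyl_d i * weyl_d j = weyl_d j * weyl_d i.
Proof.
have E k l : weyl_d k * weyl_d l = ('X_[(U_(k) + U_(l))] : {mpoly {mpoly K[m]}[m]}).
  rewrite -(dop_partialsX DM DC) (dop_partialsU DC) (dop_partialsX DM DC).
  apply: etrans (dop_mulXl _ _ _) _.
  by rewrite -[U_(k)%MM]addm0 (dop_partialsU DC) dop_partials_0.
by rewrite !E addmC.
Qed.

Fact weyl_d_poly i p : weyl_d i * weyl_poly p = weyl_poly p * weyl_d i + weyl_poly p^`M(i).
Proof.
rewrite weyl_poly_mul; apply: etrans (dop_mulXl _ _ _) _.
rewrite -[U_(i)%MM]addm0 (dop_partialsU DC) dop_partials_0 /dop_partial.
by rewrite mul_mpolyC map_mpolyC.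
Qed.

Fact weyl_dc i j : weyl_d i * weyl_c j - weyl_c j * weyl_d i = (i == j)%:R.
Proof.
rewrite weyl_d_poly addrAC subrr add0r mderivX mnm1E.
have [->|] := eqVneq j i; last by rewrite scale0r /weyl_poly mpolyC0.
rewrite -{1}[U_(i)%MM]add0m addmK mpolyX0 scale1r; exact: mpolyC1.
Qed.
End Weyl.

(* S generates the left ideal of its finite left-linear combinations. *)
Definition left_ideal (D : nzRingType) (S : D -> Prop) (T : D) : Prop :=
  exists (N : nat) (a g : 'I_N -> D),
    (forall k, S (g k)) /\ T = \sum_(k < N) a k * g k.

Section Ideal.
Import mpoly.
Variables (C : fieldType) (m n : nat) (A : 'M[C]_(n, m)).

(* C(s, nu): the first m variables are the s_i, the last n are the nu_j. *)
Definition param_field : fieldType := {fraction {mpoly C[m + n]}}.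
Local Notation W := (weyl param_field m).

Definition par (p : {mpoly C[m + n]}) : param_field := FracField.tofrac p.
Definition par_s (i : 'I_m) : param_field := par 'X_(lshift n i).
Definition par_nu (j : 'I_n) : param_field := par 'X_(rshift m j).
Definition par_cst (a : C) : param_field := par a%:MP.

Local Notation cst := (@weyl_const param_field m).
Local Notation del := (@weyl_d param_field m).
Local Notation var := (@weyl_c param_field m).

Definition op_D (j : 'I_n) : W := \sum_(k < m) cst (par_cst (A j k)) * del k.

(* D_j / (nu_j - 1) *)
Definition op_E (j : 'I_n) : W := cst (par_nu j - 1)^-1 * op_D j.

Definition op_H : W :=
  \sum_(i < m) var i * del i
  - cst (\sum_(j < n) par_nu j + \sum_(i < m) par_s i).

Definition op_L (i : 'I_m) : W :=
  - (cst (par_s i)^-1 * del i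
     * \sum_(j < n) cst (par_cst (A j i)) * \prod_(l < n | l != j) op_E l)
  + var i * (cst (par_s i)^-1 * del i) * \prod_(l < n) op_E l
  - \prod_(l < n) op_E l.

(* In op_P and op_Q the subset is I = {i_1 < ... < i_k}, k = #|I|, and
   i_j = enum_val j. *)
Definition subcols (I : {set 'I_m}) : 'M[C]_(n, #|I|) :=
  colsub (@enum_val _ (mem I)) A.

Definition del_omit (I : {set 'I_m}) (j : 'I_#|I|) : W :=
  \prod_(l < #|I| | l != j) del (enum_val l).

Definition op_P (I : {set 'I_m}) (p : 'cV[C]_#|I|) : W :=
  \sum_(j < #|I|) cst (par_cst (p j 0) * par_s (enum_val j)) * del_omit j
  - (\sum_(j < #|I|) cst (par_cst (p j 0)) * var (enum_val j))
    * \prod_(l < #|I|) del (enum_val l).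

Definition op_Q (I : {set 'I_m}) (p : 'I_#|I| -> {mpoly C[m]}) : W :=
  \sum_(j < #|I|)
    weyl_poly (map_mpoly par_cst (p j)) * cst (par_s (enum_val j)) * del_omit j.

Definition lin_form (i : 'I_m) : {mpoly {mpoly C[m]}[n]} :=
  \sum_(j < n) (A j i)%:MP%:MP * 'X_j.

(* \sum_j p_j (l_{i_j}(x) - c_{i_j}) = 0, with C[c, x] read as C[c][x]. *)
Definition is_relation (I : {set 'I_m}) (p : 'I_#|I| -> {mpoly C[m]}) : Prop :=
  \sum_(j < #|I|)
    (p j)%:MP * (lin_form (enum_val j) - ('X_(enum_val j))%:MP) = 0.

Inductive generator : W -> Prop :=
| generator_H : generator op_H
| generator_L i : generator (op_L i)
| generator_P (I : {set 'I_m}) (p : 'cV[C]_#|I|) :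
    (\rank (subcols I) < #|I|)%N -> subcols I *m p = 0 -> generator (op_P p)
| generator_Q (I : {set 'I_m}) (p : 'I_#|I| -> {mpoly C[m]}) :
    is_relation p -> generator (op_Q p).

End Ideal.

From mathcomp.real_closed Require Import complex.
From mathcomp Require Import all_classical all_reals all_analysis.
Import Num.Theory Order.TTheory numFieldNormedType.Exports.
Local Open Scope classical_set_scope.
Local Open Scope complex_scope.

HB.instance Definition _ (R : rcfType) := NormedModule.copy R[i] R[i]^o.

Section ComplexFunctions.
Variable R : realType.
Local Notation C := R[i].

Definition cexp (z : C) : C :=
  let r := expR (complex.Re z) in
  (r * cos (complex.Im z)) +i* (r * sin (complex.Im z)).

(* The principal logarithm on the half-plane 0 < Re z. *)
Definition clog (z : C) : C :=
  ln (Normc.normc z) +i* atan (complex.Im z / complex.Re z).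

(* The principal power z ^ a on the half-plane 0 < Re z. *)
Definition cpow (z a : C) : C := cexp (a * clog z).

Definition cpartial (N : nat) (i : 'I_N) (f : 'rV[C]_N -> C) (x : 'rV[C]_N) : C :=
  'D_(delta_mx 0 i) f x.

Definition rpartial (N : nat) (i : 'I_N) (f : 'rV[R]_N -> C) (t : 'rV[R]_N) : C :=
  ('D_(delta_mx 0 i) (fun u => complex.Re (f u)) t)
  +i* ('D_(delta_mx 0 i) (fun u => complex.Im (f u)) t).

Definition smooth_on (N : nat) (U : set 'rV[R]_N) (g : 'rV[R]_N -> R) : Prop :=
  forall (l : seq 'I_N) (t : 'rV[R]_N), U t ->
    differentiable (foldr (fun i h u => 'D_(delta_mx 0 i) h u) g l) t.

(* The (N-1)-simplex, in barycentric coordinates. *)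
Definition std_simplex (N : nat) : set 'rV[R]_N :=
  [set t : 'rV[R]_N | (forall i, 0 <= t 0 i) /\ \sum_(i < N) t 0 i = 1].

Definition face (N : nat) (i : 'I_N.+1) (t : 'rV[R]_N) : 'rV[R]_N.+1 :=
  \row_j (if unlift i j is Some k then t 0 k else 0).

(* (t_1, ..., t_N) |-> (1 - t_1 - ... - t_N, t_1, ..., t_N) *)
Definition bary (N : nat) (t : 'rV[R]_N) : 'rV[R]_N.+1 :=
  row_mx (1 - \sum_(i < N) t 0 i)%:M t.

(* The integral over {t | 0 <= t_i, t_1 + ... + t_N <= r}, iterated. *)
Fixpoint corner_integral (N : nat) : R -> ('rV[R]_N -> R) -> R :=
  match N with
  | 0 => fun _ f => f 0
  | N'.+1 => fun r f =>
      \int[lebesgue_measure]_(x in `[0, r])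
        corner_integral (r - x) (fun t : 'rV[R]_N' => f (row_mx x%:M t))
  end.

Definition simplex_integral (N : nat) (f : 'rV[R]_N -> C) : C :=
  corner_integral 1 (fun t => complex.Re (f t))
  +i* corner_integral 1 (fun t => complex.Im (f t)).

End ComplexFunctions.

Section TwistedCycles.
Variables (R : realType) (m n : nat).
Local Notation C := R[i].
Variable A : 'M[C]_(n, m).
Implicit Types (s c : 'rV[C]_m) (nu x : 'rV[C]_n).

Definition ell (i : 'I_m) x : C := \sum_(j < n) A j i * x 0 j.

(* The points of the torus off the hyperplanes l_i = c_i. *)
Definition complement c : set 'rV[C]_n :=
  [set x : 'rV[C]_n | (forall j, x 0 j != 0) /\ (forall i, ell i x != c 0 i)].

(* The coefficient of dx_j in dlog (x^nu \prod_i (l_i - c_i)^s_i). *)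
Definition omega s nu c (j : 'I_n) x : C :=
  nu 0 j / x 0 j + \sum_(i < m) s 0 i * A j i / (ell i x - c 0 i).

(* F is a section of the local system near x: dF - omega /\ F = 0. *)
Definition flat_near s nu c x (F : 'rV[C]_n -> C) : Prop :=
  \forall y \near x,
    differentiable F y /\ forall j, cpartial j F y = omega s nu c j y * F y.

Record loaded_simplex := LoadedSimplex {
  ls_map : 'rV[R]_n.+1 -> 'rV[C]_n;
  ls_sec : 'rV[R]_n.+1 -> C
}.

(* A smooth singular n-simplex of the complement, with a section along it of
   the (pulled back) local system. *)
Definition is_loaded_simplex s nu c (S : loaded_simplex) : Prop :=
  [/\ exists2 U, open U /\ @std_simplex R n.+1 `<=` U &
        forall j, smooth_on U (fun t => complex.Re (ls_map S t 0 j))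
               /\ smooth_on U (fun t => complex.Im (ls_map S t 0 j)),
      forall t, std_simplex t -> complement c (ls_map S t) &
      forall t, std_simplex t -> exists2 F,
        flat_near s nu c (ls_map S t) F &
        \forall u \near t, std_simplex u -> ls_sec S u = F (ls_map S u)].

(* The coefficient at the (n-1)-simplex tau of the boundary of \sum_k G_k, as
   a function on the standard simplex. *)
Definition boundary_coef (N : nat) (G : 'I_N -> loaded_simplex)
    (tau : 'rV[R]_n -> 'rV[C]_n) (t : 'rV[R]_n) : C :=
  \sum_(k < N) \sum_(i < n.+1)
    if `[< forall u, std_simplex u -> ls_map (G k) (face i u) = tau u >]
    then (-1) ^+ i * ls_sec (G k) (face i t) else 0.

(* A cycle of the complex of smooth singular chains with coefficients in the
   local system; the chain group is the sum over the simplices sigma of the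
   spaces of sections along sigma, so that scalars are part of the sections. *)
Definition twisted_cycle s nu c (N : nat) (G : 'I_N -> loaded_simplex) : Prop :=
  (forall k, is_loaded_simplex s nu c (G k)) /\
  forall tau t, std_simplex t -> boundary_coef G tau t = 0.

(* The branch of \prod_i (l_i(x) - c'_i)^s_i x^nu along ls_map S, for c' near c,
   that continues the branch ls_sec S given at c' = c. *)
Definition branch s c (S : loaded_simplex) c' (t : 'rV[R]_n.+1) : C :=
  ls_sec S t *
  \prod_(i < m)
    cpow ((ell i (ls_map S t) - c' 0 i) / (ell i (ls_map S t) - c 0 i)) (s 0 i).

(* The pull-back of dx_1/x_1 /\ ... /\ dx_n/x_n, in the coordinates of bary. *)
Definition dlog_form (S : loaded_simplex) (t : 'rV[R]_n) : C :=
  \det (\matrix_(j < n, k < n) rpartial k (fun u => ls_map S (bary u) 0 j) t)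
  / \prod_(j < n) ls_map S (bary t) 0 j.

(* The germ at c of the function phi attached to a twisted cycle G at c. *)
Definition phi s c (N : nat) (G : 'I_N -> loaded_simplex) c' : C :=
  \sum_(k < N)
    simplex_integral (fun t => branch s c (G k) c' (bary t) * dlog_form (G k) t).

End TwistedCycles.

Section Annihilator.
Import -(notations) mpoly.
Variables (R : realType) (m n : nat).
Local Notation C := R[i].
Local Notation W := (weyl (param_field C m n) m).
Variable A : 'M[C]_(n, m).

(* The value of a rational function of the parameters; it depends on the chosen
   representative only where a denominator vanishes, hence not at all for
   generic parameters. *)
Definition par_eval (s : 'rV[C]_m) (nu : 'rV[C]_n) (k : param_field C m n) : C :=
  meval (row_mx s nu 0) (frac (repr k)).1 /
  meval (row_mx s nu 0) (frac (repr k)).2.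

Definition cpartials (b : multinom m) (f : 'rV[C]_m -> C) : 'rV[C]_m -> C :=
  foldr (fun i => iter (b i) (@cpartial R m i)) f (enum 'I_m).

Definition weyl_act (s : 'rV[C]_m) (nu : 'rV[C]_n) (T : W)
    (f : 'rV[C]_m -> C) (c : 'rV[C]_m) : C :=
  \sum_(b <- msupp (T : mpoly m _))
    mmap (par_eval s nu) (c 0) (mcoeff b T) * cpartials b f c.

(* Holomorphy is required, since 'D has a default value at points where the
   derivative does not exist. *)
Definition annihilates_near (s : 'rV[C]_m) (nu : 'rV[C]_n) (T : W)
    (f : 'rV[C]_m -> C) (c : 'rV[C]_m) : Prop :=
  \forall c' \near c, differentiable f c' /\ weyl_act s nu T f c' = 0.

(* P holds for all (s, nu) in (C \ {0})^m x (C \ {1})^n off some hypersurface. *)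
Definition for_generic_params (P : 'rV[C]_m -> 'rV[C]_n -> Prop) : Prop :=
  exists2 g : mpoly (m + n) C, g != 0 &
    forall (s : 'rV[C]_m) (nu : 'rV[C]_n),
      (forall i, s 0 i != 0) -> (forall j, nu 0 j != 1) ->
      meval (row_mx s nu 0) g != 0 -> P s nu.

(* The operators that annihilate, for generic parameters, every germ phi(c) of
   every twisted cycle. *)
Definition Ann : set W :=
  [set T | for_generic_params (fun s nu =>
     forall (c : 'rV[C]_m) (N : nat) (G : 'I_N -> loaded_simplex R n),
       twisted_cycle A s nu c G -> annihilates_near s nu T (phi A s c G) c)].

End Annihilator.

(* Main.v *)
(* Multiply the integrand of phi by \prod_i (l_i - c_i)^-e_i x^-k, and let
   Phi(e, k) be the resulting period against dx_1 ... dx_n, so that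
   phi = Phi(0, 1).  Differentiation under the integral sign gives
     del_i Phi(e, k) = - (s_i - e_i) Phi(e + 1_i, k),
   and Stokes' theorem on each simplex, whose boundary terms cancel pointwise
   along a cycle, gives
     (nu_j - k_j) Phi(0, k + 1_j) + \sum_i s_i a^(i)_j Phi(1_i, k) = 0.
   Hence D_j / (nu_j - 1) raises k_j from 1 to 2, and the generators reduce to
   linear relations between the functions l_i - c_i, x_j and 1 under the
   integral.  Generic parameters are those where no denominator of a coefficient
   vanishes. *)
Require Import Defs.
From HB Require Import structures.
From mathcomp Require Import all_boot all_order all_algebra.
From mathcomp Require mpoly.
Set Implicit Arguments.
Unset Strict Implicit.
Unset Printing Implicit Defensive.
Import Order.TTheory GRing.Theory Num.Theory.
Local Open Scope ring_scope.

(** The value [par_eval] of a coefficient is read off a chosen representative of a fraction, so it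
    need not be multiplicative. Operators are therefore specialised through a relation,
    [specializes], which respects sums, products and inverses; it is compared with [par_eval] only
    for the final operator, once its denominators are known not to vanish. Integrands are controlled
    on the closed simplex only, whereas the lemmas on iterated integrals want continuity on the
    whole space: a retraction onto the simplex bridges the two without changing the integral.
    Stokes' theorem is deduced from the divergence theorem on the corner simplex, applied to a
    function times a row of cofactors of the Jacobian matrix. Such a row is divergence free, and on
    a face it becomes the minor of the face map. Since this minor depends on the face map alone, the
    cycle condition, which groups faces by their maps, makes the boundary terms cancel; this happens
    on open faces, where the minors can be compared. The branch enters only through ratios with
    positive real part, so the calculus of complex powers reduces to the first-order expansion at
    1. *)

(** * Values of rational functions of the parameters *)

Section Specialization.
Import mpoly.
Variables (C : fieldType) (m n : nat) (x : 'I_(m + n) -> C).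
Local Notation K := (param_field C m n).
Implicit Types (k : K) (v w : C).

(* The rational function k is regular at x, with value v. *)
Definition specializes k v := exists p q : {mpoly C[m + n]},
  [/\ q.@[x] != 0, k * par q = par p & v * q.@[x] = p.@[x]].

Lemma par_eq0 (p : {mpoly C[m + n]}) : (par p == 0) = (p == 0).
Proof. exact: tofrac_eq0. Qed.

Lemma parD (p q : {mpoly C[m + n]}) : par (p + q) = par p + par q.
Proof. exact: tofracD. Qed.

Lemma parM (p q : {mpoly C[m + n]}) : par (p * q) = par p * par q.
Proof. exact: tofracM. Qed.

Lemma meval_par_neq0 (q : {mpoly C[m + n]}) : q.@[x] != 0 -> par q != 0.
Proof. by rewrite par_eq0; apply: contraNneq => ->; rewrite meval0. Qed.

Lemma specializes_par (p : {mpoly C[m + n]}) : specializes (par p) p.@[x].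
Proof.
by exists p, 1; split; rewrite ?meval1 ?mulr1 ?oner_eq0// /par tofrac1 mulr1.
Qed.

Lemma specializes0 : specializes 0 0.
Proof. by have := specializes_par 0; rewrite meval0 /par tofrac0. Qed.

Lemma specializes1 : specializes 1 1.
Proof. by have := specializes_par 1; rewrite meval1 /par tofrac1. Qed.

Lemma specializesD k v l w : specializes k v -> specializes l w -> specializes (k + l) (v + w).
Proof.
move=> [p [q [q0 kq vq]]] [p' [q' [q'0 lq wq]]].
exists (p * q' + p' * q), (q * q'); split; first by rewrite mevalM mulf_neq0.
  by rewrite parD !parM -kq -lq mulrDl; congr (_ + _); [rewrite mulrA|rewrite mulrA mulrAC].
by rewrite mevalD !mevalM -vq -wq mulrDl; congr (_ + _); [rewrite mulrA|rewrite mulrA mulrAC].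
Qed.

Lemma specializesM k v l w : specializes k v -> specializes l w -> specializes (k * l) (v * w).
Proof.
move=> [p [q [q0 kq vq]]] [p' [q' [q'0 lq wq]]].
exists (p * p'), (q * q'); rewrite !mevalM mulf_neq0// !parM; split => //.
  by rewrite mulrACA kq lq.
by rewrite mulrACA vq wq.
Qed.

Lemma specializesN k v : specializes k v -> specializes (- k) (- v).
Proof.
move=> [p [q [q0 kq vq]]]; exists (- p), q; split => //; last by rewrite mulNr vq mevalN.
by rewrite mulNr kq /par tofracN.
Qed.

Lemma specializesV k v : v != 0 -> specializes k v -> specializes k^-1 v^-1.
Proof.
move=> v0 [p [q [q0 kq vq]]]; have p0 : p.@[x] != 0 by rewrite -vq mulf_neq0.
have k0 : k != 0.
  by apply: contraTneq (meval_par_neq0 p0) => k0; rewrite -kq k0 mul0r eqxx.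
by exists q, p; split => //; [rewrite -kq mulKf|rewrite -vq mulKf].
Qed.

Lemma specializes_sum (I : Type) (r : seq I) (P : pred I) (k : I -> K) (v : I -> C) :
  (forall i, specializes (k i) (v i)) ->
  specializes (\sum_(i <- r | P i) k i) (\sum_(i <- r | P i) v i).
Proof.
move=> kv; apply: (big_rec2 (fun k v => specializes k v)); first exact: specializes0.
by move=> i v' k' _; apply: specializesD.
Qed.

Lemma specializesMn k v i : specializes k v -> specializes (k *+ i) (v *+ i).
Proof.
move=> kv; elim: i => [|i IH]; first exact: specializes0.
by rewrite !mulrS; exact: specializesD.
Qed.

(** In any presentation of 0 as p / q the numerator is 0, because [par] is injective. Uniqueness of
    values follows by taking differences. *)
Lemma specializes_0l v : specializes 0 v -> v = 0.
Proof.
move=> [p [q [q0]]]; rewrite mul0r => /esym/eqP; rewrite par_eq0 => /eqP ->.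
by rewrite meval0 => /eqP; rewrite mulf_eq0 (negbTE q0) orbF => /eqP.
Qed.

Lemma specializes_fun k v w : specializes k v -> specializes k w -> v = w.
Proof.
move=> kv kw; apply/eqP; rewrite -subr_eq0; apply/eqP/specializes_0l.
by rewrite -(subrr k); apply: specializesD => //; exact: specializesN.
Qed.

(** Links an abstract fraction to the numerator and denominator that [par_eval] reads off its
    representative; the quotient construction of the field is opened for this. *)
Lemma par_frac k : k * par \d_(repr k) = par \n_(repr k).
Proof.
rewrite -{1}[k]reprK /par; unlock FracField.tofrac.
rewrite -[LHS]FracField.pi_mul; apply/eqmodP; rewrite /= FracField.equivfE /FracField.mulf.
by rewrite !numden_Ratio ?oner_eq0// ?mulr1 ?denom_ratioP// mulrC.
Qed.

Lemma specializes_frac k : (\d_(repr k)).@[x] != 0 ->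
  specializes k ((\n_(repr k)).@[x] / (\d_(repr k)).@[x]).
Proof. by move=> d0; exists \n_(repr k), \d_(repr k); rewrite divfK// par_frac. Qed.

End Specialization.

(** * Specialisation of operators with polynomial coefficients *)

Section Support.
Import mpoly.
(** The supports of an operator, of its specialisation and of a sum of operators all differ; sums
    over them are compared after extension to a common list of monomials. *)
Lemma sum_msuppw (A : nzRingType) (V : zmodType) (m : nat) (f : A -> 'X_{1..m} -> V)
    (t : {mpoly A[m]}) (r : seq ('X_{1..m})) :
  (forall b, f 0 b = 0) -> uniq r -> {subset msupp t <= r} ->
  \sum_(b <- msupp t) f (t@_b) b = \sum_(b <- r) f (t@_b) b.
Proof.
move=> f0 ur tr; rewrite [RHS](bigID (fun b => b \in msupp t)) /= [X in _ + X]big1 ?addr0.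
  rewrite (perm_big [seq b <- r | b \in msupp t]) ?big_filter//=; apply: uniq_perm.
  - exact: msupp_uniq.
  - exact: filter_uniq.
  by move=> b; rewrite mem_filter; case: (boolP (b \in msupp t)) => //= /tr ->.
by move=> b /memN_msupp_eq0 ->.
Qed.
End Support.

Section PolynomialSpecialization.
Import mpoly.
Variables (C : fieldType) (m n : nat) (x : 'I_(m + n) -> C).
Local Notation K := (param_field C m n).
Local Notation W := (weyl K m).
Implicit Types (p q : {mpoly C[m]}) (P Q : {mpoly K[m]}) (t : {mpoly {mpoly C[m]}[m]}).

Definition poly_specializes P p := forall b, specializes x P@_b p@_b.

(** The specialised operator [t] is a bare polynomial in normal form, coefficients on the left.
    Besides sums, only left multiplication by a polynomial and by a derivation is transported to
    it. *)
Definition op_specializes (T : W) t :=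
  forall b, poly_specializes ((T : {mpoly {mpoly K[m]}[m]})@_b) t@_b.

Lemma poly_specializesD P Q p q : poly_specializes P p -> poly_specializes Q q ->
  poly_specializes (P + Q) (p + q).
Proof. by move=> Pp Qq b; rewrite !mcoeffD; exact: specializesD. Qed.

Lemma poly_specializes0 : poly_specializes 0 0.
Proof. by move=> b; rewrite !mcoeff0; exact: specializes0. Qed.

Lemma poly_specializesM P Q p q : poly_specializes P p -> poly_specializes Q q ->
  poly_specializes (P * Q) (p * q).
Proof.
move=> Pp Qq b; rewrite !(mcoeff_poly_mul _ _ (ltnSn (mdeg b))).
by apply: specializes_sum => i; apply: specializesM.
Qed.

Lemma poly_specializesC k v : specializes x k v -> poly_specializes k%:MP v%:MP.
Proof.
move=> kv b; rewrite !mcoeffC; apply: specializesM => //.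
by case: (_ == _); [exact: specializes1|exact: specializes0].
Qed.

Lemma poly_specializesX i : poly_specializes 'X_i 'X_i.
Proof.
by move=> b; rewrite !mcoeffX; case: (_ == _); [exact: specializes1|exact: specializes0].
Qed.

Lemma poly_specializes_deriv i P p : poly_specializes P p ->
  poly_specializes P^`M(i) p^`M(i).
Proof. by move=> Pp b; rewrite !mcoeff_deriv; exact: specializesMn. Qed.

Fact par_cst_is_zmod_morphism : zmod_morphism (@par_cst C m n).
Proof. by move=> a b; rewrite /par_cst mpolyCB /par tofracB. Qed.
HB.instance Definition _ :=
  GRing.isZmodMorphism.Build C K (@par_cst C m n) par_cst_is_zmod_morphism.

Lemma poly_specializes_map p : poly_specializes (map_mpoly (@par_cst C m n) p) p.
Proof.
move=> b; rewrite mcoeff_map_mpoly /par_cst.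
by have := specializes_par x (p@_b)%:MP; rewrite mevalC.
Qed.

Lemma poly_specializes_exists P :
  (forall b, exists v, specializes x P@_b v) -> exists p, poly_specializes P p.
Proof.
move=> h; rewrite [P]mpolyE; elim: (msupp P : seq _) => [|b r [p IH]].
  by exists 0; rewrite big_nil; exact: poly_specializes0.
have [v hv] := h b; exists (v *: 'X_[b] + p); rewrite big_cons.
apply: poly_specializesD => // b'; rewrite !mcoeffZ !mcoeffX; apply: specializesM => //.
by case: (_ == _); [exact: specializes1|exact: specializes0].
Qed.

Lemma op_specializes0 : op_specializes 0 0.
Proof. by move=> b; rewrite !mcoeff0; exact: poly_specializes0. Qed.

Lemma weyl_poly1 : weyl_poly 1 = 1 :> W.
Proof. exact: mpolyC1. Qed.

Lemma weyl_polyN1 : weyl_poly (-1) = -1 :> W.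
Proof. exact: etrans (mpolyCN _ _) (congr1 -%R (mpolyC1 _ _)). Qed.

Lemma op_specializes1 : op_specializes 1 1.
Proof.
rewrite -weyl_poly1 => b; rewrite /weyl_poly mcoeffC mcoeff1 mul1r.
have h1 : poly_specializes 1 1 by rewrite -!mpolyC1; apply: poly_specializesC; exact: specializes1.
by case: (_ == _); [exact: h1|exact: poly_specializes0].
Qed.

Lemma op_specializesD (T U : W) t u : op_specializes T t -> op_specializes U u ->
  op_specializes (T + U) (t + u).
Proof. by move=> Tt Uu b; rewrite !mcoeffD; exact: poly_specializesD. Qed.

Lemma op_specializes_poly P p (T : W) t : poly_specializes P p -> op_specializes T t ->
  op_specializes (weyl_poly P * T) (p *: t).
Proof.
by move=> Pp Tt b; rewrite weyl_poly_mul !mcoeffZ; exact: poly_specializesM.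
Qed.

(** Left multiplication by del_i in normal form: del_i a = a del_i + d_i(a) on each coefficient. *)
Definition partial_op i t : {mpoly {mpoly C[m]}[m]} := t * 'X_i + map_mpoly (mderiv i) t.

Lemma mcoeffMXi (A : comNzRingType) (t : {mpoly A[m]}) i b :
  (t * 'X_i)@_b = if (0 < b i)%N then t@_(b - U_(i)) else 0.
Proof.
case: ifP => [bi|bi].
  have le : (U_(i) <= b)%MM by rewrite lep1mP -lt0n.
  by rewrite -{1}(submK le) addmC mcoeffMX.
rewrite [t]mpolyE mulr_suml raddf_sum /=; apply: big1 => b' _.
rewrite -scalerAl -mpolyXD mcoeffZ mcoeffX; case: eqP => [E|]; last by rewrite mulr0.
by move: bi; rewrite -E mnmDE mnm1E eqxx addn1.
Qed.

Lemma weyl_d_mul i (T : W) : weyl_d K i * T =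
  ((T : {mpoly {mpoly K[m]}[m]}) * 'X_i + map_mpoly (mderiv i) (T : {mpoly {mpoly K[m]}[m]})).
Proof.
pose D j : {additive {mpoly K[m]} -> {mpoly K[m]}} := @mderiv m K j.
have DC j l P : D j (D l P) = D l (D j P) by exact: mderiv_comm.
have E : dop_partials D U_(i)%MM T = dop_partial D i T.
  by rewrite -[U_(i)%MM]addm0 (dop_partialsU DC) dop_partials_0.
exact: etrans (dop_mulXl _ _ _) E.
Qed.

Lemma op_specializes_d i (T : W) t : op_specializes T t ->
  op_specializes (weyl_d K i * T) (partial_op i t).
Proof.
move=> Tt b; rewrite weyl_d_mul !mcoeffD; apply: poly_specializesD.
  by rewrite !mcoeffMXi; case: ifP => _; [exact: Tt|exact: poly_specializes0].
by rewrite !mcoeff_map_mpoly; exact/poly_specializes_deriv/Tt.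
Qed.

(** A general left factor acts by derivations, one at a time, followed by multiplications by
    polynomials. Stability of annihilators under left multiplication is thereby reduced to these two
    cases. *)
Lemma weyl_mulE (a g : W) : a * g =
  \sum_(b <- msupp (a : {mpoly {mpoly K[m]}[m]})) weyl_poly (a : {mpoly {mpoly K[m]}[m]})@_b *
    foldr (fun i => iter (b i) ( *%R (weyl_d K i))) g (enum 'I_m).
Proof.
pose D j : {additive {mpoly K[m]} -> {mpoly K[m]}} := @mderiv m K j.
have E (b : 'X_{1..m}) : foldr (fun i => iter (b i) ( *%R (weyl_d K i))) g (enum 'I_m) = dop_partials D b g.
  rewrite /dop_partials; elim: (enum _) => //= i r ->.
  by elim: (b i) => //= l ->; exact: weyl_d_mul.
have h : a * g = dop_mul D a g by [].
rewrite h /dop_mul.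
(* The additive law of [weyl] is that of the polynomials, so the two sums agree by conversion. *)
transitivity (\sum_(b <- msupp (a : {mpoly {mpoly K[m]}[m]}))
    ((a : {mpoly {mpoly K[m]}[m]})@_b *: dop_partials D b g : W)).
  by exact: erefl.
by apply: eq_bigr => b _; rewrite weyl_poly_mul E.
Qed.

(** Where this polynomial does not vanish, every coefficient of [T] is regular and its value is the
    one given by [par_eval]. *)
Definition op_denominator (T : W) : {mpoly C[m + n]} :=
  \prod_(b <- msupp (T : {mpoly {mpoly K[m]}[m]}))
    \prod_(b' <- msupp (T : {mpoly {mpoly K[m]}[m]})@_b)
      \d_(repr (T : {mpoly {mpoly K[m]}[m]})@_b@_b').

Lemma op_denominator_neq0 (T : W) : op_denominator T != 0.
Proof.
rewrite /op_denominator prodf_seq_neq0; apply/allP => b _ /=.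
rewrite prodf_seq_neq0; apply/allP => b' _ /=; exact: denom_ratioP.
Qed.

Lemma specializes_coef (T : W) b b' : (op_denominator T).@[x] != 0 ->
  specializes x (T : {mpoly {mpoly K[m]}[m]})@_b@_b'
    ((\n_(repr (T : {mpoly {mpoly K[m]}[m]})@_b@_b')).@[x] /
     (\d_(repr (T : {mpoly {mpoly K[m]}[m]})@_b@_b')).@[x]).
Proof.
(* A zero coefficient contributes no factor to [op_denominator]; its chosen numerator is 0, so the
   quotient is 0 whatever its denominator is worth. *)
move=> d0; have [k0|k0] := eqVneq (T : {mpoly {mpoly K[m]}[m]})@_b@_b' 0.
  have := par_frac (T : {mpoly {mpoly K[m]}[m]})@_b@_b'.
  rewrite {1}k0 mul0r => /esym/eqP; rewrite par_eq0 => /eqP ->.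
  by rewrite meval0 mul0r k0; exact: specializes0.
apply: specializes_frac; move: d0; rewrite /op_denominator rmorph_prod /= prodf_seq_neq0.
have bs : b \in msupp (T : {mpoly {mpoly K[m]}[m]}).
  by rewrite mcoeff_msupp; apply: contraNneq k0 => ->; rewrite mcoeff0.
move=> /allP /(_ b bs) /=; rewrite rmorph_prod /= prodf_seq_neq0 => /allP /(_ b') /=.
by apply; rewrite mcoeff_msupp.
Qed.

(* The value of the operator t on a function whose partial derivatives at the
   point z are the F b. *)
Definition op_value (F : 'X_{1..m} -> C) (z : 'I_m -> C) t : C :=
  \sum_(b <- msupp t) (t@_b).@[z] * F b.

Section Value.
Variables (F : 'X_{1..m} -> C) (z : 'I_m -> C).

Lemma op_valueEw (r : seq 'X_{1..m}) t : uniq r -> {subset msupp t <= r} ->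
  op_value F z t = \sum_(b <- r) (t@_b).@[z] * F b.
Proof. by move=> ur tr; apply: (@sum_msuppw _ _ _ (fun a b => a.@[z] * F b)) => // b; rewrite meval0 mul0r. Qed.

Lemma op_valueD t u : op_value F z (t + u) = op_value F z t + op_value F z u.
Proof.
set r := undup (msupp t ++ msupp u ++ msupp (t + u)).
have ur : uniq r by exact: undup_uniq.
rewrite !(@op_valueEw r)// -?big_split/=.
- by apply: eq_bigr => b _; rewrite mcoeffD mevalD mulrDl.
all: by move=> b bs; rewrite mem_undup !mem_cat bs ?orbT.
Qed.

Lemma op_valueZ p t : op_value F z (p *: t) = p.@[z] * op_value F z t.
Proof.
rewrite (@op_valueEw (msupp t)) ?msupp_uniq//; last exact: msuppZ_le.
by rewrite mulr_sumr; apply: eq_bigr => b _; rewrite mcoeffZ mevalM mulrA.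
Qed.

Lemma op_value0 : op_value F z 0 = 0.
Proof. by rewrite /op_value msupp0 big_nil. Qed.

Lemma op_valueX b : op_value F z 'X_[b] = F b.
Proof. by rewrite /op_value msuppX big_seq1 mcoeffX eqxx meval1 mul1r. Qed.

Lemma op_value1 : op_value F z 1 = F 0%MM.
Proof. by rewrite -mpolyX0 op_valueX. Qed.

(** The product rule on symbols: if each F (U_(i) + b) is the i-th derivative of F b, the right-hand
    side is the i-th derivative of [op_value] with respect to the point z. *)
Lemma op_value_partial i t : op_value F z (partial_op i t) =
  \sum_(b <- msupp t) (((t@_b)^`M(i)).@[z] * F b + (t@_b).@[z] * F (U_(i) + b)%MM).
Proof.
have vs (I : Type) (r : seq I) (f : I -> {mpoly {mpoly C[m]}[m]}) :
    op_value F z (\sum_(a <- r) f a) = \sum_(a <- r) op_value F z (f a).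
  exact: (big_morph (op_value F z) op_valueD op_value0).
rewrite /partial_op [X in op_value _ _ X]addrC op_valueD big_split /=; congr (_ + _).
  have -> : map_mpoly (mderiv i) t = \sum_(b <- msupp t) (t@_b)^`M(i) *: 'X_[b].
    apply/mpolyP => b; rewrite mcoeff_map_mpoly {1}[t]mpolyE !raddf_sum /=.
    apply: eq_bigr => b' _; rewrite !mcoeffZ !mcoeffX.
    by case: (_ == _); rewrite ?mulr1 ?mulr0 ?raddf0.
  by rewrite vs; apply: eq_bigr => b _; rewrite op_valueZ op_valueX.
rewrite {1}[t]mpolyE mulr_suml vs; apply: eq_bigr => b _.
by rewrite -scalerAl -mpolyXD op_valueZ op_valueX addmC.
Qed.

(** Brings the action that defines [Ann] to [op_value], with [rho] in the role of [par_eval]. A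
    nonzero coefficient of [T] may specialise to 0 but a zero one specialises to nothing else, so
    the support of [T] contains that of [t]. *)
Lemma op_value_weyl (T : W) t (rho : K -> C) : op_specializes T t ->
  (forall b b', rho ((T : {mpoly {mpoly K[m]}[m]})@_b)@_b' = (t@_b)@_b') ->
  \sum_(b <- msupp (T : {mpoly {mpoly K[m]}[m]}))
    mmap rho z ((T : {mpoly {mpoly K[m]}[m]})@_b) * F b = op_value F z t.
Proof.
move=> Tt rt; rewrite (@op_valueEw (msupp (T : {mpoly {mpoly K[m]}[m]}))) ?msupp_uniq//.
  apply: eq_bigr => b _; congr (_ * _).
  set P := (T : {mpoly {mpoly K[m]}[m]})@_b.
  rewrite mevalE (@sum_msuppw _ _ _ (fun a b => a * \prod_i z i ^+ b i) _ (msupp P)).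
  - by rewrite /mmap; apply: eq_bigr => b' _; rewrite rt.
  - by move=> b'; rewrite mul0r.
  - exact: msupp_uniq.
  move=> b'; rewrite !mcoeff_msupp; apply: contraNneq => P0.
  by apply/eqP/(@specializes_0l _ _ _ x); rewrite -P0; exact: Tt.
move=> b; rewrite !mcoeff_msupp; apply: contraNneq => P0; apply/eqP/mpolyP => b'.
by rewrite mcoeff0; apply: (@specializes_0l _ _ _ x); have := Tt b b'; rewrite P0 mcoeff0.
Qed.

End Value.
End PolynomialSpecialization.

From mathcomp Require Import fingroup perm.
From mathcomp.real_closed Require Import complex.
From mathcomp Require Import all_classical all_reals all_analysis.
From mathcomp Require Import measurable_realfun ring lra.
Import Order.TTheory GRing.Theory Num.Theory numFieldNormedType.Exports.
Local Open Scope classical_set_scope.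
Local Open Scope complex_scope.
Local Open Scope ring_scope.

Lemma cvg_at (T : Type) (U V : topologicalType) (F : set_system T)
    (FF : Filter F) (f : T -> U) (g : U -> V) (y : U) :
  {for y, continuous g} -> f x @[x --> F] --> y -> g (f x) @[x --> F] --> g y.
Proof. by move=> cg cf; exact: continuous_cvg. Qed.

Lemma cvg_pair_at (T : Type) (U V : topologicalType) (F : set_system T)
    (FF : Filter F) (f : T -> U) (g : T -> V) (a : U) (b : V) :
  f x @[x --> F] --> a -> g x @[x --> F] --> b ->
  (f x, g x) @[x --> F] --> (a, b).
Proof. by move=> h1 h2; exact: (cvg_pair h1 h2). Qed.

(** * Integrals over a segment with a moving endpoint *)

Section SegIntegral.
Variable R : realType.
Implicit Types (r x : R) (f g : R -> R).
Local Notation mu := (@lebesgue_measure R).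

Definition seg_integral r f : R := \int[mu]_(x in `[0, r]) f x.

Lemma seg_integrable r f : continuous f -> mu.-integrable `[0, r] (EFin \o f).
Proof.
move=> cf; apply: continuous_compact_integrable; first exact: segment_compact.
exact: continuous_subspaceT.
Qed.

Lemma eq_seg_integral r f g : {in `[0, r], f =1 g} ->
  seg_integral r f = seg_integral r g.
Proof. by move=> fg; apply: eq_Rintegral => x; rewrite inE => /fg. Qed.

Lemma seg_integralE r f : continuous f ->
  seg_integral r f = \int[mu]_(x in `]0, r[) f x.
Proof.
move=> cf; rewrite /seg_integral /Rintegral; congr fine.
apply: integral_itv_bndoo; apply/measurable_EFinP.
apply: measurable_funTS; exact: continuous_measurable_fun.
Qed.

(** End points are negligible; this is what later allows hypotheses on the open simplex only. *)
Lemma eq_seg_integral_oo r f g : continuous f -> continuous g ->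
  (forall x, 0 < x < r -> f x = g x) -> seg_integral r f = seg_integral r g.
Proof.
move=> cf cg fg; rewrite !seg_integralE//; apply: eq_Rintegral => x.
by rewrite inE /= in_itv /= => /fg.
Qed.

Lemma seg_integralD r f g : continuous f -> continuous g ->
  seg_integral r (fun x => f x + g x) = seg_integral r f + seg_integral r g.
Proof. by move=> cf cg; apply: RintegralD => //; exact: seg_integrable. Qed.

Lemma seg_integralB r f g : continuous f -> continuous g ->
  seg_integral r (fun x => f x - g x) = seg_integral r f - seg_integral r g.
Proof. by move=> cf cg; apply: RintegralB => //; exact: seg_integrable. Qed.

Lemma seg_integralZ r k f : continuous f ->
  seg_integral r (fun x => k * f x) = k * seg_integral r f.
Proof. by move=> cf; apply: RintegralZl => //; exact: seg_integrable. Qed.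

Lemma seg_integral_neg r f : r < 0 -> seg_integral r f = 0.
Proof.
by move=> r0; rewrite /seg_integral set_itv_ge ?Rintegral_set0// bnd_simp -ltNge.
Qed.

Lemma seg_integral0 f : seg_integral 0 f = 0.
Proof. by rewrite /seg_integral set_itv1 Rintegral_set1. Qed.

(** A negative endpoint gives an empty segment and the integral 0; passing to the positive part
    brings continuity in r back to a compact interval. *)
Lemma seg_integral_max r f : seg_integral (Num.max 0 r) f = seg_integral r f.
Proof.
have [//|r0|->//] := ltgtP 0 r.
by rewrite seg_integral0 seg_integral_neg.
Qed.

Lemma seg_integral_cst r k : 0 <= r -> seg_integral r (fun=> k) = k * r.
Proof.
move=> r0; rewrite /seg_integral Rintegral_cst //= lebesgue_measure_itv /= lte_fin.
by case: ltP => [_|r0']; rewrite ?sube0//= (@le_anti _ _ r 0) ?r0 ?r0' //= mulr0.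
Qed.

Lemma seg_integral_le r f g : continuous f -> continuous g ->
  (forall x, 0 <= x <= r -> f x <= g x) -> seg_integral r f <= seg_integral r g.
Proof.
move=> cf cg fg; apply: le_Rintegral; first by [].
- exact: seg_integrable.
- exact: seg_integrable.
- by move=> x; rewrite /= in_itv; exact: fg.
Qed.

Lemma ler_norm_seg_integral r f M : 0 <= r -> continuous f ->
  (forall x, 0 <= x <= r -> `|f x| <= M) -> `|seg_integral r f| <= M * r.
Proof.
move=> r0 cf fM; apply: le_trans (_ : seg_integral r (fun x => `|f x|) <= _).
  by apply: le_normr_Rintegral => //; exact: seg_integrable.
rewrite -seg_integral_cst//; apply: seg_integral_le => //.
- by move=> x; apply: continuous_comp; [exact: cf|exact: norm_continuous].
- by move=> x; exact: cvg_cst.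
Qed.

Lemma seg_integral_ftc r f F : 0 <= r -> continuous f -> continuous F ->
  (forall x, 0 < x < r -> is_derive x 1 F (f x)) -> seg_integral r f = F r - F 0.
Proof.
rewrite le_eqVlt => /predU1P[<- _ _ _|r0 cf cF dF].
  by rewrite seg_integral0 subrr.
rewrite /seg_integral /Rintegral (@continuous_FTC2 _ f F)//.
- exact: continuous_subspaceT.
- split; first by move=> x; rewrite in_itv/= => /dF[].
  + by apply: cvg_at_right_filter; exact: cF.
  + by apply: cvg_at_left_filter; exact: cF.
- by move=> x; rewrite in_itv/= => /dF[_ <-]; rewrite derive1E.
Qed.

(** This reflection is the one-dimensional case of exchanging the slack variable of a simplex with a
    coordinate. *)
Lemma seg_integral_rev r f : continuous f ->
  seg_integral r (fun x => f (r - x)) = seg_integral r f.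
Proof.
move=> cf; have [r0|r0] := ltP r 0; first by rewrite !seg_integral_neg.
have cr : continuous (fun x => r - x).
  by move=> x; apply: cvgB; [exact: cvg_cst|exact: cvg_id].
move: r0; rewrite le_eqVlt => /predU1P[<-|r0]; first by rewrite !seg_integral0.
have dr : derive1 (fun x => r - x) = fun=> -1.
  by apply/funext => y; rewrite derive1E deriveB// derive_cst derive_id sub0r.
rewrite /seg_integral [RHS]/Rintegral.
have := @integration_by_substitution_decreasing R (fun x => r - x) f 0 r (ltW r0).
rewrite subr0 subrr dr => -> //.
- rewrite /Rintegral; congr fine; apply: eq_integral => x _ /=.
  by congr (_%:E); rewrite !fctE /= opprK mulr1.
- by move=> x y _ _ xy; rewrite ltrD2l ltrN2.
- by move=> x _; exact: cvg_cst.
- exact: is_cvg_cst.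
- exact: is_cvg_cst.
- split; first by move=> x _; exact: derivableB.
  + by apply: cvg_at_right_filter; exact: cr.
  + by apply: cvg_at_left_filter; exact: cr.
- exact: continuous_subspaceT.
Qed.

(** Compactness of a segment containing all nearby ones makes the integrand uniformly close in the
    parameter, and the dependence on the endpoint is that of a primitive. Joint continuity is
    required because the slices of a corner change size with the parameter. *)
Lemma seg_integral_continuous (T : topologicalType) (g : T * R -> R) :
  continuous g -> continuous (fun p : T * R => seg_integral p.2 (fun x => g (p.1, x))).
Proof.
move=> cg [p0 r0] /=; apply/cvgrPdist_lt => e e0 /=.
(* [Rm] dominates every endpoint within distance 1 of [r0]. *)
set Rm := `|r0| + 1; pose K : set R := `[0, Rm]%classic.
have Rm0 : 0 < Rm by rewrite ltr_wpDl.
have cgp p : continuous (fun x => g (p, x)).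
  move=> x; apply: (@cvg_at _ _ _ (nbhs x) _ (fun x => (p, x)) g (p, x)).
    exact: cg.
  by apply: cvg_pair_at; [exact: cvg_cst|exact: cvg_id].
have eR : 0 < e / 2 / (Rm + 1) by rewrite !divr_gt0// ltr_wpDl// ltW.
have nearp : \forall p \near p0, forall x, K x ->
    `|g (p0, x) - g (p, x)| < e / 2 / (Rm + 1).
  have /compact_near_coveringP cK : compact K by exact: segment_compact.
  apply: (cK _ (nbhs p0) (fun p x => `|g (p0, x) - g (p, x)| < e / 2 / (Rm + 1))).
  move=> x _.
  (* Both values are compared with g (p0, x) at the centre of the covering neighbourhood, hence the
     further halving. *)
  have h1 : \forall z \near (x, p0), `|g (p0, x) - g (z.2, z.1)| < e / 2 / (Rm + 1) / 2.
    have : (fun z : R * T => g (z.2, z.1)) z @[z --> (x, p0)] --> g (p0, x).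
      apply: (@cvg_at _ _ _ (nbhs (x, p0)) _ (fun z : R * T => (z.2, z.1)) g (p0, x)).
        exact: cg.
      by apply: cvg_pair_at; [exact: cvg_snd|exact: cvg_fst].
    by move/cvgrPdist_lt; apply; rewrite divr_gt0.
  have h2 : \forall z \near (x, p0), `|g (p0, x) - g (p0, z.1)| < e / 2 / (Rm + 1) / 2.
    have : (fun z : R * T => g (p0, z.1)) z @[z --> (x, p0)] --> g (p0, x).
      apply: (@cvg_at _ _ _ (nbhs (x, p0)) _ (fun z : R * T => z.1) (fun x => g (p0, x)) x).
        exact: cgp.
      exact: cvg_fst.
    by move/cvgrPdist_lt; apply; rewrite divr_gt0.
  apply: (filterS _ (filterI h1 h2)) => -[x' p] /= [h h'].
  rewrite (splitr (_ / (Rm + 1))).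
  rewrite (_ : g (p0, x') - g (p, x') =
    (g (p0, x) - g (p, x')) - (g (p0, x) - g (p0, x'))); last by ring.
  by rewrite (le_lt_trans (ler_normB _ _))// ltrD.
have near1 : \forall r \near r0, `|r0 - r| < 1.
    by have /cvgrPdist_lt /(_ _ ltr01) : r @[r --> r0] --> r0 by exact: cvg_id.
have nearr : \forall r \near r0,
    `|seg_integral r0 (fun x => g (p0, x)) - seg_integral r (fun x => g (p0, x))| < e / 2.
  have := @parameterized_integral_continuous R 0 Rm (fun x => g (p0, x)) (ltW Rm0)
    (@seg_integrable _ _ (cgp p0)).
  move/subspace_continuousP => /(_ (Num.max 0 r0)) cI.
  have KR : `[0, Rm]%classic (Num.max 0 r0).
    rewrite /= in_itv /= le_max lexx /= ge_max (ltW Rm0) /=.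
    by rewrite (le_trans (ler_norm _))// lerDl.
  have := cI KR => /cvgrPdist_lt /(_ (e / 2)); rewrite divr_gt0// => /(_ isT).
  rewrite near_withinE => nI.
  have cm : Num.max 0 r @[r --> r0] --> Num.max 0 r0.
    by apply: (@continuous_max _ _ (fun=> 0) id); [exact: cvg_cst|exact: cvg_id].
  have := cm _ nI; rewrite nbhs_filterE /= => nI'.
  apply: (filterS _ (filterI nI' near1)) => r /= [h hr].
  rewrite -(seg_integral_max r0) -(seg_integral_max r); apply: h.
  rewrite /= in_itv /= le_max lexx /= ge_max (ltW Rm0) /=.
  rewrite (le_trans (ler_norm _))// -[r](subrK r0) addrC (le_trans (ler_normD _ _))//.
  by rewrite lerD2l ltW// distrC.
have n2 : \forall z \near (p0, r0), (forall x, K x ->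
    `|g (p0, x) - g (z.1, x)| < e / 2 / (Rm + 1)) by exact: cvg_fst nearp.
have n3 : \forall z \near (p0, r0), `|seg_integral r0 (fun x => g (p0, x)) -
  seg_integral z.2 (fun x => g (p0, x))| < e / 2 by exact: cvg_snd nearr.
have n4 : \forall z \near (p0, r0), `|r0 - z.2| < 1 by exact: cvg_snd near1.
apply: (filterS _ (filterI n2 (filterI n3 n4))) => -[p r] /= [hp [hr h1]].
rewrite (splitr e) -[X in X - _](subrK (seg_integral r (fun x => g (p0, x)))) -addrA.
rewrite (le_lt_trans (ler_normD _ _))// ltrD//.
have [rn|r0'] := ltP r 0; first by rewrite !seg_integral_neg// subrr normr0 divr_gt0.
have rRm : r <= Rm.
  rewrite (le_trans (ler_norm _))// -[r](subrK r0) addrC (le_trans (ler_normD _ _))//.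
  by rewrite lerD2l ltW// distrC.
rewrite -seg_integralB//.
apply: le_lt_trans (_ : e / 2 / (Rm + 1) * r < _).
  apply: ler_norm_seg_integral => //.
    by move=> x; apply: cvgB; exact: cgp.
  move=> x /andP[x0 xr]; apply/ltW/hp; rewrite /K /= in_itv /= x0 /=.
  exact: le_trans xr rRm.
rewrite mulrAC ltr_pdivrMr ?ltr_wpDl ?(ltW Rm0)// ltr_pM2l ?divr_gt0//.
by rewrite (le_lt_trans rRm)// ltrDl.
Qed.

End SegIntegral.

(** * Fubini's theorem on a triangle *)

Section TriangleFubini.
Variable R : realType.
Local Notation mu := (@lebesgue_measure R).
Local Notation RT := (measurableTypeR R).

(** An open set is the countable union of the rational boxes that it contains, and boxes are
    measurable for the product sigma-algebra. *)
Lemma open_measurable_pair (U : set (R * R)) : open U -> measurable (U : set (RT * RT)).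
Proof.
move=> oU; pose B (q : rat * rat * (rat * rat)) : set (R * R) :=
  `]ratr q.1.1, ratr q.1.2[%classic `*` `]ratr q.2.1, ratr q.2.2[%classic.
have -> : U = \bigcup_q (if `[< B q `<=` U >] then B q else set0).
  apply/seteqP; split => [[x y] Uxy|z [q _]]; last first.
    by case: asboolP => // sU /sU.
  have : nbhs (x, y) U by apply: open_nbhs_nbhs; split.
  move=> [[A1 A2] /= [/nbhs_ballP[e1 /= e10 b1] /nbhs_ballP[e2 /= e20 b2]] sU].
  have sq (a e : R) : 0 < e -> exists q1 q2 : rat,
      (a \in `]ratr q1, ratr q2[%R) /\ (forall b, (b \in `]ratr q1, ratr q2[%R) -> ball a e b).
    move=> e0.
    have ae : a - e < a by rewrite ltrBlDr ltrDl.
    have ea : a < a + e by rewrite ltrDl.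
    have [q1] := rat_in_itvoo ae; have [q2] := rat_in_itvoo ea.
    rewrite !in_itv /= => /andP[h1 h2] /andP[h3 h4]; exists q1, q2; rewrite in_itv /= h1 h4.
    split=> // b; rewrite in_itv /= => /andP[h5 h6].
    rewrite -ball_normE /= ltr_distlC; apply/andP; split; [exact: lt_trans h5|exact: lt_trans h2].
  have [q1 [q2 [h1 h2]]] := sq x _ e10; have [q3 [q4 [h3 h4]]] := sq y _ e20.
  exists ((q1, q2), (q3, q4)) => //; case: asboolP => [_|[]]; first by split.
  by move=> [a b] [/= Ba Bb]; apply: sU; split => /=; [apply/b1/h2|apply/b2/h4].
apply: countable_bigcupT_measurable; first exact: countableP.
by move=> q; case: asboolP => // _; apply: measurableX; exact: measurable_itv.
Qed.

Lemma closed_measurable_pair (U : set (R * R)) : closed U -> measurable (U : set (RT * RT)).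
Proof.
by move=> cU; rewrite -[U]setCK; apply: measurableC; apply: open_measurable_pair; exact: closed_openC.
Qed.

Lemma continuous_measurable_pair (h : R * R -> R) : continuous h ->
  measurable_fun setT (h : RT * RT -> RT).
Proof.
move=> /continuousP ch; apply: (measurability _ (RGenOpens.measurableE R)).
move=> _ [_ [a [b ->] <-]]; rewrite setTI; apply: open_measurable_pair.
exact/ch/interval_open.
Qed.

Definition triangle (r : R) : set (R * R) :=
  [set z | [&& 0 <= z.1, 0 <= z.2 & z.1 + z.2 <= r]].

Lemma triangle_closed r : closed (triangle r).
Proof.
have -> : triangle r = [set z : R * R | 0 <= z.1] `&` ([set z | 0 <= z.2] `&`
    [set z | z.1 + z.2 <= r]).
  by apply/seteqP; split => z; rewrite /triangle /=; [move=> /and3P[]|move=> [? [? ?]]; apply/and3P].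
have c1 : closed ((@fst R R) @^-1` [set x | 0 <= x]).
  by apply: preimage_closed => [z _|]; [exact: cvg_fst|exact: closed_ge].
have c2 : closed ((@snd R R) @^-1` [set x | 0 <= x]).
  by apply: preimage_closed => [z _|]; [exact: cvg_snd|exact: closed_ge].
have c3 : closed ((fun z : R * R => z.1 + z.2) @^-1` [set x | x <= r]).
  apply: preimage_closed => [z _|]; last exact: closed_le.
  by apply: cvgD; [exact: cvg_fst|exact: cvg_snd].
exact: closedI c1 (closedI c2 c3).
Qed.

Lemma triangle_sub r : triangle r `<=` `[0, r]%classic `*` `[0, r]%classic.
Proof.
move=> [x y] /= /and3P[x0 y0 xy]; split; rewrite /= in_itv /= ?x0 ?y0 /=.
- by rewrite (le_trans _ xy)// lerDl.
- by rewrite (le_trans _ xy)// lerDr.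
Qed.

(** The function cut off by the closed triangle lives on the whole plane, where Fubini's theorem
    applies; it is bounded, by compactness of the square, on a set of finite measure. *)
Lemma triangle_integrable (h : R * R -> R) r : continuous h ->
  (mu \x mu)%E.-integrable setT (EFin \o (h \_ (triangle r)) : RT * RT -> \bar R).
Proof.
move=> ch; have mT : measurable (triangle r : set (RT * RT)).
  exact: closed_measurable_pair (@triangle_closed r).
have : (mu \x mu)%E.-integrable (triangle r : set (RT * RT)) (EFin \o (h : RT * RT -> R)).
  apply: measurable_bounded_integrable => //.
  - have rfin : ((mu \x mu) (`[0%R, r]%classic `*` `[0%R, r]%classic : set (RT * RT)) < +oo)%E.
      rewrite product_measure1E; try exact: measurable_itv.
      rewrite /= lebesgue_measure_itv /=; case: ifP => _; last by rewrite mule0 ltry.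
      by rewrite -EFinB -EFinM ltry.
    apply: le_lt_trans rfin.
      apply: le_measure; rewrite ?inE//; last exact: triangle_sub.
      by apply: measurableX; exact: measurable_itv.
  - apply: measurable_funTS; exact: continuous_measurable_pair.
  - have : compact (h @` (`[0, r]%classic `*` `[0, r]%classic)).
      apply: continuous_compact; first exact: continuous_subspaceT.
      by apply: compact_setX; exact: segment_compact.
    move=> /compact_bounded [M [Mr hM]]; exists M; split => // x Mx z Tz.
    by apply: (hM _ Mx); exists z => //; exact: triangle_sub.
by move/(integrable_mkcond _ mT); rewrite restrict_EFin.
Qed.

Let iterE (h : R * R -> R) r : continuous h ->
  seg_integral r (fun x => seg_integral (r - x) (fun y => h (x, y))) =
  fine (\int[mu]_x \int[mu]_y ((h \_ (triangle r)) (x, y))%:E).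
Proof.
move=> ch; rewrite /seg_integral {1}/Rintegral integral_mkcond; congr fine.
apply: eq_integral => x _; rewrite /patch; case: ifPn => [|nx].
  rewrite inE /= in_itv /= => /andP[x0 xr].
  rewrite /Rintegral fineK; last first.
    apply: integrable_fin_num => //; apply: seg_integrable => y.
    apply: (@cvg_at _ _ _ (nbhs y) _ (fun y => (x, y)) h (x, y)); first exact: ch.
    by apply: cvg_pair_at; [exact: cvg_cst|exact: cvg_id].
  rewrite integral_mkcond; apply: eq_integral => y _; rewrite /patch.
  have -> : (y \in `[0, r - x]%classic) = ((x, y) \in triangle r).
    by apply/idP/idP; rewrite !inE /triangle /= in_itv /= x0 /= lerBrDl.
  by case: ifP.
rewrite integral0_eq// => y _; case: ifP => //; rewrite inE => /triangle_sub [/= xr _].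
by move: nx; rewrite notin_setE.
Qed.

Lemma triangle_fubini (h : R * R -> R) r : continuous h ->
  seg_integral r (fun x => seg_integral (r - x) (fun y => h (x, y))) =
  seg_integral r (fun y => seg_integral (r - y) (fun x => h (x, y))).
Proof.
move=> ch; rewrite iterE// (iterE (h := fun z => h (z.2, z.1))); last first.
  move=> z; apply: (@cvg_at _ _ _ (nbhs z) _ (fun z => (z.2, z.1)) h (z.2, z.1)); first exact: ch.
  by apply: cvg_pair_at; [exact: cvg_snd|exact: cvg_fst].
congr fine.
have /= -> := @Fubini _ _ _ _ _ _ _ _ (triangle_integrable r ch).
apply: eq_integral => y _; apply: eq_integral => x _; congr (_%:E).
rewrite /patch; have -> : ((x, y) \in triangle r) = ((y, x) \in triangle r).
  by apply/idP/idP; rewrite !inE /triangle /= addrC; move=> /and3P[-> -> ->].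
by [].
Qed.

End TriangleFubini.

(** * Row vectors: insertion, exchange of coordinates, continuity *)

Section RowVectors.
Variable K : pzRingType.

(** [vcons] is convertible to the concatenations inside [corner_integral] and [bary], and [vins] at
    the value 0 to [face]; later proofs rely on both. *)
Definition vcons (N : nat) (x : K) (t : 'rV[K]_N) : 'rV[K]_N.+1 := row_mx x%:M t.
Definition vtail (N : nat) (t : 'rV[K]_N.+1) : 'rV[K]_N := \row_j t 0 (lift ord0 j).
Definition vins (N : nat) (k : 'I_N.+1) (x : K) (t : 'rV[K]_N) : 'rV[K]_N.+1 :=
  \row_j (if unlift k j is Some l then t 0 l else x).
Definition swap01 (N : nat) (z : 'rV[K]_N.+2) : 'rV[K]_N.+2 :=
  vcons (z 0 (lift ord0 ord0)) (vcons (z 0 ord0) (vtail (vtail z))).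

Lemma vcons0 N x (t : 'rV[K]_N) : vcons x t 0 ord0 = x.
Proof.
rewrite /vcons (_ : ord0 = lshift N (ord0 : 'I_1)); last exact: val_inj.
by apply: etrans (row_mxEl _ _ _ _) _; rewrite mxE eqxx mulr1n.
Qed.

Lemma vconsS N x (t : 'rV[K]_N) j : vcons x t 0 (lift ord0 j) = t 0 j.
Proof.
rewrite /vcons (_ : lift ord0 j = rshift 1 j); last exact: val_inj.
exact: row_mxEr.
Qed.

Lemma vinsE N (k : 'I_N.+1) x (t : 'rV[K]_N) : vins k x t 0 k = x.
Proof. by rewrite mxE unlift_none. Qed.

Lemma vinsS N (k : 'I_N.+1) x (t : 'rV[K]_N) j : vins k x t 0 (lift k j) = t 0 j.
Proof. by rewrite mxE liftK. Qed.

Lemma eq_rVS N (s t : 'rV[K]_N.+1) : s 0 ord0 = t 0 ord0 ->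
  (forall j, s 0 (lift ord0 j) = t 0 (lift ord0 j)) -> s = t.
Proof.
move=> h0 hS; apply/rowP => j; have [i ->|->] := unliftP ord0 j; [exact: hS|exact: h0].
Qed.

Lemma vconsK N x (t : 'rV[K]_N) : vtail (vcons x t) = t.
Proof. by apply/rowP => j; rewrite mxE vconsS. Qed.

Lemma vcons_tail N (z : 'rV[K]_N.+1) : vcons (z 0 ord0) (vtail z) = z.
Proof. by apply: eq_rVS; [rewrite vcons0|move=> j; rewrite vconsS mxE]. Qed.

Lemma vins0 N x (t : 'rV[K]_N) : vins ord0 x t = vcons x t.
Proof. by apply: eq_rVS; [rewrite vinsE vcons0|move=> j; rewrite vinsS vconsS]. Qed.

Lemma vins_cons N (k : 'I_N.+1) x y (t : 'rV[K]_N) :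
  vins (lift ord0 k) x (vcons y t) = vcons y (vins k x t).
Proof.
apply/rowP => j; have [i ->|->] := unliftP (lift ord0 k) j; last first.
  by rewrite vinsE vconsS vinsE.
rewrite vinsS; have [l ->|->] := unliftP ord0 i.
  have -> : lift (lift ord0 k) (lift ord0 l) = lift ord0 (lift k l).
    by apply: val_inj; rewrite /= /bump !leq0n !add1n ltnS addnS.
  by rewrite !vconsS vinsS.
have -> : lift (lift ord0 k) (ord0 : 'I_N.+1) = ord0 by apply: val_inj.
by rewrite !vcons0.
Qed.

Lemma swap01E N x y (t : 'rV[K]_N) : swap01 (vcons x (vcons y t)) = vcons y (vcons x t).
Proof. by rewrite /swap01 vconsS !vcons0 !vconsK. Qed.

Lemma sum_vcons N x (t : 'rV[K]_N) : \sum_j vcons x t 0 j = x + \sum_j t 0 j.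
Proof.
by rewrite big_ord_recl vcons0; congr (_ + _); apply: eq_bigr => j _; rewrite vconsS.
Qed.

Lemma vconsD N x y (s t : 'rV[K]_N) : vcons x s + vcons y t = vcons (x + y) (s + t).
Proof.
by apply: eq_rVS => [|j]; rewrite mxE !(vcons0, vconsS)// mxE.
Qed.

Lemma vconsZ N k x (t : 'rV[K]_N) : k *: vcons x t = vcons (k * x) (k *: t).
Proof.
by apply: eq_rVS => [|j]; rewrite mxE !(vcons0, vconsS)// mxE.
Qed.

Lemma delta_vcons0 N : delta_mx 0 ord0 = vcons 1 (0 : 'rV[K]_N).
Proof.
by apply: eq_rVS => [|j]; rewrite mxE !(vcons0, vconsS)// mxE.
Qed.

Lemma delta_vconsS N (k : 'I_N) : delta_mx 0 (lift ord0 k) = vcons 0 (delta_mx 0 k : 'rV[K]_N).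
Proof.
apply: eq_rVS => [|j]; rewrite mxE !(vcons0, vconsS) //= !mxE.
by rewrite (inj_eq (@lift_inj _ ord0)).
Qed.
End RowVectors.

Section RowContinuity.
Variable K : numFieldType.

Lemma cvg_rV (T : Type) (F : set_system T) (FF : Filter F) N (f : T -> 'rV[K]_N)
    (l : 'rV[K]_N) :
  (forall j, f x 0 j @[x --> F] --> l 0 j) -> f x @[x --> F] --> l.
Proof.
move=> fl A [P lP PA].
have : \forall x \near F, forall j, P 0 j (f x 0 j).
  by apply: filter_forall => j; apply: (fl j); exact: lP.
apply: filterS => x hx; apply: PA => i j; rewrite ord1; exact: hx.
Qed.

Lemma cvg_coord (T : Type) (F : set_system T) (FF : Filter F) N (f : T -> 'rV[K]_N)
    (l : 'rV[K]_N) j : f x @[x --> F] --> l -> f x 0 j @[x --> F] --> l 0 j.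
Proof.
by move=> fl; apply: (@cvg_at _ _ _ F _ f (fun v => v 0 j) l) => //; exact: coord_continuous.
Qed.

Lemma cvg_vcons (T : Type) (F : set_system T) (FF : Filter F) N (a : T -> K)
    (f : T -> 'rV[K]_N) (x : K) (l : 'rV[K]_N) :
  a x @[x --> F] --> x -> f x @[x --> F] --> l ->
  vcons (a x) (f x) @[x --> F] --> vcons x l.
Proof.
move=> ax fl; apply: cvg_rV => j; have [i ->|->] := unliftP ord0 j.
  by rewrite vconsS; under eq_fun do rewrite vconsS; exact: cvg_coord.
by rewrite vcons0; under eq_fun do rewrite vcons0.
Qed.

Lemma cvg_vins (T : Type) (F : set_system T) (FF : Filter F) N k (a : T -> K)
    (f : T -> 'rV[K]_N) (x : K) (l : 'rV[K]_N) :
  a x @[x --> F] --> x -> f x @[x --> F] --> l ->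
  vins k (a x) (f x) @[x --> F] --> vins k x l.
Proof.
move=> ax fl; apply: cvg_rV => j; have [i ->|->] := unliftP k j.
  by rewrite vinsS; under eq_fun do rewrite vinsS; exact: cvg_coord.
by rewrite vinsE; under eq_fun do rewrite vinsE.
Qed.

Lemma cvg_bigsum (T : Type) (F : set_system T) (FF : Filter F) (V : normedModType K)
    (I : Type) (r : seq I) (P : pred I) (f : I -> T -> V) (l : I -> V) :
  (forall i, P i -> f i x @[x --> F] --> l i) ->
  \sum_(i <- r | P i) f i x @[x --> F] --> \sum_(i <- r | P i) l i.
Proof.
move=> fl; elim: r => [|i r IH].
  by rewrite big_nil; under eq_fun do rewrite big_nil; exact: cvg_cst.
rewrite big_cons; under eq_fun do rewrite big_cons.
by case: (boolP (P i)) => // Pi; apply: cvgD => //; exact: fl.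
Qed.

Lemma cvg_bigprod (T : Type) (F : set_system T) (FF : Filter F)
    (I : Type) (r : seq I) (P : pred I) (f : I -> T -> K) (l : I -> K) :
  (forall i, P i -> f i x @[x --> F] --> l i) ->
  \prod_(i <- r | P i) f i x @[x --> F] --> \prod_(i <- r | P i) l i.
Proof.
move=> fl; elim: r => [|i r IH].
  by rewrite big_nil; under eq_fun do rewrite big_nil; exact: cvg_cst.
rewrite big_cons; under eq_fun do rewrite big_cons.
by case: (boolP (P i)) => // Pi; apply: cvgM => //; exact: fl.
Qed.

Lemma cvg_sum_coord (T : Type) (F : set_system T) (FF : Filter F) N (f : T -> 'rV[K]_N)
    (l : 'rV[K]_N) : f x @[x --> F] --> l ->
  \sum_j f x 0 j @[x --> F] --> \sum_j l 0 j.
Proof.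
by move=> fl; apply: (@cvg_bigsum _ _ _ K^o) => j _; exact: cvg_coord.
Qed.

Lemma sum_coord_continuous N : continuous (fun z : 'rV[K]_N => \sum_j z 0 j).
Proof. by move=> z; apply: (@cvg_sum_coord _ _ (nbhs_filter z)); exact: cvg_id. Qed.

Lemma vcons_slack_continuous N (r : K) :
  continuous (fun z : 'rV[K]_N => vcons (r - \sum_j z 0 j) z).
Proof.
move=> z; apply: (@cvg_vcons _ _ (nbhs_filter z)); last exact: cvg_id.
apply: (@cvgB _ _ _ _ (nbhs_filter z)); first exact: cvg_cst.
exact: sum_coord_continuous.
Qed.

Lemma swap01_continuous N : continuous (@swap01 K N).
Proof.
move=> z; apply: (@cvg_vcons _ _ (nbhs_filter z)); first exact: coord_continuous.
apply: (@cvg_vcons _ _ (nbhs_filter z)); first exact: coord_continuous.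
apply: (@cvg_rV _ _ (nbhs_filter z)) => j; rewrite !mxE.
by under eq_fun do rewrite !mxE; exact: coord_continuous.
Qed.

Lemma vins_continuous N k (x : K) : continuous (@vins K N k x).
Proof.
by move=> z; apply: (@cvg_vins _ _ (nbhs_filter z)); [exact: cvg_cst|exact: cvg_id].
Qed.

Lemma vcons_continuous N : continuous (fun p : K * 'rV[K]_N => vcons p.1 p.2).
Proof.
by move=> z; apply: (@cvg_vcons _ _ (nbhs_filter z)); [exact: cvg_fst|exact: cvg_snd].
Qed.
End RowContinuity.

Lemma continuous_compose (T U V : topologicalType) (f : T -> U) (g : U -> V) :
  continuous f -> continuous g -> continuous (fun x => g (f x)).
Proof.
by move=> cf cg x; apply: (@cvg_at _ _ _ (nbhs x) _ f g); [exact: cg|exact: cf].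
Qed.

(** A directional derivative sees its function along one line only, so it can be transported between
    spaces by any map that is affine on that line: slices, faces and barycentric coordinates are
    treated this way. *)
Lemma eq_is_derive_line (R : numFieldType) (V1 V2 W : normedModType R)
    (f : V1 -> W) (g : V2 -> W) (t v : V1) (s w : V2) (d : W) :
  (forall h : R, f (h *: v + t) = g (h *: w + s)) ->
  is_derive s w g d -> is_derive t v f d.
Proof.
move=> fg gd; have fs : f t = g s by have := fg 0; rewrite !scale0r !add0r.
have E : (fun h : R => h^-1 *: ((f \o shift t) (h *: v) - f t)) =
         (fun h : R => h^-1 *: ((g \o shift s) (h *: w) - g s)).
  by apply/funext => h /=; rewrite fg fs.
case: gd => [dg eg]; split; first by move: dg; rewrite /derivable E.
by rewrite -eg /derive E.
Qed.

Lemma fst_continuous2 (T U : topologicalType) : continuous (@fst T U).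
Proof. by move=> z; exact: cvg_fst. Qed.

Lemma snd_continuous2 (T U : topologicalType) : continuous (@snd T U).
Proof. by move=> z; exact: cvg_snd. Qed.

(** * Integration over the corner simplex and its divergence theorem *)

Section Corner.
Variable R : realType.
Local Notation CI N := (@corner_integral R N).

Local Arguments corner_integral : simpl never.

Definition corner (N : nat) (r : R) : set 'rV[R]_N :=
  [set t : 'rV[R]_N | (forall i, 0 <= t 0 i) /\ \sum_i t 0 i <= r].
Definition corner_int (N : nat) (r : R) : set 'rV[R]_N :=
  [set t : 'rV[R]_N | (forall i, 0 < t 0 i) /\ \sum_i t 0 i < r].

Lemma corner_integral0 r f : CI 0 r f = f 0.
Proof. by []. Qed.

Lemma corner_integralS N r f :
  CI N.+1 r f = seg_integral r (fun x => CI N (r - x) (fun t => f (vcons x t))).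
Proof. by []. Qed.

Lemma corner_vcons N r x (t : 'rV[R]_N) : 0 <= x -> corner (r - x) t -> corner r (vcons x t).
Proof.
move=> x0 [t0 tr]; split; last by rewrite sum_vcons -lerBrDl.
by move=> i; have [j ->|->] := unliftP ord0 i; rewrite ?vconsS ?vcons0.
Qed.

Lemma corner_int_vcons N r x (t : 'rV[R]_N) :
  0 < x -> corner_int (r - x) t -> corner_int r (vcons x t).
Proof.
move=> x0 [t0 tr]; split; last by rewrite sum_vcons -ltrBrDl.
by move=> i; have [j ->|->] := unliftP ord0 i; rewrite ?vconsS ?vcons0.
Qed.

Lemma eq_corner_integral N r (f g : 'rV[R]_N -> R) : 0 <= r ->
  (forall t, corner r t -> f t = g t) -> CI N r f = CI N r g.
Proof.
elim: N r f g => [|N IH] r f g r0 fg.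
  by apply: fg; split => [[]//|]; rewrite big_ord0.
rewrite !corner_integralS; apply: eq_seg_integral => x; rewrite in_itv /= => /andP[x0 xr].
apply: IH; first by rewrite subr_ge0.
by move=> t rt; apply: fg; exact: corner_vcons.
Qed.

(** The parameter space varies in the induction: the first coordinate joins it while the remaining
    ones are integrated. *)
Lemma corner_integral_continuous N (T : topologicalType) (f : T * 'rV[R]_N -> R) :
  continuous f -> continuous (fun p : T * R => CI N p.2 (fun t => f (p.1, t))).
Proof.
elim: N T f => [|N IH] T f cf.
  have c1 : continuous (fun p : T * R => (p.1, 0 : 'rV[R]_0)).
    by move=> p; apply: (@cvg_pair_at _ _ _ _ (nbhs_filter p)); [exact: cvg_fst|exact: cvg_cst].
  exact: (continuous_compose c1 cf).
pose g (q : (T * R) * R) := CI N (q.1.2 - q.2) (fun t => f (q.1.1, vcons q.2 t)).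
have c3 : continuous (fun p : T * R => (p, p.2)).
  by move=> p; apply: (@cvg_pair_at _ _ _ _ (nbhs_filter p)); [exact: cvg_id|exact: cvg_snd].
suff cg : continuous g by exact: (continuous_compose c3 (seg_integral_continuous cg)).
pose f' (q : (T * R) * 'rV[R]_N) := f (q.1.1, vcons q.1.2 q.2).
have cf' : continuous f'.
  have c1 : continuous (fun q : (T * R) * 'rV[R]_N => (q.1.1, vcons q.1.2 q.2)).
    move=> q; have FF := nbhs_filter q.
    have q1 : q.1 @[q --> q] --> q.1 by exact: cvg_fst.
    apply: (@cvg_pair_at _ _ _ _ FF).
      exact: (continuous_compose (@fst_continuous2 _ _) (@fst_continuous2 _ _)).
    apply: (@cvg_vcons _ _ _ FF); last exact: cvg_snd.
    exact: (continuous_compose (@fst_continuous2 _ _) (@snd_continuous2 _ _)).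
  exact: (continuous_compose c1 cf).
have c2 : continuous (fun q : (T * R) * R => ((q.1.1, q.2), q.1.2 - q.2)).
  move=> q; have FF := nbhs_filter q.
  have q1 : q.1 @[q --> q] --> q.1 by exact: cvg_fst.
  have q2 : q.2 @[q --> q] --> q.2 by exact: cvg_snd.
  apply: (@cvg_pair_at _ _ _ _ FF).
    apply: (@cvg_pair_at _ _ _ _ FF) => //.
    by exact: (continuous_compose (@fst_continuous2 _ _) (@fst_continuous2 _ _)).
  apply: (@cvgB _ _ _ _ FF) => //.
  by exact: (continuous_compose (@fst_continuous2 _ _) (@snd_continuous2 _ _)).
exact: (continuous_compose c2 (IH _ _ cf')).
Qed.

Lemma vcons_fst_continuous N (x : R) : continuous (fun t : 'rV[R]_N => vcons x t).
Proof.
by move=> t; apply: (@cvg_vcons _ _ _ (nbhs_filter t)); [exact: cvg_cst|exact: cvg_id].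
Qed.

Lemma corner_slice_continuous N r (f : 'rV[R]_N.+1 -> R) : continuous f ->
  continuous (fun x => CI N (r - x) (fun t => f (vcons x t))).
Proof.
move=> cf; have c2 : continuous (fun x : R => (x, r - x)).
  move=> x; apply: (@cvg_pair_at _ _ _ _ (nbhs_filter x)); first exact: cvg_id.
  by apply: (@cvgB _ _ _ _ (nbhs_filter x)); [exact: cvg_cst|exact: cvg_id].
have := continuous_compose (@vcons_continuous R N) cf.
by move=> /(@corner_integral_continuous N _) => /(continuous_compose c2).
Qed.

Lemma eq_corner_integral_int N r (f g : 'rV[R]_N -> R) : 0 < r ->
  continuous f -> continuous g ->
  (forall t, corner_int r t -> f t = g t) -> CI N r f = CI N r g.
Proof.
elim: N r f g => [|N IH] r f g r0 cf cg fg.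
  by apply: fg; split => [[]//|]; rewrite big_ord0.
rewrite !corner_integralS; apply: eq_seg_integral_oo; try exact: corner_slice_continuous.
move=> x /andP[x0 xr]; have vc := @vcons_fst_continuous N x.
apply: IH; [by rewrite subr_gt0|exact: (continuous_compose vc cf)|
  exact: (continuous_compose vc cg)|].
by move=> t rt; apply: fg; exact: corner_int_vcons.
Qed.

Lemma corner_integralD N r (f g : 'rV[R]_N -> R) : continuous f -> continuous g ->
  CI N r (fun t => f t + g t) = CI N r f + CI N r g.
Proof.
elim: N r f g => [|N IH] r f g cf cg //.
rewrite !corner_integralS -seg_integralD; try exact: corner_slice_continuous.
apply: eq_seg_integral => x _; have vc := @vcons_fst_continuous N x.
by rewrite -IH//; [exact: (continuous_compose vc cf)|exact: (continuous_compose vc cg)].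
Qed.

Lemma corner_integralZ N r k (f : 'rV[R]_N -> R) : continuous f ->
  CI N r (fun t => k * f t) = k * CI N r f.
Proof.
elim: N r f => [|N IH] r f cf //.
rewrite !corner_integralS -seg_integralZ; try exact: corner_slice_continuous.
apply: eq_seg_integral => x _; have vc := @vcons_fst_continuous N x.
by rewrite -IH//; exact: (continuous_compose vc cf).
Qed.

Lemma corner_integralB N r (f g : 'rV[R]_N -> R) : continuous f -> continuous g ->
  CI N r (fun t => f t - g t) = CI N r f - CI N r g.
Proof.
move=> cf cg; rewrite -[X in _ - X]mul1r -mulNr -corner_integralZ// -corner_integralD//.
  by congr (CI N r _); apply/funext => t; rewrite mulN1r.
by move=> t; apply: (@cvgM _ _ _ (nbhs_filter t)); [exact: cvg_cst|exact: cg].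
Qed.

(** The hypothesis r <= 1 keeps the factor contributed by each integration below 1. *)
Lemma ler_norm_corner_integral N r (f : 'rV[R]_N -> R) M : 0 <= r <= 1 -> continuous f ->
  (forall t, corner r t -> `|f t| <= M) -> `|CI N r f| <= M.
Proof.
elim: N r f => [|N IH] r f /andP[r0 r1] cf fM.
  by apply: fM; split => [[]//|]; rewrite big_ord0.
have M0 : 0 <= M.
  apply: le_trans (fM 0 _) => //; split => [i|]; first by rewrite mxE.
  by rewrite big1// => i _; rewrite mxE.
rewrite corner_integralS; apply: le_trans (_ : M * r <= _); last first.
  by rewrite -[leRHS]mulr1 ler_wpM2l.
apply: ler_norm_seg_integral => //; first exact: corner_slice_continuous.
move=> x /andP[x0 xr]; apply: IH; first by rewrite subr_ge0 xr (le_trans _ r1)// gerBl.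
  by have vc := @vcons_fst_continuous N x; exact: (continuous_compose vc cf).
by move=> t ct; apply: fM; exact: corner_vcons.
Qed.

(** The two outer integrations run over a triangle, and the inner integral is a continuous function
    of both variables, so Fubini's theorem exchanges them. *)
Lemma corner_integral_swap N r (f : 'rV[R]_N.+2 -> R) : continuous f ->
  CI N.+2 r f = CI N.+2 r (fun z => f (swap01 z)).
Proof.
move=> cf.
pose h (z : R * R) := CI N (r - z.1 - z.2) (fun t => f (vcons z.1 (vcons z.2 t))).
have ch : continuous h.
  pose f' (q : (R * R) * 'rV[R]_N) := f (vcons q.1.1 (vcons q.1.2 q.2)).
  have cf' : continuous f'.
    have c1 : continuous (fun q : (R * R) * 'rV[R]_N => vcons q.1.1 (vcons q.1.2 q.2)).
      move=> q; have FF := nbhs_filter q.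
      have q1 : q.1 @[q --> q] --> q.1 by exact: cvg_fst.
      apply: (@cvg_vcons _ _ _ FF).
        exact: (continuous_compose (@fst_continuous2 _ _) (@fst_continuous2 _ _)).
      apply: (@cvg_vcons _ _ _ FF); last exact: cvg_snd.
      exact: (continuous_compose (@fst_continuous2 _ _) (@snd_continuous2 _ _)).
    exact: (continuous_compose c1 cf).
  have c2 : continuous (fun z : R * R => (z, r - z.1 - z.2)).
    move=> z; have FF := nbhs_filter z.
    apply: (@cvg_pair_at _ _ _ _ FF); first exact: cvg_id.
    apply: (@cvgB _ _ _ _ FF); last exact: cvg_snd.
    by apply: (@cvgB _ _ _ _ FF); [exact: cvg_cst|exact: cvg_fst].
  exact: (continuous_compose c2 (corner_integral_continuous cf')).
have := triangle_fubini r ch; rewrite /h /= => E.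
rewrite corner_integralS; under eq_fun do rewrite corner_integralS.
rewrite E [RHS]corner_integralS; under [in RHS]eq_fun do rewrite corner_integralS.
congr (seg_integral r _); apply/funext => x; congr (seg_integral _ _); apply/funext => y.
rewrite addrAC; congr (CI N _ _); apply/funext => t.
by rewrite swap01E.
Qed.

(** Symmetry of the simplex in the slack variable and the first coordinate. In dimension one it is
    the reflection of the segment. Otherwise a coordinate not involved is brought to the front by
    [corner_integral_swap], and induction applies on its slices, where the slack is relative to r -
    x. *)
Lemma corner_integral_slack N r (f : 'rV[R]_N.+2 -> R) : continuous f ->
  CI N.+1 r (fun z => f (vcons (r - \sum_j z 0 j) z)) =
  CI N.+1 r (fun z => f (swap01 (vcons (r - \sum_j z 0 j) z))).
Proof.
elim: N r f => [|N IH] r f cf.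
  rewrite !corner_integralS /= -seg_integral_rev; last first.
    apply: (@corner_slice_continuous 0 r (fun z => f (vcons (r - \sum_j z 0 j) z))).
    exact: (continuous_compose (@vcons_slack_continuous _ _ r) cf).
  congr (seg_integral r _); apply/funext => x.
  by rewrite !corner_integral0 swap01E !sum_vcons !big_ord0 !addr0 opprB addrC subrK.
have cs := @vcons_slack_continuous R N.+2 r.
have sw := @swap01_continuous R.
rewrite corner_integral_swap; last exact: (continuous_compose cs cf).
rewrite [RHS]corner_integral_swap; last first.
  exact: (continuous_compose (continuous_compose cs (sw _)) cf).
rewrite !corner_integralS; congr (seg_integral r _); apply/funext => x.
pose g (z : 'rV[R]_N.+2) := f (vcons (z 0 ord0) (swap01 (vcons x (vtail z)))).
have cg : continuous g.
  have vt : continuous (fun z : 'rV[R]_N.+2 => vtail z).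
    move=> z; apply: (@cvg_rV _ _ _ (nbhs_filter z)) => j; rewrite mxE.
    by under eq_fun do rewrite mxE; exact: coord_continuous.
  have c1 : continuous (fun z : 'rV[R]_N.+2 => vcons x (vtail z)).
    exact: (continuous_compose vt (@vcons_fst_continuous _ x)).
  have c2 : continuous (fun z : 'rV[R]_N.+2 => swap01 (vcons x (vtail z))).
    exact: (continuous_compose c1 (sw _)).
  have c3 : continuous (fun z : 'rV[R]_N.+2 => vcons (z 0 ord0) (swap01 (vcons x (vtail z)))).
    move=> z; apply: (@cvg_vcons _ _ _ (nbhs_filter z)); first exact: coord_continuous.
    exact: c2.
  exact: (continuous_compose c3 cf).
have := IH (r - x) g cg; rewrite /g.
have E (z : 'rV[R]_N.+1) : r - \sum_j swap01 (vcons x z) 0 j = r - x - \sum_j z 0 j.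
  by rewrite -(vcons_tail z) swap01E !sum_vcons; ring.
have -> : (fun z : 'rV[R]_N.+1 => f (vcons (vcons (r - x - \sum_j z 0 j) z 0 ord0)
    (swap01 (vcons x (vtail (vcons (r - x - \sum_j z 0 j) z)))))) =
  (fun z => f (vcons (r - \sum_j swap01 (vcons x z) 0 j) (swap01 (vcons x z)))).
  by apply/funext => z; rewrite vcons0 vconsK E.
move=> ->; congr (CI _ _ _); apply/funext => z; rewrite E -(vcons_tail z).
move: (r - x - _) => s; rewrite !swap01E !vcons0 !vconsK swap01E.
by [].
Qed.

(** Integration along t_k leaves the slanted face minus the face t_k = 0; slicing by the first
    coordinate reduces the dimension down to a segment, where the fundamental theorem of calculus
    applies. The slanted face is parametrised without coordinate 0 whatever k is, and the symmetries
    of the simplex reconcile the parametrisations. *)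
Lemma corner_divergence N (k : 'I_N.+1) r (V W : 'rV[R]_N.+1 -> R) : 0 <= r ->
  continuous V -> continuous W ->
  (forall t, corner_int r t -> is_derive t (delta_mx 0 k) V (W t)) ->
  CI N.+1 r W = CI N r (fun y => V (vcons (r - \sum_j y 0 j) y))
              - CI N r (fun y => V (vins k 0 y)).
Proof.
elim: N k r V W => [|N IH] k r V W r0 cV cW dV.
  rewrite (ord1 k) in dV *; rewrite corner_integralS !corner_integral0 big_ord0 subr0 vins0.
  have vc0 : continuous (fun x : R => vcons x (0 : 'rV[R]_0)).
    by move=> x; apply: (@cvg_vcons _ _ _ (nbhs_filter x)); [exact: cvg_id|exact: cvg_cst].
  apply: (@seg_integral_ftc _ r _ (fun x => V (vcons x 0))) => //.
  - exact: (continuous_compose vc0 cW).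
  - exact: (continuous_compose vc0 cV).
  move=> x /andP[x0 xr]; apply: (@eq_is_derive_line _ _ _ _ _ V _ _ (vcons x 0) (delta_mx 0 ord0)).
    move=> h; rewrite delta_vcons0 vconsZ vconsD scaler0 addr0.
    by congr (V (vcons (_ + _) _)).
  apply: dV; split => [i|]; last by rewrite sum_vcons big_ord0 addr0.
  by rewrite (ord1 i) vcons0.
have cs := @vcons_slack_continuous R N.+1 r.
have sw := @swap01_continuous R N.
(* Slices by coordinate 0 solve for coordinate 1 on the slanted face, hence the [swap01] in the face
   term. *)
have step k' (V' W' : 'rV[R]_N.+2 -> R) : continuous V' -> continuous W' ->
    (forall t, corner_int r t -> is_derive t (delta_mx 0 (lift ord0 k')) V' (W' t)) ->
    CI N.+2 r W' = CI N.+1 r (fun y => V' (swap01 (vcons (r - \sum_j y 0 j) y)))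
      - CI N.+1 r (fun y => V' (vins (lift ord0 k') 0 y)).
  move=> cV' cW' dV'; rewrite -corner_integralB; last 2 first.
  - exact: (continuous_compose (continuous_compose cs sw) cV').
  - exact: (continuous_compose (@vins_continuous _ _ _ _) cV').
  rewrite [RHS]corner_integralS [LHS]corner_integralS; apply: eq_seg_integral_oo.
  - exact: corner_slice_continuous.
  - apply: (@corner_slice_continuous N r (fun y : 'rV[R]_N.+1 =>
      V' (swap01 (vcons (r - \sum_j y 0 j) y)) - V' (vins (lift ord0 k') 0 y))) => t.
    apply: (@cvgB _ _ _ _ (nbhs_filter t)).
      exact: (continuous_compose (continuous_compose cs sw) cV').
    exact: (continuous_compose (@vins_continuous _ _ _ _) cV').
  move=> x /andP[x0 xr]; have vc := @vcons_fst_continuous N.+1 x.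
  have hd t : corner_int (r - x) t ->
      is_derive t (delta_mx 0 k') (fun t => V' (vcons x t)) (W' (vcons x t)).
    move=> ct; apply: (@eq_is_derive_line _ _ _ _ _ V' _ _ (vcons x t) (delta_mx 0 (lift ord0 k'))).
      by move=> h; rewrite delta_vconsS vconsZ vconsD mulr0 add0r.
    by apply: dV'; exact: corner_int_vcons.
  have rx0 : 0 <= r - x by rewrite subr_ge0 ltW.
  rewrite (IH k' (r - x) _ _ rx0 (continuous_compose vc cV') (continuous_compose vc cW') hd).
  have vcN := @vcons_fst_continuous N.
  rewrite -corner_integralB; last 2 first.
  - exact: (continuous_compose (continuous_compose (@vcons_slack_continuous R N (r - x)) vc) cV').
  - exact: (continuous_compose (continuous_compose (@vins_continuous _ _ _ _) vc) cV').
  congr (CI N _ _); apply/funext => t.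
  by rewrite swap01E sum_vcons vins_cons opprD addrA.
have [k' ek|ek] := unliftP ord0 k.
  rewrite corner_integral_slack// ek; apply: step => // t ct.
  by rewrite -ek; exact: dV.
(* Direction 0 is turned into direction 1 by exchanging the two coordinates. *)
rewrite corner_integral_swap//.
have hd t : corner_int r t ->
    is_derive t (delta_mx 0 (lift ord0 ord0)) (fun z => V (swap01 z)) (W (swap01 t)).
  move=> [t0 tr]; apply: (@eq_is_derive_line _ _ _ _ _ V _ _ (swap01 t) (delta_mx 0 k)).
    move=> h; rewrite ek delta_vcons0 delta_vconsS delta_vcons0 -[t in LHS]vcons_tail.
    rewrite -[vtail t]vcons_tail !vconsZ !vconsD swap01E.
    by rewrite !scaler0 !add0r mulr0 add0r mxE.
  apply: dV; move: t0 tr; rewrite -(vcons_tail t) -(vcons_tail (vtail t)) swap01E.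
  move=> t0 tr; split; last by move: tr; rewrite !sum_vcons addrCA.
  move=> i; have [j ->|->] := unliftP ord0 i; last first.
    by have := t0 (lift ord0 ord0); rewrite vcons0 vconsS vcons0.
  have [l ->|->] := unliftP ord0 j; last by have := t0 ord0; rewrite vconsS !vcons0.
  by have := t0 (lift ord0 (lift ord0 l)); rewrite !vconsS.
rewrite (step ord0 _ _ (continuous_compose sw cV) (continuous_compose sw cW) hd).
have sK (z : 'rV[R]_N.+2) : swap01 (swap01 z) = z.
  by rewrite -(vcons_tail z) -(vcons_tail (vtail z)) !swap01E.
have -> : (fun y : 'rV[R]_N.+1 => V (swap01 (swap01 (vcons (r - \sum_j y 0 j) y)))) =
    (fun y => V (vcons (r - \sum_j y 0 j) y)).
  by apply/funext => z; rewrite sK.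
have -> : (fun y : 'rV[R]_N.+1 => V (swap01 (vins (lift ord0 ord0) 0 y))) =
    (fun y => V (vins k 0 y)).
  apply/funext => z; rewrite -(vcons_tail z).
  by rewrite vins_cons vins0 swap01E ek vins0.
by [].
Qed.

End Corner.

(** * Limits of complex-valued functions *)

Section ComplexLimits.
Variable R : realType.
Local Notation C := R[i].
Local Notation Re := (@complex.Re R).
Local Notation Im := (@complex.Im R).
Implicit Types z w : C.

Lemma normcE z : `|z| = (Num.sqrt (Re z ^+ 2 + Im z ^+ 2))%:C.
Proof. by case: z. Qed.

Lemma gt0_realC (e : C) : 0 < e -> exists2 r : R, 0 < r & e = r%:C.
Proof. by case: e => a b; rewrite ltcE /= => /andP[/eqP -> a0]; exists a. Qed.

Lemma cvg_complexP (T : Type) (F : set_system T) (FF : Filter F) (f : T -> C) (l : C) :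
  f x @[x --> F] --> l <->
  (Re (f x) @[x --> F] --> Re l /\ Im (f x) @[x --> F] --> Im l).
Proof.
split.
  move=> /cvgrPdist_lt fl; split; apply/cvgrPdist_lt => e e0.
    have := fl e%:C; rewrite ltcR => /(_ e0); apply: filterS => x.
    rewrite normcE ltcR; apply: le_lt_trans; rewrite -raddfB /= -sqrtr_sqr ler_wsqrtr//.
    by rewrite lerDl sqr_ge0.
  have := fl e%:C; rewrite ltcR => /(_ e0); apply: filterS => x.
  rewrite normcE ltcR; apply: le_lt_trans; rewrite -raddfB /= -sqrtr_sqr ler_wsqrtr//.
  by rewrite lerDr sqr_ge0.
move=> [/cvgrPdist_lt fR /cvgrPdist_lt fI]; apply/cvgrPdist_lt => _ /gt0_realC[e e0 ->].
have e2 : 0 < e / 2 by rewrite divr_gt0.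
apply: (filterS _ (filterI (fR _ e2) (fI _ e2))) => x [/= h1 h2].
rewrite normcE ltcR; apply: le_lt_trans (_ : `|Re (l - f x)| + `|Im (l - f x)| < e).
  rewrite -[leRHS]ger0_norm ?addr_ge0// -sqrtr_sqr ler_wsqrtr//.
  rewrite sqrrD !real_normK ?num_real// -addrA addrCA addrC lerDl mulrn_wge0// mulr_ge0.
by rewrite (splitr e) ltrD// raddfB.
Qed.

Lemma Re_continuous : continuous (Re : C -> R).
Proof. by move=> z; have [] := (cvg_complexP (nbhs_filter z) id z).1 cvg_id. Qed.

Lemma Im_continuous : continuous (Im : C -> R).
Proof. by move=> z; have [] := (cvg_complexP (nbhs_filter z) id z).1 cvg_id. Qed.

Lemma realC_continuous : continuous (fun r : R => r%:C : C).
Proof.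
by move=> r; apply/(cvg_complexP (nbhs_filter r)); split; [exact: cvg_id|exact: cvg_cst].
Qed.

Lemma ReIm_norm z : `|Re z|%:C <= `|z| /\ `|Im z|%:C <= `|z|.
Proof.
by split; rewrite normcE lecR -sqrtr_sqr ler_wsqrtr// ?lerDl ?lerDr sqr_ge0.
Qed.

Lemma norm_ReIm z : `|z| <= (`|Re z| + `|Im z|)%:C.
Proof.
rewrite normcE lecR -[leRHS]ger0_norm ?addr_ge0// -sqrtr_sqr ler_wsqrtr//.
by rewrite sqrrD !real_normK ?num_real// -addrA addrCA addrC lerDl mulrn_wge0// mulr_ge0.
Qed.

End ComplexLimits.

(** * Continuity on the closed corner *)

Section CornerContinuous.
Variable R : realType.
Local Notation C := R[i].
Local Notation Re := (@complex.Re R).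
Local Notation Im := (@complex.Im R).

(* A record rather than a definition: unfolding it makes unification diverge. *)
Record corner_continuous (N : nat) (T : topologicalType) (f : 'rV[R]_N -> T) : Prop :=
  CornerContinuous { corner_cvg : forall t, corner 1 t ->
    f u @[u --> within (corner 1) (nbhs t)] --> f t }.

(** Positive parts divided by the maximum of 1 and their sum: a continuous retraction of the whole
    space onto the corner of size 1. *)
Definition retract (N : nat) (t : 'rV[R]_N) : 'rV[R]_N :=
  (Num.max 1 (\sum_i Num.max 0 (t 0 i)))^-1 *: (\row_i Num.max 0 (t 0 i)).

Lemma retract_continuous N : continuous (@retract N).
Proof.
have cm (T : topologicalType) (f g : T -> R) : continuous f -> continuous g ->
    continuous (fun x => Num.max (f x) (g x)).
  by move=> cf cg x; apply: (@continuous_max _ _ f g); [exact: cf|exact: cg].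
have cp (i : 'I_N) : continuous (fun t : 'rV[R]_N => Num.max 0 (t 0 i)).
  by apply: (cm _ (fun=> 0) (fun t : 'rV[R]_N => t 0 i)); [exact: cst_continuous|exact: coord_continuous].
have cM : continuous (fun t : 'rV[R]_N => Num.max 1 (\sum_i Num.max 0 (t 0 i))).
  apply: (cm _ (fun=> 1)); first exact: cst_continuous.
  by move=> t; apply: (@cvg_bigsum _ _ _ (nbhs_filter t) R^o) => i _; exact: cp.
move=> t; apply: (@cvg_rV _ _ _ (nbhs_filter t)) => j; rewrite !mxE.
under eq_fun do rewrite !mxE.
apply: (@cvgM _ _ _ (nbhs_filter t)); last exact: cp.
apply: (@cvgV _ _ _ (nbhs_filter t)); last exact: cM.
by rewrite gt_eqF// lt_max ltr01.
Qed.

Lemma retract_corner N (t : 'rV[R]_N) : corner 1 (retract t).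
Proof.
have M0 : 0 < Num.max 1 (\sum_i Num.max 0 (t 0 i)) by rewrite lt_max ltr01.
split => [i|]; first by rewrite !mxE mulr_ge0 ?invr_ge0 ?(ltW M0)// le_max lexx.
under eq_bigr do rewrite !mxE; rewrite -mulr_sumr ler_pdivrMl// mulr1.
by rewrite le_max lexx orbT.
Qed.

Lemma retract_id N (t : 'rV[R]_N) : corner 1 t -> retract t = t.
Proof.
move=> [t0 t1]; have E i : Num.max 0 (t 0 i) = t 0 i by rewrite max_r.
rewrite /retract; under eq_bigr do rewrite E.
rewrite max_l// invr1 scale1r; apply/rowP => i; by rewrite mxE E.
Qed.

Lemma retract_comp_continuous N (T : topologicalType) (f : 'rV[R]_N -> T) :
  corner_continuous f -> continuous (fun t => f (retract t)).
Proof.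
move=> cf t A fA; have h := corner_cvg cf (retract_corner t) fA.
have h' : nbhs t [set u | corner 1 (retract u) -> A (f (retract u))].
  exact: (retract_continuous h).
by apply: (filterS _ h') => u /= hu; apply: hu; exact: retract_corner.
Qed.

Lemma corner_continuous_cvg N (T : topologicalType) (f : 'rV[R]_N -> T) :
  (forall t, corner 1 t -> {for t, continuous f}) -> corner_continuous f.
Proof. by move=> cf; split=> t ct; apply: cvg_within_filter; exact: cf. Qed.

Lemma corner_continuous_comp N (T U : topologicalType) (f : 'rV[R]_N -> T) (g : T -> U) :
  corner_continuous f -> (forall t, corner 1 t -> {for f t, continuous g}) ->
  corner_continuous (fun t => g (f t)).
Proof.
move=> cf cg; split=> t ct; apply: (@cvg_at _ _ _ _ (within_filter _ (nbhs_filter t)) f g (f t)).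
  exact: cg.
exact: (corner_cvg cf ct).
Qed.

Lemma corner_continuous_cst N (T : topologicalType) (c : T) :
  corner_continuous (fun _ : 'rV[R]_N => c).
Proof. by split=> t _; exact: cvg_cst. Qed.

Lemma corner_continuousD N (f g : 'rV[R]_N -> C) : corner_continuous f ->
  corner_continuous g -> corner_continuous (fun t => f t + g t).
Proof.
move=> cf cg; split=> t ct; apply: (@cvgD _ C _ _ (within_filter _ (nbhs_filter t))).
  exact: (corner_cvg cf ct).
exact: (corner_cvg cg ct).
Qed.

Lemma corner_continuousB N (f g : 'rV[R]_N -> C) : corner_continuous f ->
  corner_continuous g -> corner_continuous (fun t => f t - g t).
Proof.
move=> cf cg; split=> t ct; apply: (@cvgB _ C _ _ (within_filter _ (nbhs_filter t))).
  exact: (corner_cvg cf ct).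
exact: (corner_cvg cg ct).
Qed.

Lemma corner_continuousM N (f g : 'rV[R]_N -> C) : corner_continuous f ->
  corner_continuous g -> corner_continuous (fun t => f t * g t).
Proof.
move=> cf cg; split=> t ct; apply: (@cvgM C _ _ (within_filter _ (nbhs_filter t))).
  exact: (corner_cvg cf ct).
exact: (corner_cvg cg ct).
Qed.

Lemma corner_continuousV N (f : 'rV[R]_N -> C) : corner_continuous f ->
  (forall t, corner 1 t -> f t != 0) -> corner_continuous (fun t => (f t)^-1).
Proof.
move=> cf f0; split=> t ct; apply: (@cvgV C _ _ (within_filter _ (nbhs_filter t))).
  exact: f0.
exact: (corner_cvg cf ct).
Qed.

Lemma corner_continuous_sum N (I : Type) (r : seq I) (P : pred I)
    (f : I -> 'rV[R]_N -> C) : (forall i, P i -> corner_continuous (f i)) ->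
  corner_continuous (fun t => \sum_(i <- r | P i) f i t).
Proof.
move=> cf; split=> t ct; apply: (@cvg_bigsum _ _ _ (within_filter _ (nbhs_filter t)) C) => i Pi.
exact: (corner_cvg (cf i Pi) ct).
Qed.

Lemma corner_continuous_prod N (I : Type) (r : seq I) (P : pred I)
    (f : I -> 'rV[R]_N -> C) : (forall i, P i -> corner_continuous (f i)) ->
  corner_continuous (fun t => \prod_(i <- r | P i) f i t).
Proof.
move=> cf; split=> t ct; apply: (@cvg_bigprod C _ _ (within_filter _ (nbhs_filter t))) => i Pi.
exact: (corner_cvg (cf i Pi) ct).
Qed.

Lemma corner_continuousX N (f : 'rV[R]_N -> C) k : corner_continuous f ->
  corner_continuous (fun t => f t ^+ k).
Proof.
move=> cf; split=> t ct; elim: k => [|k IH].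
  by under eq_fun do rewrite expr0; exact: cvg_cst.
rewrite exprS; under eq_fun do rewrite exprS.
by apply: (@cvgM C _ _ (within_filter _ (nbhs_filter t))); [exact: (corner_cvg cf ct)|exact: IH].
Qed.

Lemma corner_continuous_det N (p : nat) (M : 'rV[R]_N -> 'M[C]_p) :
  (forall i j, corner_continuous (fun t => M t i j)) ->
  corner_continuous (fun t => \det (M t)).
Proof.
move=> cM; rewrite /determinant; apply: corner_continuous_sum => s _.
apply: corner_continuousM; first exact: corner_continuous_cst.
by apply: corner_continuous_prod => i _; exact: cM.
Qed.

Lemma corner_continuous_reparam N M (T : topologicalType) (f : 'rV[R]_M -> T)
    (g : 'rV[R]_N -> 'rV[R]_M) : corner_continuous f -> continuous g ->
  (forall t, corner 1 t -> corner 1 (g t)) -> corner_continuous (fun t => f (g t)).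
Proof.
move=> cf cg gc; split=> t ct A fA; have h := corner_cvg cf (gc _ ct) fA.
have h' : nbhs t [set u | corner 1 (g u) -> A (f (g u))] by exact: (cg t _ h).
by apply: (filterS _ h') => u /= hu cu; apply: hu; exact: gc.
Qed.

End CornerContinuous.

(** * Integrals of complex functions over the simplex *)

Section SimplexIntegral.
Variable R : realType.
Local Notation C := R[i].
Local Notation Re := (@complex.Re R).
Local Notation Im := (@complex.Im R).
Variable N : nat.
Local Notation SI := (@simplex_integral R N).
Implicit Types f g : 'rV[R]_N -> C.

Let ReC f : corner_continuous f -> continuous (fun t => Re (f (retract t))).
Proof.
move=> cf; apply: (@continuous_compose _ _ _ (fun t => f (retract t)) Re).
  exact: retract_comp_continuous.
exact: Re_continuous.
Qed.

Let ImC f : corner_continuous f -> continuous (fun t => Im (f (retract t))).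
Proof.
move=> cf; apply: (@continuous_compose _ _ _ (fun t => f (retract t)) Im).
  exact: retract_comp_continuous.
exact: Im_continuous.
Qed.

(** The iterated integral visits the corner only, so the integrand may be replaced by its continuous
    extension through the retraction. *)
Lemma simplex_integral_retract f : SI f =
  corner_integral 1 (fun t => Re (f (retract t)))
  +i* corner_integral 1 (fun t => Im (f (retract t))).
Proof.
by rewrite /simplex_integral; congr (_ +i* _); apply: eq_corner_integral => // t ct;
  rewrite retract_id.
Qed.

Lemma eq_simplex_integral_corner f g : (forall t, corner 1 t -> f t = g t) -> SI f = SI g.
Proof.
by move=> fg; rewrite /simplex_integral; congr (_ +i* _); apply: eq_corner_integral => // t ct;
  rewrite fg.
Qed.

Lemma corner_int_sub r (t : 'rV[R]_N) : corner_int r t -> corner r t.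
Proof. by move=> [t0 t1]; split => [i|]; exact: ltW. Qed.

Lemma eq_simplex_integral f g : corner_continuous f -> corner_continuous g ->
  (forall t, corner_int 1 t -> f t = g t) -> SI f = SI g.
Proof.
move=> cf cg fg; rewrite !simplex_integral_retract.
by congr (_ +i* _); apply: eq_corner_integral_int; rewrite ?ltr01//;
  do ?[exact: ReC|exact: ImC]; move=> t ct; rewrite retract_id ?fg//; exact: corner_int_sub.
Qed.

Lemma simplex_integralD f g : corner_continuous f -> corner_continuous g ->
  SI (fun t => f t + g t) = SI f + SI g.
Proof.
move=> cf cg; rewrite !simplex_integral_retract.
rewrite (_ : (_ +i* _) + _ = (corner_integral 1 (fun t => Re (f (retract t))) +
  corner_integral 1 (fun t => Re (g (retract t)))) +i* (corner_integral 1
  (fun t => Im (f (retract t))) + corner_integral 1 (fun t => Im (g (retract t)))))//.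
rewrite -!corner_integralD; [|exact: ImC|exact: ImC|exact: ReC|exact: ReC].
by congr (_ +i* _); congr (corner_integral 1 _); apply/funext => t; rewrite raddfD.
Qed.

Lemma simplex_integralZ (k : C) f : corner_continuous f ->
  SI (fun t => k * f t) = k * SI f.
Proof.
move=> cf; rewrite !simplex_integral_retract; case: k => a b.
rewrite (_ : (a +i* b) * _ = (a * corner_integral 1 (fun t => Re (f (retract t))) -
  b * corner_integral 1 (fun t => Im (f (retract t)))) +i* (a * corner_integral 1
  (fun t => Im (f (retract t))) + b * corner_integral 1 (fun t => Re (f (retract t)))))//.
have cZ (c : R) (h : 'rV[R]_N -> R) : continuous h -> continuous (fun t => c * h t).
  by move=> ch t; apply: (@cvgM _ _ _ (nbhs_filter t)); [exact: cvg_cst|exact: ch].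
rewrite -!corner_integralZ; [|exact: ReC|exact: ImC|exact: ImC|exact: ReC].
rewrite -corner_integralB; [|exact/cZ/ReC|exact/cZ/ImC].
rewrite -corner_integralD; [|exact/cZ/ImC|exact/cZ/ReC].
by congr (_ +i* _); congr (corner_integral 1 _); apply/funext => t; case: (f _).
Qed.

Lemma simplex_integral0 : SI (fun=> 0 : C) = 0 :> C.
Proof.
have := @simplex_integralZ 0 (fun=> 0) (@corner_continuous_cst R N C 0).
rewrite [X in _ = X]mul0r => E; rewrite -[RHS]E; congr (SI _).
by apply/funext => t; rewrite mulr0.
Qed.

Lemma simplex_integralN f : corner_continuous f -> SI (fun t => - f t) = - SI f.
Proof.
move=> cf; rewrite -mulN1r -simplex_integralZ//.
by congr (SI _); apply/funext => t; rewrite mulN1r.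
Qed.

Lemma simplex_integralB f g : corner_continuous f -> corner_continuous g ->
  SI (fun t => f t - g t) = SI f - SI g.
Proof.
move=> cf cg; rewrite -simplex_integralN// -simplex_integralD//.
rewrite (_ : (fun t => - g t) = (fun t => 0 - g t)).
  exact: corner_continuousB (@corner_continuous_cst R N C 0) cg.
by apply/funext => t; rewrite sub0r.
Qed.

Lemma simplex_integral_sum (I : Type) (r : seq I) (P : pred I) (f : I -> 'rV[R]_N -> C) :
  (forall i, P i -> corner_continuous (f i)) ->
  SI (fun t => \sum_(i <- r | P i) f i t) = \sum_(i <- r | P i) SI (f i).
Proof.
move=> cf; elim: r => [|i r IH].
  by rewrite big_nil -[RHS]simplex_integral0; congr (SI _); apply/funext => t; rewrite big_nil.
rewrite big_cons; case: ifPn => Pi.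
  rewrite -IH -simplex_integralD; [|exact: cf|exact: corner_continuous_sum].
  by congr (SI _); apply/funext => t; rewrite big_cons Pi.
by rewrite -IH; congr (SI _); apply/funext => t; rewrite big_cons (negbTE Pi).
Qed.

(** Real and imaginary parts are bounded separately, each by M, hence the doubled constant. *)
Lemma ler_norm_simplex_integral f (M : R) : corner_continuous f ->
  (forall t, corner 1 t -> `|f t| <= M%:C) -> `|SI f| <= (M + M)%:C.
Proof.
move=> cf fM; rewrite simplex_integral_retract; apply: le_trans (norm_ReIm _) _.
rewrite lecR /= lerD// ler_norm_corner_integral ?ler01 ?lexx//.
- exact: ReC.
- move=> t ct; rewrite -lecR retract_id//; apply: le_trans (fM _ ct).
  by have [] := ReIm_norm (f t).
- exact: ImC.
- move=> t ct; rewrite -lecR retract_id//; apply: le_trans (fM _ ct).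
  by have [] := ReIm_norm (f t).
Qed.

Lemma corner_continuous_bounded f : corner_continuous f ->
  exists2 M : R, 0 < M & forall t, corner 1 t -> `|f t| <= M%:C.
Proof.
move=> cf; pose K := [set v : 'rV[R]_N | forall i, `[0, 1]%classic (v 0 i)].
have cK : compact K by apply: (@rV_compact R N (fun=> `[0, 1]%classic)) => i; exact: segment_compact.
have cornerK t : corner 1 t -> K t.
  move=> [t0 t1] i; rewrite /= in_itv /= t0 /= (le_trans _ t1)//.
  by rewrite (bigD1 i)//= lerDl sumr_ge0.
have bd (h : 'rV[R]_N -> R) : continuous h ->
    exists2 M : R, 0 < M & forall t, corner 1 t -> `|h t| <= M.
  move=> ch; have : compact (h @` K).
    by apply: continuous_compact => //; exact: continuous_subspaceT.
  move=> /compact_bounded [M [_ hM]]; exists (`|M| + 1); first by rewrite ltr_wpDl.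
  move=> t ct; apply: (hM (`|M| + 1)); first by rewrite (le_lt_trans (ler_norm _))// ltrDl.
  by exists t => //; exact: cornerK.
have [M1 M10 h1] := bd _ (ReC cf); have [M2 M20 h2] := bd _ (ImC cf).
exists (M1 + M2); first exact: addr_gt0.
move=> t ct; apply: le_trans (norm_ReIm _) _; rewrite lecR lerD//.
  by have := h1 _ ct; rewrite retract_id.
by have := h2 _ ct; rewrite retract_id.
Qed.

End SimplexIntegral.

(** * Directional derivatives of complex-valued functions and the chain rule *)

Section ComplexDerivative.
Variable R : realType.
Local Notation C := R[i].
Local Notation Re := (@complex.Re R).
Local Notation Im := (@complex.Im R).
Variable V : normedModType R.
Implicit Types (t v : V) (f g : V -> C).

(** Directions are real while values are complex: [V] is a space over the reals, and each component
    is differentiated. *)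
Definition is_cderive t v f (d : C) : Prop :=
  is_derive t v (fun u => Re (f u)) (Re d) /\ is_derive t v (fun u => Im (f u)) (Im d).

Lemma is_cderive_cst t v c : is_cderive t v (fun=> c) 0.
Proof. by split; exact: is_derive_cst. Qed.

Lemma is_cderiveD t v f g d e : is_cderive t v f d -> is_cderive t v g e ->
  is_cderive t v (fun u => f u + g u) (d + e).
Proof.
move=> [f1 f2] [g1 g2]; split; rewrite raddfD /=.
  rewrite (_ : (fun u => _) = (fun u => Re (f u)) + (fun u => Re (g u))).
    exact: is_deriveD.
  by apply/funext => u; rewrite fctE raddfD.
rewrite (_ : (fun u => _) = (fun u => Im (f u)) + (fun u => Im (g u))).
  exact: is_deriveD.
by apply/funext => u; rewrite fctE raddfD.
Qed.

Lemma is_cderiveM t v f g d e : is_cderive t v f d -> is_cderive t v g e ->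
  is_cderive t v (fun u => f u * g u) (d * g t + f t * e).
Proof.
move=> [f1 f2] [g1 g2]; split.
  rewrite (_ : (fun u => _) = (fun u => Re (f u)) * (fun u => Re (g u)) -
      (fun u => Im (f u)) * (fun u => Im (g u))); last first.
    by apply/funext => u; rewrite !fctE; case: (f u) => ? ?; case: (g u).
  apply: is_derive_eq (is_deriveB (is_deriveM f1 g1) (is_deriveM f2 g2)) _.
  rewrite /GRing.scale /=; case: (f t) (g t) d e {f1 f2 g1 g2} => a b [a' b'] [x y] [x' y'] /=.
  by ring.
rewrite (_ : (fun u => _) = (fun u => Re (f u)) * (fun u => Im (g u)) +
    (fun u => Im (f u)) * (fun u => Re (g u))); last first.
  by apply/funext => u; rewrite !fctE; case: (f u) => ? ?; case: (g u).
apply: is_derive_eq (is_deriveD (is_deriveM f1 g2) (is_deriveM f2 g1)) _.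
rewrite /GRing.scale /=; case: (f t) (g t) d e {f1 f2 g1 g2} => a b [a' b'] [x y] [x' y'] /=.
by ring.
Qed.

Lemma is_cderive_eq t v f d e : is_cderive t v f d -> d = e -> is_cderive t v f e.
Proof. by move=> ? <-. Qed.

Lemma is_cderiveZ t v k f d : is_cderive t v f d ->
  is_cderive t v (fun u => k * f u) (k * d).
Proof.
move=> fd; apply: is_cderive_eq (is_cderiveM (is_cderive_cst t v k) fd) _.
by rewrite mul0r add0r.
Qed.

Lemma is_cderive_sum (I : Type) (r : seq I) (P : pred I) (f : I -> V -> C) (d : I -> C) t v :
  (forall i, P i -> is_cderive t v (f i) (d i)) ->
  is_cderive t v (fun u => \sum_(i <- r | P i) f i u) (\sum_(i <- r | P i) d i).
Proof.
move=> fd; elim: r => [|i r IH].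
  rewrite big_nil (_ : (fun u => _) = (fun=> 0)); first exact: is_cderive_cst.
  by apply/funext => u; rewrite big_nil.
rewrite big_cons; case: ifPn => Pi.
  rewrite (_ : (fun u => _) = (fun u => f i u + \sum_(i <- r | P i) f i u)).
    by apply: is_cderiveD => //; exact: fd.
  by apply/funext => u; rewrite big_cons Pi.
rewrite (_ : (fun u => _) = (fun u => \sum_(i <- r | P i) f i u)) //.
by apply/funext => u; rewrite big_cons (negbTE Pi).
Qed.

Lemma is_cderive_prod (I : eqType) (r : seq I) (f : I -> V -> C) (d : I -> C) t v :
  uniq r -> (forall i, is_cderive t v (f i) (d i)) ->
  is_cderive t v (fun u => \prod_(i <- r) f i u)
    (\sum_(b <- r) d b * \prod_(a <- r | a != b) f a t).
Proof.
move=> + fd; elim: r => [_|i r IH /= /andP[ir ur]].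
  rewrite big_nil (_ : (fun u => _) = (fun=> 1)); first exact: is_cderive_cst.
  by apply/funext => u; rewrite big_nil.
rewrite (_ : (fun u => _) = (fun u => f i u * \prod_(i <- r) f i u)); last first.
  by apply/funext => u; rewrite big_cons.
apply: is_cderive_eq (is_cderiveM (fd i) (IH ur)) _.
rewrite [RHS]big_cons big_cons eqxx /=; congr (_ * _ + _).
  rewrite [RHS]big_seq_cond [LHS]big_seq; apply: eq_bigl => a.
  by case: (boolP (a \in r)) => //= ar; apply/esym; apply: contraNneq ir => <-.
rewrite mulr_sumr [RHS]big_seq [LHS]big_seq; apply: eq_bigr => b br.
rewrite big_cons; have -> : i != b by apply: contraNneq ir => ->.
by rewrite mulrCA.
Qed.

Lemma is_cderive_near t v f g d : (\forall u \near t, f u = g u) ->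
  is_cderive t v f d -> is_cderive t v g d.
Proof.
move=> fg [f1 f2]; split.
  by apply: near_eq_is_derive f1; apply: filterS fg => u ->.
by apply: near_eq_is_derive f2; apply: filterS fg => u ->.
Qed.

Lemma is_cderiveP t v f d : is_cderive t v f d <->
  (h^-1)%:C * (f (h *: v + t) - f t) @[h --> (0 : R)^'] --> d.
Proof.
have FF : Filter ((0 : R)^') by exact: dnbhs_filter.
have ER h : Re ((h^-1)%:C * (f (h *: v + t) - f t)) =
    h^-1 * (Re (f (h *: v + t)) - Re (f t)).
  by rewrite -raddfB; case: (_ - _) => a b /=; rewrite mul0r subr0.
have EI h : Im ((h^-1)%:C * (f (h *: v + t) - f t)) =
    h^-1 * (Im (f (h *: v + t)) - Im (f t)).
  by rewrite -raddfB; case: (_ - _) => a b /=; rewrite mul0r addr0.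
split.
  move=> [[d1 e1] [d2 e2]]; apply/cvg_complexP; split.
    by under eq_fun do rewrite ER; rewrite -e1; exact: d1.
  by under eq_fun do rewrite EI; rewrite -e2; exact: d2.
move/cvg_complexP => []; under eq_fun do rewrite ER; move=> h1.
under eq_fun do rewrite EI; move=> h2.
split; split; [apply/cvg_ex; exists (Re d); exact: h1|exact: cvg_lim h1|
  apply/cvg_ex; exists (Im d); exact: h2|exact: cvg_lim h2].
Qed.

End ComplexDerivative.

Section Differentials.
Variables (K : numFieldType) (V W : normedModType K).

Lemma differentiable_bound (f : V -> W) (x : V) : differentiable f x ->
  forall e, 0 < e -> \forall z \near x, `|f z - f x - 'd f x (z - x)| <= e * `|z - x|.
Proof.
move=> /diff_locally df e e0.
have /eqaddoP := df => /(_ e e0).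
rewrite -[0 in X in X -> _](subrr x) => h.
have h' : \forall z \near x, `|(f \o shift x - (cst (f x) + 'd f x)) (z - x)| <= e * `|z - x|.
  have c : z - x @[z --> x] --> x - x.
    by apply: (@cvgB _ _ _ _ (nbhs_filter x)); [exact: cvg_id|exact: cvg_cst].
  exact: (c _ h).
apply: (filterS _ h') => z; rewrite /= !fctE /= subrK opprD addrA.
by [].
Qed.

Lemma bound_differentiable (f : V -> W) (x : V) (L : {linear V -> W}) : continuous L ->
  (forall e, 0 < e -> \forall z \near x, `|f z - f x - L (z - x)| <= e * `|z - x|) ->
  differentiable f x /\ 'd f x = L :> (V -> W).
Proof.
move=> cL h; have E : f \o shift x = cst (f x) + L +o_ 0 id.
  apply/eqaddoP => e e0.
  have c : z + x @[z --> (0 : V)] --> x.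
    rewrite -[X in _ --> X]add0r.
    by apply: (@cvgD _ _ _ _ (nbhs_filter (0 : V))); [exact: cvg_id|exact: cvg_cst].
  have h' : \forall z \near (0 : V), `|f (z + x) - f x - L (z + x - x)| <= e * `|z + x - x|.
    exact: (c _ (h e e0)).
  apply: (filterS _ h') => z; by rewrite /= !fctE /= addrK opprD addrA.
have dL := diff_unique cL E; split => //.
by apply/diff_locallyP; rewrite dL.
Qed.

End Differentials.

Section ComplexChain.
Variable R : realType.
Local Notation C := R[i].
Variable V : normedModType R.

Lemma cvg_norm_le0 (T : Type) (F : set_system T) (FF : Filter F) (f : T -> C) (l : C)
    (g : T -> C) : (forall e : R, 0 < e -> \forall x \near F, `|f x - g x| <= e%:C) ->
  g x @[x --> F] --> l -> f x @[x --> F] --> l.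
Proof.
move=> fg gl; have d0 : f x - g x @[x --> F] --> (0 : C).
  apply/cvgrPdist_lt => _ /gt0_realC[e e0 ->].
  have e2 : 0 < e / 2 by rewrite divr_gt0.
  apply: (filterS _ (fg _ e2)) => x h; rewrite sub0r normrN; apply: le_lt_trans h _.
  by rewrite ltcR ltr_pdivrMr// ltr_pMr// ltrDl.
rewrite -[l]add0r (_ : f = fun x => (f x - g x) + g x).
  by apply: (@cvgD _ C _ _ FF); [exact: d0|exact: gl].
by apply/funext => x; rewrite subrK.
Qed.

(** The outer differential is complex linear and the parameter of the curve is real, so the rule is
    proved on difference quotients: [q] tends to [dX], its image under the differential converges,
    and the remainder of F is a small multiple of the norm of [q], which stays bounded. *)
Lemma is_cderive_chain (n : nat) (F : 'rV[C]_n -> C) (X : V -> 'rV[C]_n) (dX : 'rV[C]_n)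
    (t v : V) : differentiable F (X t) ->
  (forall j, is_cderive t v (fun u => X u 0 j) (dX 0 j)) ->
  is_cderive t v (fun u => F (X u)) (\sum_j cpartial j F (X t) * dX 0 j).
Proof.
move=> dF dXj; have FF : Filter ((0 : R)^') by exact: dnbhs_filter.
have dFE w : 'd F (X t) w = \sum_j cpartial j F (X t) * w 0 j.
  rewrite {1}(row_sum_delta w) linear_sum; apply: eq_bigr => j _.
  by rewrite linearZ /= /cpartial deriveE// mulrC.
apply/is_cderiveP.
pose q (h : R) : 'rV[C]_n := (h^-1)%:C *: (X (h *: v + t) - X t).
have q1 : q h @[h --> (0 : R)^'] --> dX.
  apply: (@cvg_rV _ _ _ FF) => j; rewrite /q; under eq_fun do rewrite !mxE.
  by have /is_cderiveP := dXj j.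
have Xc : X (h *: v + t) @[h --> (0 : R)^'] --> X t.
  apply: (@cvg_rV _ _ _ FF) => j.
  have hc : h%:C @[h --> (0 : R)^'] --> (0 : C).
    apply: cvg_within_filter; exact: (@realC_continuous R 0).
  have := @cvgM C _ _ FF _ _ _ _ hc ((is_cderiveP _ _ _ _).1 (dXj j)).
  rewrite mul0r => h1; have h2 := @cvgD _ C _ _ FF _ _ _ _ h1 (@cvg_cst _ (X t 0 j) _ _ FF).
  move: h2; rewrite add0r; apply: cvg_trans; apply: near_eq_cvg.
  have n0 : \forall h \near (0 : R)^', h != 0 by exact: nbhs_dnbhs_neq.
  apply: (filterS _ n0) => h h0 /=.
  rewrite -[LHS]/(h%:C * ((h^-1)%:C * (X (h *: v + t) 0 j - X t 0 j)) + X t 0 j).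
  by rewrite mulrA -rmorphM/= divff// mul1r subrK.
apply: (@cvg_norm_le0 _ _ FF _ _ (fun h => 'd F (X t) (q h))); last first.
  rewrite -dFE; apply: (@cvg_at _ _ _ _ FF q ('d F (X t)) dX); last exact: q1.
  exact: (diff_continuous dF).
move=> e e0.
have [B B0 qB] : exists2 B : R, 0 < B & \forall h \near (0 : R)^', `|q h| <= B%:C.
  have : `|q h| @[h --> (0 : R)^'] --> `|dX| by exact: (cvg_norm q1).
  have [b b0 Eb] : exists2 b : R, 0 <= b & `|dX| = b%:C.
    have := normr_ge0 dX; case: `|dX| => a b; rewrite lecE /= => /andP[/eqP -> ?]; by exists a.
  move=> /cvgrPdist_lt /(_ 1 ltr01) h; exists (b + 1); first by rewrite ltr_wpDl.
  apply: (filterS _ h) => r; rewrite Eb => hr.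
  rewrite rmorphD/= -lerBlDl; apply: le_trans (ltW hr).
  rewrite distrC; apply: real_ler_norm; rewrite realB// ger0_real//.
  by rewrite lecR.
have eB : 0 < e / B by rewrite divr_gt0.
have eBC : 0 < (e / B)%:C by rewrite ltcR.
have nX : \forall h \near (0 : R)^', `|F (X (h *: v + t)) - F (X t) -
    'd F (X t) (X (h *: v + t) - X t)| <= (e / B)%:C * `|X (h *: v + t) - X t|.
  exact: (Xc _ (differentiable_bound dF eBC)).
have n0 : \forall h \near (0 : R)^', h != 0 by exact: nbhs_dnbhs_neq.
apply: (filterS _ (filterI nX (filterI qB n0))) => h /= [hX [hB h0]].
have hn0 : (h^-1)%:C != 0 :> C by rewrite eq_complex /= negb_and invr_eq0 h0.
rewrite /q linearZ /= -mulrBr normrM.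
apply: le_trans (_ : `|(h^-1)%:C| * ((e / B)%:C * `|X (h *: v + t) - X t|) <= _).
  by rewrite ler_wpM2l.
rewrite mulrCA -normrZ; apply: le_trans (_ : (e / B)%:C * B%:C <= _).
  by rewrite ler_wpM2l// ltW.
by rewrite -rmorphM/= divfK// gt_eqF.
Qed.

End ComplexChain.

Lemma near_mono (T : topologicalType) (x : T) (P Q : T -> Prop) :
  (forall y, P y -> Q y) -> (\forall y \near x, P y) -> \forall y \near x, Q y.
Proof. by move=> PQ; apply: filterS => y; exact: PQ. Qed.

Lemma near_and (T : topologicalType) (x : T) (P Q : T -> Prop) :
  (\forall y \near x, P y) -> (\forall y \near x, Q y) -> \forall y \near x, P y /\ Q y.
Proof. by move=> hP hQ; exact: filterI. Qed.

(** * The principal logarithm and power on the right half-plane *)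

Section ComplexPower.
Variable R : realType.
Local Notation C := R[i].
Local Notation Re := (@complex.Re R).
Local Notation Im := (@complex.Im R).
Implicit Types z w a : C.

Lemma cexpD z w : cexp (z + w) = cexp z * cexp w.
Proof.
case: z w => x y [x' y']; rewrite /cexp /= expRD cosD sinD.
apply/eqP; rewrite eq_complex /=; apply/andP; split; apply/eqP; ring.
Qed.

Lemma cexp0 : cexp 0 = 1 :> C.
Proof. by rewrite /cexp /= expR0 cos0 sin0 mulr0 mulr1. Qed.

Lemma Re_gt0_norm z : 0 < Re z -> 0 < Normc.normc z.
Proof.
case: z => x y /= x0; rewrite sqrtr_gt0 ltr_pwDl ?exprn_gt0// sqr_ge0.
by [].
Qed.

Lemma clog_polar z : 0 < Re z ->
  Normc.normc z * cos (Im (clog z)) = Re z /\ Normc.normc z * sin (Im (clog z)) = Im z.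
Proof.
case: z => x y /= x0.
have ns : Num.sqrt (1 + (y / x) ^+ 2) = Num.sqrt (x ^+ 2 + y ^+ 2) / x.
  have -> : 1 + (y / x) ^+ 2 = (x ^+ 2 + y ^+ 2) / x ^+ 2.
    by rewrite expr_div_n mulrDl divff// expf_neq0// gt_eqF.
  by rewrite sqrtrM ?addr_ge0 ?sqr_ge0// sqrtrV ?sqr_ge0// sqrtr_sqr gtr0_norm.
have n0 : Num.sqrt (x ^+ 2 + y ^+ 2) != 0.
  by rewrite gt_eqF// (Re_gt0_norm (z := x +i* y)).
have x0' : x != 0 by rewrite gt_eqF.
have cE : cos (atan (y / x)) = x / Num.sqrt (x ^+ 2 + y ^+ 2).
  by rewrite cos_atan ns invf_div.
have sE : sin (atan (y / x)) = y / Num.sqrt (x ^+ 2 + y ^+ 2).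
  have := atanK (y / x); rewrite /tan => tE.
  rewrite -[LHS](@divfK _ (cos (atan (y / x)))) ?tE ?cE; first by field; rewrite x0' n0.
  by rewrite mulf_neq0// invr_neq0.
by rewrite cE sE; split; field.
Qed.

Lemma clogK z : 0 < Re z -> cexp (clog z) = z.
Proof.
move=> z0; have [h1 h2] := clog_polar z0.
rewrite /cexp /= lnK ?posrE ?Re_gt0_norm//.
by rewrite -[atan _]/(Im (clog z)) h1 h2; case: z {z0 h1 h2}.
Qed.

Lemma normcM z w : Normc.normc (z * w) = Normc.normc z * Normc.normc w.
Proof. exact: Normc.normcM. Qed.

(** The sum of the two arguments lies in (-pi, pi), and its cosine is positive because the product
    is in the half-plane. It therefore lies in (-pi/2, pi/2), where the arctangent inverts the
    tangent. *)
Lemma clogM z w : 0 < Re z -> 0 < Re w -> 0 < Re (z * w) ->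
  clog (z * w) = clog z + clog w.
Proof.
move=> z0 w0 zw0.
have [z1 z2] := clog_polar z0; have [w1 w2] := clog_polar w0.
rewrite {1}/clog normcM lnM ?posrE ?Re_gt0_norm//.
suff -> : atan (Im (z * w) / Re (z * w)) = Im (clog z) + Im (clog w) by [].
set p := Im (clog z); set q := Im (clog w).
have nz := Re_gt0_norm z0; have nw := Re_gt0_norm w0.
have ReE : Re (z * w) = Normc.normc z * Normc.normc w * cos (p + q).
  rewrite cosD mulrBr; rewrite -/p -/q in z1 z2 w1 w2.
  transitivity (Re z * Re w - Im z * Im w); first by case: (z) (w) => ? ? [].
  by rewrite -z1 -z2 -w1 -w2; ring.
have ImE : Im (z * w) = Normc.normc z * Normc.normc w * sin (p + q).
  rewrite sinD mulrDr; rewrite -/p -/q in z1 z2 w1 w2.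
  transitivity (Re z * Im w + Im z * Re w); first by case: (z) (w) => ? ? [].
  by rewrite -z1 -z2 -w1 -w2; ring.
have c0 : 0 < cos (p + q) by move: zw0; rewrite ReE pmulr_rgt0// mulr_gt0.
have [p1 p2] : - (pi / 2) < p /\ p < pi / 2 by split; [exact: atan_gtNpi2|exact: atan_ltpi2].
have [q1 q2] : - (pi / 2) < q /\ q < pi / 2 by split; [exact: atan_gtNpi2|exact: atan_ltpi2].
have pq1 : p + q < pi / 2.
  rewrite ltNge; apply/negP => h; move: c0; rewrite ltNge => /negP; apply.
  rewrite -[p + q](subrK (pi / 2)) cosDpihalf oppr_le0 sin_ge0_pi// subr_ge0 h /=.
  by lra.
have pq2 : - (pi / 2) < p + q.
  rewrite ltNge; apply/negP => h; move: c0; rewrite ltNge => /negP; apply.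
  rewrite -[p + q]opprK cosN -[- (p + q)](subrK (pi / 2)) cosDpihalf oppr_le0 sin_ge0_pi//.
  by apply/andP; split; lra.
rewrite -[RHS]tanK ?in_itv /= ?pq1 ?pq2// ReE ImE /tan -mulf_div divff ?mul1r//.
by rewrite gt_eqF// mulr_gt0.
Qed.

Lemma cpowM z w a : 0 < Re z -> 0 < Re w -> 0 < Re (z * w) ->
  cpow (z * w) a = cpow z a * cpow w a.
Proof. by move=> z0 w0 zw0; rewrite /cpow clogM// mulrDr cexpD. Qed.

Lemma clog1 : clog 1 = 0 :> C.
Proof. by rewrite /clog /= mul0r atan0 expr1n expr0n addr0 sqrtr1 ln1. Qed.

Lemma cpow1 a : cpow 1 a = 1.
Proof. by rewrite /cpow clog1 mulr0 cexp0. Qed.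

Lemma real_derive_bound (f : R -> R) (d : R) : is_derive (0 : R) 1 f d ->
  forall e, 0 < e -> \forall x \near (0 : R), `|f x - f 0 - x * d| <= e * `|x|.
Proof.
move=> [df dE] e e0; have df' := (derivable1_diffP _ _).1 df.
apply: (filterS _ (differentiable_bound df' e0)) => x.
by rewrite subr0 (deriv1E df) derive1E dE.
Qed.

Lemma cexp_bound (e : C) : 0 < e -> \forall z \near (0 : C), `|cexp z - 1 - z| <= e * `|z|.
Proof.
move=> /gt0_realC[{}e e0 ->].
(* The errors below add up to 1/16 in |x| and 5/16 in |y|, within the 1/2 allowed to each. *)
have e8 : 0 < e / 16 by rewrite divr_gt0.
have m0 : 0 < Num.min 1 (e / 16) by rewrite lt_min ltr01 e8.
have e1 := real_derive_bound (is_derive_expR (0 : R)) e8.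
have c1 := real_derive_bound (is_derive_cos (0 : R)) e8.
have s1 := real_derive_bound (is_derive_sin (0 : R)) e8.
have ec : \forall x \near (0 : R), `|expR 0 - expR x| < Num.min 1 (e / 16).
  by have /cvgrPdist_lt := @continuous_expR R 0; apply.
have nR (P : set R) : (\forall x \near (0 : R), P x) -> \forall z \near (0 : C), P (Re z).
  by move=> h; exact: (@Re_continuous R 0 _ h).
have nI (P : set R) : (\forall x \near (0 : R), P x) -> \forall z \near (0 : C), P (Im z).
  by move=> h; exact: (@Im_continuous R 0 _ h).
have h := near_and (nR _ (near_and e1 ec)) (nI _ (near_and c1 s1)).
apply: (near_mono _ h) => {h e1 c1 s1 ec}.
case=> x y /=; rewrite expR0 cos0 sin0 !oppr0 !mulr1 !mulr0 !oppr0 !addr0 => -[[he hx] [hc hs]].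
apply: le_trans (norm_ReIm _) _.
apply: le_trans (_ : (e / 2 * `|x| + e / 2 * `|y|)%:C <= _); last first.
  have [hx1 hy1] := ReIm_norm (x +i* y).
  move: hx1 hy1; rewrite !normcE -rmorphM !lecR /=; set n := Num.sqrt _ => hx1 hy1.
  have e2 : 0 <= e / 2 by rewrite divr_ge0 ?(ltW e0).
  by have := ler_wpM2l e2 hx1; have := ler_wpM2l e2 hy1; lra.
rewrite lecR.
have ex2 : `|expR x| <= 2.
  rewrite -[expR x](subrK 1) (le_trans (ler_normD _ _))// normr1.
  rewrite -[leRHS]/(1 + 1) lerD2r distrC; apply/ltW/(lt_le_trans hx).
  by rewrite ge_min lexx.
have ex3 : `|expR x - 1| <= e / 16.
  by rewrite distrC; apply/ltW/(lt_le_trans hx); rewrite ge_min lexx orbT.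
have E1 : expR x * cos y - 1 - x = (expR x - 1 - x) + expR x * (cos y - 1) by ring.
have E2 : expR x * sin y - y = expR x * (sin y - y) + (expR x - 1) * y by ring.
have x0 := normr_ge0 x; have y0 := normr_ge0 y.
have b1 : `|expR x * cos y - 1 - x| <= e / 16 * `|x| + 2 * (e / 16 * `|y|).
  rewrite E1 (le_trans (ler_normD _ _))// lerD// normrM.
  by apply: ler_pM => //; rewrite ?normr_ge0.
have b2 : `|expR x * sin y - y| <= 2 * (e / 16 * `|y|) + e / 16 * `|y|.
  rewrite E2 (le_trans (ler_normD _ _))// !normrM lerD//.
    by apply: ler_pM => //; rewrite ?normr_ge0.
  by rewrite ler_wpM2r.
have -> : Im (cexp (x +i* y) - 1 - (x +i* y)) = expR x * sin y - y.
  by rewrite /= oppr0 addr0.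
have h := lerD b1 b2; apply: (le_trans h).
have : 0 <= e * `|x| by rewrite mulr_ge0// ltW.
have : 0 <= e * `|y| by rewrite mulr_ge0// ltW.
by lra.
Qed.

Lemma clog_continuous1 : clog z @[z --> (1 : C)] --> (0 : C).
Proof.
have FF := nbhs_filter (1 : C).
apply/(cvg_complexP FF) => /=; split.
  have E z : ln (Normc.normc z) = ln (Re `|z|) by [].
  under eq_fun do rewrite E.
  have c1 : Re `|z| @[z --> (1 : C)] --> Re `|1 : C|.
    apply: (@cvg_at _ _ _ _ FF (fun z : C => `|z|) Re); first exact: Re_continuous.
    exact: norm_continuous.
  have -> : (0 : R) = ln (Re `|1 : C|) by rewrite normr1 /= ln1.
  apply: (@cvg_at _ _ _ _ FF (fun z : C => Re `|z|) (@ln R)); last exact: c1.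
  by apply: continuous_ln; rewrite normr1 /= ltr01.
have -> : (0 : R) = atan (Im 1 / Re 1) by rewrite /= mul0r atan0.
apply: (@cvg_at _ _ _ _ FF (fun z : C => Im z / Re z) (@atan R)).
  exact: continuous_atan.
apply: (@cvgM _ _ _ FF); first exact: Im_continuous.
by apply: (@cvgV _ _ _ FF); [rewrite /= oner_neq0|exact: Re_continuous].
Qed.

Lemma near_Re_gt0 z : 0 < Re z -> \forall w \near z, 0 < Re w.
Proof.
move=> z0; have /cvgrPdist_lt /(_ _ z0) h := @Re_continuous R z.
apply: (near_mono _ h) => w; rewrite ltr_distlC => /andP[+ _].
by rewrite subrr.
Qed.

(* The derivative of clog at 1 is obtained from that of its inverse cexp at 0. *)
Lemma clog_bound (e : C) : 0 < e -> \forall z \near (1 : C), `|clog z - (z - 1)| <= e * `|z - 1|.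
Proof.
move=> e0; have [r r0 re] := gt0_realC e0; pose m := Num.min (1 / 2) (r / 2).
have m0 : 0 < m by rewrite lt_min !divr_gt0.
have mC : 0 < m%:C by rewrite ltcR.
have h1 : \forall z \near (1 : C), `|cexp (clog z) - 1 - clog z| <= m%:C * `|clog z|.
  exact: (clog_continuous1 (cexp_bound mC)).
have p1 : 0 < Re (1 : C) by rewrite /= ltr01.
apply: (near_mono _ (near_and h1 (near_Re_gt0 p1))) => z [/= + z0].
rewrite clogK//; set w := clog z => hw.
have m1 : m <= 1 / 2 by rewrite ge_min lexx.
have m2 : m <= r / 2 by rewrite ge_min lexx orbT.
have wn : `|w| <= 2 * `|z - 1|.
  have : `|w| <= `|z - 1| + (1 / 2)%:C * `|w|.
    rewrite -[X in `|X| <= _](subKr (z - 1)) (le_trans (ler_normB _ _))// lerD2l.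
    by rewrite (le_trans hw)// ler_wpM2r// lecR.
  have -> : (1 / 2 : R)%:C = 1 / 2 :> C by rewrite rmorphM rmorph1 fmorphV rmorph_nat.
  move=> h; have : (1 / 2) * `|w| <= `|z - 1|.
    have E : (1 / 2) * `|w| = `|w| - (1 / 2) * `|w| by field.
    by rewrite E lerBlDr.
  by rewrite mul1r mulrC ler_pdivrMr// mulrC.
rewrite -normrN opprB; apply: (le_trans hw).
apply: le_trans (_ : m%:C * (2 * `|z - 1|) <= _); first by rewrite ler_wpM2l// ltW.
rewrite mulrA ler_wpM2r// re.
have -> : m%:C * 2 = (m * 2)%:C by rewrite rmorphM rmorph_nat.
by rewrite lecR -ler_pdivlMr.
Qed.

(** Composes the expansions of [cexp] at 0 and of [clog] at 1. Other base points are brought back to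
    1 by dividing by the value of the base. *)
Lemma cpow_bound1 a (e : C) : 0 < e ->
  \forall z \near (1 : C), `|cpow z a - 1 - a * (z - 1)| <= e * `|z - 1|.
Proof.
move=> e0; have [r r0 re] := gt0_realC e0.
have an0 : 0 < `|a| + 1 by rewrite ltr_wpDl.
have e1 : 0 < e / 2 / (`|a| + 1) by rewrite !divr_gt0.
have m1 : 0 < e / 2 / (`|a| + 1) / 2 by rewrite divr_gt0.
have c0 : a * clog z @[z --> (1 : C)] --> (0 : C).
  rewrite -(mulr0 a); apply: (@cvgM C _ _ (nbhs_filter (1 : C))); first exact: cvg_cst.
  exact: clog_continuous1.
have h1 : \forall z \near (1 : C),
    `|cexp (a * clog z) - 1 - a * clog z| <= e / 2 / (`|a| + 1) / 2 * `|a * clog z|.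
  exact: (c0 _ (cexp_bound m1)).
apply: (near_mono _ (near_and h1 (near_and (clog_bound e1) (clog_bound ltr01)))).
move=> z [/= b1 [b2 b3]].
have wn : `|clog z| <= 2 * `|z - 1|.
  rewrite -[clog z](subrK (z - 1)) (le_trans (ler_normD _ _))//.
  by rewrite mulr_natl mulr2n lerD2r; rewrite mul1r in b3.
have -> : cpow z a - 1 - a * (z - 1) = (cexp (a * clog z) - 1 - a * clog z) +
    a * (clog z - (z - 1)) by rewrite /cpow; ring.
apply: le_trans (ler_normD _ _) _.
have -> : e * `|z - 1| = e / 2 / (`|a| + 1) / 2 * ((`|a| + 1) * (2 * `|z - 1|)) +
    (`|a| + 1) * (e / 2 / (`|a| + 1) * `|z - 1|).
  by field; rewrite gt_eqF.
apply: lerD.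
  apply: (le_trans b1); rewrite ler_wpM2l ?(ltW m1)// normrM.
  by apply: ler_pM => //; rewrite lerDl.
by rewrite normrM; apply: ler_pM => //; rewrite lerDl.
Qed.

End ComplexPower.

(** * Symmetry of second derivatives *)

Section Clairaut.
Variables (R : realType) (V : normedModType R).

(** The mean value theorem in direction v turns the second difference into h times a difference of
    values of 'D_v g, which differentiability at t evaluates up to o(h). *)
Lemma second_difference (g : V -> R) (t v w : V) :
  (\forall u \near t, derivable g u v) -> differentiable (fun u => 'D_v g u) t ->
  forall e, 0 < e -> exists2 d, 0 < d & forall h, 0 < h < d ->
    `|g (h *: w + (h *: v + t)) - g (h *: v + t) - (g (h *: w + t) - g t)
      - h ^+ 2 * 'D_w (fun u => 'D_v g u) t| <= e * h ^+ 2.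
Proof.
(* The two increments at which 'D_v g is expanded have norm at most h (|w| + |v|) and h |v|; the 1
   keeps [B] positive. *)
move=> dg dDg e e0; pose B := 2 * `|v| + `|w| + 1.
have B0 : 0 < B by rewrite /B ltr_wpDl// addr_ge0// mulr_ge0.
have eB : 0 < e / B by rewrite divr_gt0.
have := near_and dg (differentiable_bound dDg eB).
move=> /nbhs_ballP[r /= r0 rP].
have inb (a b : R) h : 0 < h < r / B -> 0 <= a <= h -> 0 <= b <= h ->
    ball t r (a *: v + (b *: w + t)).
  move=> /andP[h0 hr] /andP[a0 ah] /andP[b0 bh]; rewrite -ball_normE /=.
  have -> : t - (a *: v + (b *: w + t)) = - (a *: v + b *: w).
    by rewrite addrA opprD addrCA subrr addr0.
  rewrite normrN; apply: le_lt_trans (ler_normD _ _) _; rewrite !normrZ !ger0_norm//.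
  apply: le_lt_trans (_ : h * B < r); last by rewrite -ltr_pdivlMr.
  have := ler_wpM2r (normr_ge0 v) ah; have := ler_wpM2r (normr_ge0 w) bh.
  have hv : 0 <= h * `|v| by rewrite mulr_ge0// ltW.
  rewrite /B; move: (normr_ge0 v) (normr_ge0 w); nra.
exists (r / B); first by rewrite divr_gt0.
move=> h hrB; have /andP[h0 hr] := hrB.
pose phi s := g (h *: w + (s *: v + t)) - g (s *: v + t).
pose dphi s := 'D_v g (h *: w + (s *: v + t)) - 'D_v g (s *: v + t).
have h0h : 0 <= h <= h by rewrite lexx ltW.
have z0h : (0 : R) <= 0 <= h by rewrite !lexx (ltW h0).
have in1 s : 0 <= s <= h -> ball t r (h *: w + (s *: v + t)).
  by move=> sh; rewrite addrCA; exact: (inb s h h hrB sh h0h).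
have in2 s : 0 <= s <= h -> ball t r (s *: v + t).
  by move=> sh; have := inb s 0 h hrB sh z0h; rewrite scale0r add0r.
have dp s : 0 <= s <= h -> is_derive s 1 phi (dphi s).
  move=> sh.
  have e1 : is_derive s 1 (fun s => g (h *: w + (s *: v + t))) ('D_v g (h *: w + (s *: v + t))).
    apply: (@eq_is_derive_line _ _ _ _ _ g _ _ (h *: w + (s *: v + t)) v).
      move=> k; have -> : k%:A = k :> R by exact: mulr1.
      by congr (g _); rewrite scalerDl -addrA [RHS]addrCA.
    by split=> //; have [] := rP _ (in1 _ sh).
  have e2 : is_derive s 1 (fun s => g (s *: v + t)) ('D_v g (s *: v + t)).
    apply: (@eq_is_derive_line _ _ _ _ _ g _ _ (s *: v + t) v).
      move=> k; have -> : k%:A = k :> R by exact: mulr1.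
      by rewrite scalerDl -addrA.
    by split=> //; have [] := rP _ (in2 _ sh).
  exact: is_deriveB.
have [||c] := @MVT _ phi dphi 0 h h0.
- by move=> s; rewrite in_itv /= => /andP[s0 sh]; apply: dp; rewrite !ltW.
- apply: derivable_within_continuous => s; rewrite in_itv /= => sh.
  by have [] := dp _ sh.
rewrite in_itv /= => /andP[c0 ch]; rewrite subr0.
have -> : phi h - phi 0 = g (h *: w + (h *: v + t)) - g (h *: v + t) - (g (h *: w + t) - g t).
  by rewrite /phi !scale0r !add0r.
move=> ->.
have chh : 0 <= c <= h by rewrite !ltW.
have [_ b1] := rP _ (in1 _ chh); have [_ b2] := rP _ (in2 _ chh).
set L := 'd (fun u => 'D_v g u) t in b1 b2.
have -> : 'D_w (fun u => 'D_v g u) t = L w by rewrite deriveE.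
have n1 : `|h *: w + (c *: v + t) - t| <= h * (`|w| + `|v|).
  rewrite addrA addrK; apply: le_trans (ler_normD _ _) _; rewrite !normrZ.
  by rewrite (gtr0_norm h0) (gtr0_norm c0) mulrDr lerD2l ler_wpM2r// ltW.
have n2 : `|c *: v + t - t| <= h * `|v|.
  by rewrite addrK normrZ (gtr0_norm c0) ler_wpM2r// ltW.
have {}b1 := le_trans b1 (ler_wpM2l (ltW eB) n1).
have {}b2 := le_trans b2 (ler_wpM2l (ltW eB) n2).
have E : dphi c * h - h ^+ 2 * L w = h * (('D_v g (h *: w + (c *: v + t)) - 'D_v g t -
    L (h *: w + (c *: v + t) - t)) - ('D_v g (c *: v + t) - 'D_v g t - L (c *: v + t - t))).
  have l1 : L (h *: w + (c *: v + t) - t) = h * L w + c * L v.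
    by rewrite addrA addrK linearD !linearZ.
  have l2 : L (c *: v + t - t) = c * L v by rewrite addrK linearZ.
  by rewrite /dphi l1 l2; ring.
rewrite E normrM (gtr0_norm h0).
apply: le_trans (_ : h * (e / B * (h * (`|w| + `|v|)) + e / B * (h * `|v|)) <= _).
  by rewrite ler_wpM2l ?(ltW h0)// (le_trans (ler_normB _ _))// lerD.
have -> : h * (e / B * (h * (`|w| + `|v|)) + e / B * (h * `|v|)) =
    e * h ^+ 2 * ((2 * `|v| + `|w|) / B) by field; rewrite gt_eqF.
apply: ler_piMr; first by rewrite mulr_ge0 ?sqr_ge0 ?(ltW e0).
by rewrite ler_pdivrMr// mul1r /B lerDl.
Qed.

(** The second difference is symmetric in v and w, and both mixed derivatives are its limit after
    division by the square of h. *)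
Lemma clairaut (g : V -> R) (t v w : V) :
  (\forall u \near t, derivable g u v) -> (\forall u \near t, derivable g u w) ->
  differentiable (fun u => 'D_v g u) t -> differentiable (fun u => 'D_w g u) t ->
  'D_w (fun u => 'D_v g u) t = 'D_v (fun u => 'D_w g u) t.
Proof.
move=> dv dw dDv dDw; apply/eqP; rewrite -subr_eq0 -normr_le0; apply/ler_addgt0Pr => e e0.
rewrite add0r; have e2 : 0 < e / 2 by rewrite divr_gt0.
have [d1 d10 h1] := second_difference w dv dDv e2.
have [d2 d20 h2] := second_difference v dw dDw e2.
pose h := Num.min d1 d2 / 2.
have m0 : 0 < Num.min d1 d2 by rewrite lt_min d10.
have h0 : 0 < h by rewrite divr_gt0.
have hm : h < Num.min d1 d2 by rewrite ltr_pdivrMr// ltr_pMr// ltr1n.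
have hd1 : 0 < h < d1 by rewrite h0 (lt_le_trans hm)// ge_min lexx.
have hd2 : 0 < h < d2 by rewrite h0 (lt_le_trans hm)// ge_min lexx orbT.
have := h1 _ hd1; have := h2 _ hd2; rewrite [h *: v + (h *: w + t)]addrCA.
set a := 'D_w _ t; set b := 'D_v _ t.
set x1 := g (h *: w + (h *: v + t)); set x2 := g (h *: w + t); set x3 := g (h *: v + t).
move=> k2 k1; have hh : 0 < h ^+ 2 by rewrite exprn_gt0.
rewrite -(ler_pM2l hh) -[X in X * `|_|]gtr0_norm// -normrM.
have -> : h ^+ 2 * (a - b) = (x1 - x2 - (x3 - g t) - h ^+ 2 * b) -
    (x1 - x3 - (x2 - g t) - h ^+ 2 * a) by ring.
apply: le_trans (ler_normB _ _) _; apply: le_trans (lerD k2 k1) _.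
by rewrite -mulrDl -splitr mulrC.
Qed.

End Clairaut.

Lemma near_eq_differentiable (K : numFieldType) (V W : normedModType K) (f g : V -> W) (t : V) :
  (\forall u \near t, f u = g u) -> differentiable f t -> differentiable g t.
Proof.
move=> fg df; have ft : f t = g t by exact: (nbhs_singleton fg).
have [|//] := @bound_differentiable _ _ _ g t ('d f t) (diff_continuous df).
move=> e e0; apply: (near_mono _ (near_and fg (differentiable_bound df e0))) => u [<-].
by rewrite ft.
Qed.

(** * Smooth functions in barycentric coordinates *)

Section Smooth.
Variable R : realType.

Local Notation D l g := (foldr (fun i h u => 'D_(delta_mx 0 i) h u) g l).

Lemma eq_iter_derive N (U : set 'rV[R]_N) (f g : 'rV[R]_N -> R) (l : seq 'I_N) :
  open U -> (forall t, U t -> f t = g t) -> forall t, U t -> D l f t = D l g t.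
Proof.
move=> oU fg; elim: l => [|i l IH] //= t Ut.
apply: near_eq_derive; have : nbhs t U by exact: open_nbhs_nbhs.
by apply: near_mono => u Uu; exact: IH.
Qed.

Lemma smooth_on_derive N (U : set 'rV[R]_N) (f : 'rV[R]_N -> R) (i : 'I_N) :
  smooth_on U f -> smooth_on U (fun t => 'D_(delta_mx 0 i) f t).
Proof. by move=> sf l t Ut; have := sf (rcons l i) t Ut; rewrite foldr_rcons. Qed.

Lemma smooth_on_differentiable N (U : set 'rV[R]_N) (f : 'rV[R]_N -> R) t :
  smooth_on U f -> U t -> differentiable f t.
Proof. by move=> sf Ut; exact: (sf [::]). Qed.

Lemma smooth_onB N (U : set 'rV[R]_N) (f g : 'rV[R]_N -> R) : open U ->
  smooth_on U f -> smooth_on U g -> smooth_on U (fun t => f t - g t).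
Proof.
move=> oU sf sg l.
have E : forall t, U t -> D l (fun t => f t - g t) t = D l f t - D l g t.
  elim: l => [|i l IH] //= t Ut.
  have nU : nbhs t U by exact: open_nbhs_nbhs.
  have -> : 'D_(delta_mx 0 i) (D l (fun t => f t - g t)) t =
      'D_(delta_mx 0 i) (D l f - D l g) t.
    by apply: near_eq_derive; apply: near_mono nU => u Uu; exact: IH.
  by rewrite deriveB//; apply: diff_derivable; [exact: sf|exact: sg].
move=> t Ut; have nU : nbhs t U by exact: open_nbhs_nbhs.
apply: (@near_eq_differentiable _ _ _ (D l f - D l g)).
  by apply: near_mono nU => u Uu; rewrite E.
by apply: differentiableB; [exact: sf|exact: sg].
Qed.

Lemma smooth_on_symm N (U : set 'rV[R]_N) (f : 'rV[R]_N -> R) (i j : 'I_N) t : open U ->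
  smooth_on U f -> U t ->
  'D_(delta_mx 0 j) (fun u => 'D_(delta_mx 0 i) f u) t =
  'D_(delta_mx 0 i) (fun u => 'D_(delta_mx 0 j) f u) t.
Proof.
move=> oU sf Ut; have nU : nbhs t U by exact: open_nbhs_nbhs.
apply: clairaut.
- by apply: near_mono nU => u Uu; apply: diff_derivable; exact: (sf [::]).
- by apply: near_mono nU => u Uu; apply: diff_derivable; exact: (sf [::]).
- exact: (sf [:: i]).
- exact: (sf [:: j]).
Qed.

Lemma baryE N (t : 'rV[R]_N) : bary t = vcons (1 - \sum_i t 0 i) t.
Proof. by []. Qed.

Lemma bary_continuous N : continuous (@bary R N).
Proof. exact: (@vcons_slack_continuous R N 1). Qed.

Definition bary_lin N (t : 'rV[R]_N) : 'rV[R]_N.+1 := vcons (- \sum_i t 0 i) t.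

Fact bary_lin_linear N : linear (@bary_lin N).
Proof.
move=> k s t; rewrite /bary_lin vconsZ vconsD; congr (vcons _ _).
rewrite mulrN -opprD mulr_sumr -big_split /=; congr (- _).
by apply: eq_bigr => i _; rewrite !mxE.
Qed.
HB.instance Definition _ N :=
  GRing.isLinear.Build R 'rV[R]_N 'rV[R]_N.+1 *:%R (@bary_lin N) (@bary_lin_linear N).

Lemma bary_linB N (s t : 'rV[R]_N) : bary s - bary t = bary_lin (s - t).
Proof.
rewrite -[X in _ - X]scale1r -scaleNr !baryE vconsZ vconsD mulN1r scaleN1r /bary_lin.
congr (vcons _ _); under [in RHS]eq_bigr do rewrite !mxE.
by rewrite sumrB; ring.
Qed.

Lemma bary_line N (t v : 'rV[R]_N) (h : R) : bary (h *: v + t) = h *: bary_lin v + bary t.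
Proof. by rewrite -[bary _](subrK (bary t)) bary_linB addrK linearZ. Qed.

Lemma bary_lin_delta N (k : 'I_N) :
  bary_lin (delta_mx 0 k) = delta_mx 0 (lift ord0 k) - delta_mx 0 ord0.
Proof.
rewrite delta_vconsS delta_vcons0 -scaleN1r vconsZ vconsD scaler0 addr0 mulr1 add0r.
congr (vcons (- _) _); rewrite (bigD1 k)//= mxE !eqxx big1 ?addr0// => i ik.
by rewrite mxE (negbTE ik) andbF.
Qed.

Lemma bary_differentiable N (t : 'rV[R]_N) : differentiable (@bary R N) t.
Proof.
have cL : continuous (@bary_lin N).
  move=> u; apply: (@cvg_vcons _ _ _ (nbhs_filter u)); last exact: cvg_id.
  by apply: (@cvgN _ _ _ _ (nbhs_filter u)); exact: sum_coord_continuous.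
have [] // := @bound_differentiable _ _ _ (@bary R N) t (@bary_lin N) cL.
move=> e e0; apply: (@filterE _ _ (nbhs_filter t)) => z; rewrite bary_linB subrr normr0.
by rewrite mulr_ge0// ltW.
Qed.

Lemma derive_bary N (f : 'rV[R]_N.+1 -> R) (t : 'rV[R]_N) (k : 'I_N) :
  differentiable f (bary t) ->
  is_derive t (delta_mx 0 k) (fun u => f (bary u))
    ('D_(delta_mx 0 (lift ord0 k)) f (bary t) - 'D_(delta_mx 0 ord0) f (bary t)).
Proof.
move=> df; apply: (@eq_is_derive_line _ _ _ _ _ f _ _ (bary t) (bary_lin (delta_mx 0 k))).
  by move=> h; rewrite bary_line.
split; first exact: diff_derivable.
by rewrite !deriveE// bary_lin_delta linearB.
Qed.

(** The k-th derivative of f composed with [bary] is D_(k+1) f - D_0 f composed with [bary], again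
    of the same kind. The induction peels off the innermost derivative, hence [last_ind]. *)
Lemma smooth_on_bary N (U : set 'rV[R]_N.+1) (f : 'rV[R]_N.+1 -> R) : open U ->
  smooth_on U f -> smooth_on (@bary R N @^-1` U) (fun t => f (bary t)).
Proof.
move=> oU; have oU' : open (@bary R N @^-1` U).
  by apply: open_comp => // t _; exact: bary_continuous.
move=> + l; elim/last_ind: l f => [|l k IH] f sf t Ut.
  apply: differentiable_comp; first exact: bary_differentiable.
  exact: (sf [::]).
rewrite foldr_rcons.
pose v u := 'D_(delta_mx 0 (lift ord0 k)) f u - 'D_(delta_mx 0 ord0) f u.
have sv : smooth_on U v by apply: smooth_onB => //; exact: smooth_on_derive.
apply: (near_eq_differentiable _ (IH v sv t Ut)).
have nU : nbhs t (@bary R N @^-1` U) by exact: open_nbhs_nbhs.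
apply: near_mono nU => u Uu; apply: (eq_iter_derive _ oU') Uu => s Us.
by have [_ ->] := derive_bary k (smooth_on_differentiable sf Us).
Qed.

End Smooth.

(** * Cofactor identities *)

Section Cofactors.
Variable K : comNzRingType.

(** The sum is the determinant of M with row j replaced by ones. Subtracting column 0 from the
    others, by the unitriangular [U], leaves a single 1 in that row. This describes the slanted
    face, whose tangent vectors are differences of coordinate directions. *)
Lemma sum_cofactor n (M : 'M[K]_n.+1) (j : 'I_n.+1) :
  \sum_k cofactor M j k =
  (-1) ^+ j * \det (\matrix_(a < n, l < n) (M (lift j a) (lift ord0 l) - M (lift j a) ord0)).
Proof.
pose M1 : 'M[K]_n.+1 := \matrix_(a, k) if a == j then 1 else M a k.
pose U : 'M[K]_n.+1 := \matrix_(i, l) ((i == l)%:R - ((i == ord0) && (l != ord0))%:R).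
have detU : \det U = 1.
  rewrite -det_tr det_trig.
    by rewrite big1// => i _; rewrite !mxE eqxx; case: eqP => //=; rewrite subr0.
  apply/is_trig_mxP => i l il; rewrite !mxE.
  have -> : (l == i) = false by apply/negbTE; rewrite -val_eqE gtn_eqF.
  by have -> : (l == ord0) = false; [apply/negbTE; rewrite -val_eqE /= -lt0n (leq_trans _ il)|rewrite subrr].
have MU a l : (M1 *m U) a l = M1 a l - (l != ord0)%:R * M1 a ord0.
  have UE i : U i l = (i == l)%:R - ((i == ord0) && (l != ord0))%:R by rewrite mxE.
  rewrite mxE; under eq_bigr do rewrite UE mulrBr.
  rewrite sumrB (bigD1 l)//= eqxx mulr1 big1 ?addr0; last first.
    by move=> i /negbTE ->; rewrite mulr0.
  rewrite (bigD1 ord0)//= big1 ?addr0; first by rewrite mulrC.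
  by move=> i /negbTE ->; rewrite mulr0.
have E1 : \det M1 = \sum_k cofactor M j k.
  rewrite (expand_det_row _ j); apply: eq_bigr => k _; rewrite mxE eqxx mul1r.
  rewrite /cofactor; congr (_ * \det _); apply/matrixP => a b; rewrite !mxE.
  by rewrite eq_sym (negbTE (neq_lift _ _)).
have -> : \sum_k cofactor M j k = \det (M1 *m U) by rewrite det_mulmx detU mulr1.
rewrite (expand_det_row _ j) (bigD1 ord0)//=.
rewrite big1 ?addr0; last first.
  by move=> l l0; rewrite MU !mxE eqxx l0 mulr1 subrr mul0r.
rewrite MU !mxE !eqxx mul0r subr0 mul1r /cofactor addn0; congr (_ * \det _).
apply/matrixP => a l; rewrite 2![LHS]mxE MU !mxE.
by rewrite eq_sym (negbTE (neq_lift _ _)) eq_sym neq_lift mul1r.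
Qed.

Lemma sum_row_cofactor n (M : 'M[K]_n) (a j : 'I_n) :
  \sum_k M a k * cofactor M j k = \det M *+ (a == j).
Proof.
have := mul_mx_adj M => /matrixP /(_ a j); rewrite !mxE => <-.
by apply: eq_bigr => k _; rewrite !mxE.
Qed.
End Cofactors.

(** * Cofactor rows of a Jacobian matrix are divergence free *)

Section Piola.
Variables (R : realType) (N : nat).
Local Notation C := R[i].
Variables (DX : 'I_N -> 'I_N -> 'rV[R]_N -> C) (D2 : 'I_N -> 'I_N -> 'I_N -> 'rV[R]_N -> C).

(** The derivative in direction k of the (j, k) cofactor, where [DX] holds first and [D2] second
    derivatives of the components. It is indexed by permutations with s j = k so that terms can be
    paired by a transposition. *)
Definition cofactor_derive (j k : 'I_N) (t : 'rV[R]_N) : C :=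
  \sum_(s : 'S_N | s j == k) (-1) ^+ s *
    \sum_(b <- [seq a <- index_enum 'I_N | j != a]) D2 b (s b) k t *
      \prod_(a <- [seq a <- index_enum 'I_N | j != a] | a != b) DX a (s a) t.

Lemma is_cderive_cofactor j k t :
  (forall a b, is_cderive t (delta_mx 0 k) (DX a b) (D2 a b k t)) ->
  is_cderive t (delta_mx 0 k) (fun u => cofactor (\matrix_(a, b) DX a b u) j k)
    (cofactor_derive j k t).
Proof.
move=> dD; rewrite (_ : (fun u => _) = (fun u => \sum_(s : 'S_N | s j == k) (-1) ^+ s *
    \prod_(a <- [seq a <- index_enum 'I_N | j != a]) DX a (s a) u)); last first.
  apply/funext => u; rewrite expand_cofactor; apply: eq_bigr => s _.
  by rewrite big_filter; congr (_ * _); apply: eq_bigr => a _; rewrite mxE.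
apply: is_cderive_sum => s _; apply: is_cderiveZ.
apply: (@is_cderive_prod _ _ _ _ (fun a u => DX a (s a) u)); last by move=> a; exact: dD.
by rewrite filter_uniq// index_enum_uniq.
Qed.

(* The terms of two permutations differing by the transposition (j b) cancel. *)
Lemma piola j t : (forall a k l, D2 a k l t = D2 a l k t) ->
  \sum_k cofactor_derive j k t = 0.
Proof.
move=> sym; set r := [seq a <- index_enum 'I_N | j != a].
pose F (s : 'S_N) b := D2 b (s b) (s j) t * \prod_(a <- r | a != b) DX a (s a) t.
transitivity (\sum_(s : 'S_N) \sum_(b <- r) (-1) ^+ s * F s b).
  rewrite (partition_big (fun s : 'S_N => s j) predT)//=; apply: eq_bigr => k _.
  by apply: eq_bigr => s /eqP sk; rewrite mulr_sumr; apply: eq_bigr => b _; rewrite /F sk.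
rewrite exchange_big /= big_seq big1// => b; rewrite mem_filter => /andP[jb _].
set T := (X in X = 0); suff /eqP : T = - T.
  by rewrite -subr_eq0 opprK -mulr2n mulrn_eq0 /= => /eqP.
rewrite {1}/T (reindex_inj (mulgI (tperm j b))) /= -sumrN; apply: eq_bigr => s _.
rewrite odd_permM odd_tperm jb signr_addb expr1 mulN1r mulNr; congr (- (_ * _)).
rewrite /F !permM tpermL tpermR sym; congr (_ * _).
rewrite big_seq_cond [RHS]big_seq_cond; apply: eq_bigr => a.
rewrite mem_filter => /andP[/andP[ja _] ab].
by rewrite permM tpermD// eq_sym.
Qed.

End Piola.

(** * Stokes' theorem on one simplex *)

Section ComplexSmooth.
Variable R : realType.
Local Notation C := R[i].
Local Notation Re := (@complex.Re R).
Local Notation Im := (@complex.Im R).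

Definition complex_smooth_on N (U : set 'rV[R]_N) (f : 'rV[R]_N -> C) :=
  smooth_on U (fun t => Re (f t)) /\ smooth_on U (fun t => Im (f t)).

Lemma complex_smooth_on_rpartial N (U : set 'rV[R]_N) (f : 'rV[R]_N -> C) k :
  complex_smooth_on U f -> complex_smooth_on U (rpartial k f).
Proof. by move=> [h1 h2]; split; exact: smooth_on_derive. Qed.

Lemma is_cderive_smooth N (U : set 'rV[R]_N) (f : 'rV[R]_N -> C) k t :
  complex_smooth_on U f -> U t -> is_cderive t (delta_mx 0 k) f (rpartial k f t).
Proof.
move=> [h1 h2] Ut; split; split=> //; apply: diff_derivable.
  exact: (smooth_on_differentiable h1 Ut).
exact: (smooth_on_differentiable h2 Ut).
Qed.

Lemma rpartial_symm N (U : set 'rV[R]_N) (f : 'rV[R]_N -> C) k l t : open U ->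
  complex_smooth_on U f -> U t -> rpartial l (rpartial k f) t = rpartial k (rpartial l f) t.
Proof.
move=> oU [h1 h2] Ut; have e1 := smooth_on_symm k l oU h1 Ut.
by have e2 := smooth_on_symm k l oU h2 Ut; rewrite {1 3}/rpartial /= e1 e2.
Qed.

Lemma complex_smooth_on_continuous N (U : set 'rV[R]_N) (f : 'rV[R]_N -> C) t :
  complex_smooth_on U f -> U t -> {for t, continuous f}.
Proof.
move=> [h1 h2] Ut; apply/(cvg_complexP (nbhs_filter t)); split.
  exact: (differentiable_continuous (smooth_on_differentiable h1 Ut)).
exact: (differentiable_continuous (smooth_on_differentiable h2 Ut)).
Qed.

Lemma corner_continuous_smooth N (U : set 'rV[R]_N) (f : 'rV[R]_N -> C) :
  corner 1 `<=` U -> complex_smooth_on U f -> corner_continuous f.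
Proof.
move=> cU sf; apply: corner_continuous_cvg => t ct.
exact: (complex_smooth_on_continuous sf (cU _ ct)).
Qed.

Lemma rpartialE N (f : 'rV[R]_N -> C) k t d :
  is_cderive t (delta_mx 0 k) f d -> rpartial k f t = d.
Proof. by move=> [[_ h1] [_ h2]]; rewrite /rpartial h1 h2; case: d {h1 h2}. Qed.

Lemma near_corner_int N (t : 'rV[R]_N) r : corner_int r t ->
  \forall u \near t, corner_int r u.
Proof.
move=> [t0 t1].
have h1 : \forall u \near t, forall i : 'I_N, 0 < (u : 'rV[R]_N) 0 i.
  apply: (@filter_forall _ _ (fun (i : 'I_N) (u : 'rV[R]_N) => 0 < u 0 i) _ (nbhs_filter t)) => i.
  have /cvgrPdist_lt /(_ _ (t0 i)) h := @coord_continuous R 1 N 0 i t.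
  by apply: (near_mono _ h) => u; rewrite ltr_distlC subrr => /andP[].
have h2 : \forall u \near t, \sum_i (u : 'rV[R]_N) 0 i < r.
  have d0 : 0 < r - \sum_i t 0 i by rewrite subr_gt0.
  have /cvgrPdist_lt /(_ _ d0) h := @sum_coord_continuous R N t.
  by apply: (near_mono _ h) => u; rewrite ltr_distlC => /andP[_]; rewrite addrC subrK.
exact: near_and.
Qed.

Lemma corner_bary N (y : 'rV[R]_N) : corner 1 y -> corner 1 (bary y).
Proof.
move=> [y0 y1]; split; last by rewrite baryE sum_vcons subrK.
move=> i; rewrite baryE; have [j ->|->] := unliftP ord0 i; first by rewrite vconsS.
by rewrite vcons0 subr_ge0.
Qed.

Lemma corner_vins N (k : 'I_N.+1) (y : 'rV[R]_N) : corner 1 y -> corner 1 (vins k 0 y).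
Proof.
move=> [y0 y1]; split.
  by move=> i; have [j ->|->] := unliftP k i; rewrite ?vinsS ?vinsE.
rewrite (bigD1_ord k)//= vinsE add0r; under eq_bigr do rewrite vinsS.
by [].
Qed.

(** The real statement is applied to V and W composed with the retraction, which is the identity
    near interior points and so leaves the derivatives there unchanged. *)
Lemma simplex_divergence N (k : 'I_N.+1) (V W : 'rV[R]_N.+1 -> C) :
  corner_continuous V -> corner_continuous W ->
  (forall t, corner_int 1 t -> is_cderive t (delta_mx 0 k) V (W t)) ->
  simplex_integral W = simplex_integral (fun y => V (bary y))
                     - simplex_integral (fun y => V (vins k 0 y)).
Proof.
move=> cV cW dV.
have cR (f : 'rV[R]_N.+1 -> C) : corner_continuous f -> continuous (fun t => Re (f (retract t))).
  move=> cf; apply: (@continuous_compose _ _ _ (fun t => f (retract t)) Re).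
    exact: retract_comp_continuous.
  exact: Re_continuous.
have cI (f : 'rV[R]_N.+1 -> C) : corner_continuous f -> continuous (fun t => Im (f (retract t))).
  move=> cf; apply: (@continuous_compose _ _ _ (fun t => f (retract t)) Im).
    exact: retract_comp_continuous.
  exact: Im_continuous.
have nr (t : 'rV[R]_N.+1) : corner_int 1 t -> \forall u \near t, u = retract u.
  move=> ct; apply: (near_mono _ (near_corner_int ct)) => u cu.
  by rewrite retract_id//; exact: corner_int_sub.
have dR t : corner_int 1 t ->
    is_derive t (delta_mx 0 k) (fun t => Re (V (retract t))) (Re (W (retract t))).
  move=> ct; have [d1 _] := dV _ ct; rewrite (retract_id (corner_int_sub ct)).
  by apply: near_eq_is_derive d1; apply: (near_mono _ (nr _ ct)) => u {1}->.
have dI t : corner_int 1 t ->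
    is_derive t (delta_mx 0 k) (fun t => Im (V (retract t))) (Im (W (retract t))).
  move=> ct; have [_ d2] := dV _ ct; rewrite (retract_id (corner_int_sub ct)).
  by apply: near_eq_is_derive d2; apply: (near_mono _ (nr _ ct)) => u {1}->.
have H1 := corner_divergence ler01 (cR _ cV) (cR _ cW) dR.
have H2 := corner_divergence ler01 (cI _ cV) (cI _ cW) dI.
rewrite (simplex_integral_retract W) H1 H2 /simplex_integral.
have E (a b c d : R) : (a +i* b) - (c +i* d) = (a - c) +i* (b - d) by [].
rewrite E; congr ((_ - _) +i* (_ - _)); apply: eq_corner_integral => // y cy;
  rewrite retract_id//; [exact: corner_bary|exact: corner_vins|exact: corner_bary|exact: corner_vins].
Qed.

End ComplexSmooth.

Section Stokes.
Variables (R : realType) (N : nat).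
Local Notation C := R[i].
Variables (U : set 'rV[R]_N.+1) (X : 'rV[R]_N.+1 -> 'rV[C]_N.+1).
Hypothesis oU : open U.
Hypothesis cornerU : corner 1 `<=` U.
Hypothesis smoothX : forall a, complex_smooth_on U (fun t => X t 0 a).
Variables (u : 'rV[R]_N.+1 -> C) (g : 'I_N.+1 -> 'rV[R]_N.+1 -> C).
Hypothesis cu : corner_continuous u.
Hypothesis cg : forall a, corner_continuous (g a).

Definition jacobian_matrix (t : 'rV[R]_N.+1) : 'M[C]_N.+1 :=
  \matrix_(a, k) rpartial k (fun v => X v 0 a) t.

(** The coefficient of the pull-back by [Y] of the wedge product of all dx_a with a different from
    j. *)
Definition minor (j : 'I_N.+1) (Y : 'rV[R]_N -> 'rV[C]_N.+1) (y : 'rV[R]_N) : C :=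
  \det (\matrix_(a < N, l < N) rpartial l (fun v => Y v 0 (lift j a)) y).

Hypothesis du : forall k t, corner_int 1 t ->
  is_cderive t (delta_mx 0 k) u (\sum_a g a t * jacobian_matrix t a k).

Let DX a k t : C := rpartial k (fun v => X v 0 a) t.
Let D2 a k l t : C := rpartial l (DX a k) t.

Let sDX a k : complex_smooth_on U (DX a k).
Proof. exact: complex_smooth_on_rpartial. Qed.

Let cDX a k : corner_continuous (DX a k).
Proof. exact: (corner_continuous_smooth cornerU (sDX a k)). Qed.

Let cD2 a k l : corner_continuous (D2 a k l).
Proof.
exact: (corner_continuous_smooth cornerU (complex_smooth_on_rpartial l (sDX a k))).
Qed.

Lemma corner_continuous_jacobian a k : corner_continuous (fun t => jacobian_matrix t a k).
Proof.
have -> : (fun t => jacobian_matrix t a k) = DX a k by apply/funext => t; rewrite mxE.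
exact: cDX.
Qed.

Lemma corner_continuous_cofactor j k :
  corner_continuous (fun t => cofactor (jacobian_matrix t) j k).
Proof.
rewrite /cofactor; apply: corner_continuousM; first exact: corner_continuous_cst.
apply: corner_continuous_det => a b.
have -> : (fun t => row' j (col' k (jacobian_matrix t)) a b) = DX (lift j a) (lift k b).
  by apply/funext => t; rewrite !mxE.
exact: cDX.
Qed.

Let cofder j k t := cofactor_derive DX D2 j k t.

Let c_cofder j k : corner_continuous (cofder j k).
Proof.
rewrite /cofder /cofactor_derive; apply: corner_continuous_sum => s _.
apply: corner_continuousM; first exact: corner_continuous_cst.
apply: corner_continuous_sum => b _; apply: corner_continuousM; first exact: cD2.
by apply: corner_continuous_prod => a _; exact: cDX.
Qed.

(** The field with components u times the (j, k) cofactor has divergence [g j] times the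
    determinant: the derivative of u pairs each row a of the Jacobian matrix with the cofactors of
    row j, which gives 0 unless a = j, and the derivatives of the cofactors cancel by [piola]. *)
Lemma stokes_cofactor j : simplex_integral (fun t => g j t * \det (jacobian_matrix t)) =
  simplex_integral (fun y => u (bary y) * \sum_k cofactor (jacobian_matrix (bary y)) j k)
  - \sum_k simplex_integral (fun y => u (vins k 0 y) * cofactor (jacobian_matrix (vins k 0 y)) j k).
Proof.
pose V k t := u t * cofactor (jacobian_matrix t) j k.
pose W k t := (\sum_a g a t * jacobian_matrix t a k) * cofactor (jacobian_matrix t) j k +
  u t * cofder j k t.
have cV k : corner_continuous (V k).
  by apply: corner_continuousM => //; exact: corner_continuous_cofactor.
have cW k : corner_continuous (W k).
  apply: corner_continuousD; last by apply: corner_continuousM; [exact: cu|exact: c_cofder].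
  apply: corner_continuousM; last exact: corner_continuous_cofactor.
  apply: corner_continuous_sum => a _; apply: corner_continuousM; first exact: cg.
  exact: corner_continuous_jacobian.
have dV k t : corner_int 1 t -> is_cderive t (delta_mx 0 k) (V k) (W k t).
  move=> ct; apply: is_cderiveM; first exact: du.
  apply: (@is_cderive_cofactor _ _ DX D2) => a b.
  exact: (is_cderive_smooth k (sDX a b) (cornerU (corner_int_sub ct))).
transitivity (simplex_integral (fun t => \sum_k W k t)).
  apply: eq_simplex_integral_corner => t ct; rewrite /W big_split /= -mulr_sumr piola; last first.
    by move=> a k l; exact: (rpartial_symm k l oU (smoothX a) (cornerU ct)).
  rewrite mulr0 addr0; under eq_bigr do rewrite mulr_suml.
  rewrite exchange_big /=; under eq_bigr do (under eq_bigr do rewrite -mulrA);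
    under eq_bigr do rewrite -mulr_sumr sum_row_cofactor.
  by rewrite (bigD1 j)//= eqxx big1 ?addr0// => a /negbTE ->; rewrite mulr0.
rewrite simplex_integral_sum; last by move=> k _; exact: cW.
under eq_bigr => k _ do rewrite (simplex_divergence (cV k) (cW k) (dV k)).
have cVb k : corner_continuous (fun y => V k (bary y)).
  exact: (corner_continuous_reparam (cV k) (@bary_continuous R N) (@corner_bary R N)).
have sb : simplex_integral (fun y => \sum_k V k (bary y)) =
    \sum_k simplex_integral (fun y => V k (bary y)).
  exact: simplex_integral_sum.
rewrite sumrB; congr (_ - _); apply: etrans (esym sb) _.
by apply: eq_simplex_integral_corner => y cy; rewrite mulr_sumr.
Qed.

(** Inserting a zero is affine, so deleting column k of the Jacobian matrix amounts to restricting
    the map to the face t_k = 0. *)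
Lemma minor_vins j k (y : 'rV[R]_N) : corner 1 y ->
  cofactor (jacobian_matrix (vins k 0 y)) j k =
  (-1) ^+ (j + k) * minor j (fun v => X (vins k 0 v)) y.
Proof.
move=> cy; rewrite /cofactor /minor; congr (_ * \det _).
apply/matrixP => a l; rewrite !mxE; apply/esym/rpartialE.
have Uy : U (vins k 0 y) by exact/cornerU/corner_vins.
have line h : vins k 0 (h *: delta_mx 0 l + y) =
    h *: delta_mx 0 (lift k l) + vins k 0 y :> 'rV[R]_N.+1.
  apply/rowP => i; have [i' ->|->] := unliftP k i.
    by rewrite vinsS !mxE liftK (inj_eq (@lift_inj _ k)).
  by rewrite vinsE !mxE unlift_none (negbTE (neq_lift _ _)) andbF mulr0 addr0.
have [d1 d2] := is_cderive_smooth (lift k l) (smoothX (lift j a)) Uy.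
split.
  by apply: (eq_is_derive_line _ d1) => h; rewrite line.
by apply: (eq_is_derive_line _ d2) => h; rewrite line.
Qed.

(** The derivatives along [bary] are the differences of columns that [sum_cofactor] produces. *)
Lemma minor_bary j (y : 'rV[R]_N) : corner 1 y ->
  \sum_k cofactor (jacobian_matrix (bary y)) j k =
  (-1) ^+ j * minor j (fun v => X (bary v)) y.
Proof.
move=> cy; rewrite sum_cofactor /minor; congr (_ * \det _).
apply/matrixP => a l; rewrite !mxE; apply/esym/rpartialE.
have Uy : U (bary y) by exact/cornerU/corner_bary.
have [s1 s2] := smoothX (lift j a).
split; rewrite raddfB; apply: derive_bary.
  exact: (smooth_on_differentiable s1 Uy).
exact: (smooth_on_differentiable s2 Uy).
Qed.

(** Stokes' theorem for u times the wedge of the dx_a with a different from j, given that du is the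
    sum of the g_a dx_a; the sign (-1)^j comes from moving dx_j past the preceding factors. *)
Theorem stokes_simplex j : simplex_integral (fun t => g j t * \det (jacobian_matrix t)) =
  (-1) ^+ j * (simplex_integral (fun y => u (bary y) * minor j (fun v => X (bary v)) y)
  - \sum_(k < N.+1) (-1) ^+ k *
      simplex_integral (fun y => u (vins k 0 y) * minor j (fun v => X (vins k 0 v)) y)).
Proof.
have sgn2 i : (-1) ^+ i * (-1) ^+ i = 1 :> C by rewrite -exprD addnn -signr_odd odd_double.
have cub : corner_continuous (fun y => u (bary y)).
  exact: (corner_continuous_reparam cu (@bary_continuous R N) (@corner_bary R N)).
have cuv k : corner_continuous (fun y => u (vins k 0 y)).
  exact: (corner_continuous_reparam cu (@vins_continuous R N k 0) (@corner_vins R N k)).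
have cmb : corner_continuous (fun y => u (bary y) * \sum_k cofactor (jacobian_matrix (bary y)) j k).
  apply: corner_continuousM; first exact: cub.
  apply: corner_continuous_sum => k _.
  exact: (corner_continuous_reparam (corner_continuous_cofactor j k)
    (@bary_continuous R N) (@corner_bary R N)).
have cmv k : corner_continuous
    (fun y => u (vins k 0 y) * cofactor (jacobian_matrix (vins k 0 y)) j k).
  apply: corner_continuousM; first exact: cuv.
  exact: (corner_continuous_reparam (corner_continuous_cofactor j k)
    (@vins_continuous R N k 0) (@corner_vins R N k)).
rewrite stokes_cofactor mulrBr mulr_sumr; congr (_ - _).
  transitivity ((-1) ^+ j * ((-1) ^+ j * simplex_integral
      (fun y => u (bary y) * \sum_k cofactor (jacobian_matrix (bary y)) j k))).
    by rewrite mulrA sgn2 mul1r.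
  rewrite -simplex_integralZ; last exact: cmb.
  congr (_ * _); apply: eq_simplex_integral_corner => y cy.
  by rewrite minor_bary// mulrCA; congr (_ * _); rewrite mulrA sgn2 mul1r.
apply: eq_bigr => k _; rewrite mulrA -exprD.
transitivity ((-1) ^+ (j + k) * ((-1) ^+ (j + k) * simplex_integral
    (fun y => u (vins k 0 y) * cofactor (jacobian_matrix (vins k 0 y)) j k))).
  by rewrite mulrA sgn2 mul1r.
rewrite -simplex_integralZ; last exact: cmv.
congr (_ * _); apply: eq_simplex_integral_corner => y cy.
by rewrite minor_vins// mulrCA; congr (_ * _); rewrite mulrA sgn2 mul1r.
Qed.

End Stokes.

(** * Gradients, logarithmic derivatives and expansions of powers *)

Section RowForm.
Variables (K : numFieldType) (m : nat).

Definition row_form (d : 'I_m -> K) (v : 'rV[K]_m) : K^o := \sum_i v 0 i * d i.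

Fact row_form_linear d : linear (row_form d).
Proof.
move=> k u v; rewrite /row_form scaler_sumr -big_split /=.
by apply: eq_bigr => i _; rewrite !mxE mulrDl -mulrA.
Qed.
HB.instance Definition _ d :=
  GRing.isLinear.Build K 'rV[K]_m K^o *:%R (row_form d) (row_form_linear d).

Lemma row_form_continuous d : continuous (row_form d).
Proof.
move=> v; apply: (@cvg_bigsum _ _ _ (nbhs_filter v) K^o) => i _.
by apply: (@cvgM _ _ _ (nbhs_filter v)); [exact: coord_continuous|exact: cvg_cst].
Qed.

Lemma row_form_delta d i : row_form d (delta_mx 0 i) = d i.
Proof.
rewrite /row_form (bigD1 i)//= mxE !eqxx mul1r big1 ?addr0// => j ji.
by rewrite mxE (negbTE ji) andbF mul0r.
Qed.
End RowForm.

Section RowNorm.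
Variables (R : realType) (m : nat).
Local Notation C := R[i].
Implicit Types v : 'rV[C]_m.

Lemma norm_realC (V : normedModType C) (v : V) : exists2 r : R, 0 <= r & `|v| = r%:C.
Proof.
have := normr_ge0 v; case: `|v| => a b; rewrite lecE /= => /andP[/eqP -> a0].
by exists a.
Qed.

Lemma ler_coord_norm v j : `|v 0 j| <= `|v|.
Proof.
have [a a0 Ea] := norm_realC (v 0 j : C); have [b b0 Eb] := norm_realC v.
rewrite Ea Eb lecR leNgt; apply/negP => ba.
have : ball (0 : 'rV[C]_m) a%:C v by rewrite -ball_normE /= sub0r normrN Eb ltcR.
move=> [_ /(_ 0 j)]; rewrite -ball_normE /= mxE sub0r normrN Ea.
by rewrite ltxx.
Qed.

Lemma row_norm_le v (r : C) : 0 <= r -> (forall j, `|v 0 j| <= r) -> `|v| <= r.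
Proof.
move=> r0 vr; have [v0|v0] := eqVneq (mx_norm v) 0; first by rewrite [X in X <= _](_ : _ = mx_norm v)// v0.
have [[i j] /= E] := mx_norm_neq0 v0.
by rewrite [X in X <= _](_ : _ = mx_norm v)// E (ord1 i).
Qed.

End RowNorm.

Section PowerCalculus.
Variable R : realType.
Local Notation C := R[i].
Local Notation Re := (@complex.Re R).

Lemma bound_row_form m (F : 'rV[C]_m -> C) (x : 'rV[C]_m) (d : 'I_m -> C) :
  (forall e : C, 0 < e -> \forall z \near x,
    `|F z - F x - \sum_i (z - x) 0 i * d i| <= e * `|z - x|) ->
  differentiable F x /\ forall i, cpartial i F x = d i.
Proof.
move=> h; have [dF dE] := @bound_differentiable _ _ _ F x _ (@row_form_continuous C m d) h.
by split => // i; rewrite /cpartial deriveE// dE; exact: row_form_delta.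
Qed.

(** The expansion at 1 makes [cpow] complex differentiable there; row vectors of length one put it
    in the format of [is_cderive_chain]. *)
Lemma is_cderive_cpow1 (V : normedModType R) (w : V -> C) (a d : C) (t v : V) :
  w t = 1 -> is_cderive t v w d -> is_cderive t v (fun u => cpow (w u) a) (a * d).
Proof.
move=> w1 dw; pose F (x : 'rV[C]_1) := cpow (x 0 0) a; pose one : 'rV[C]_1 := const_mx 1.
have [dF dE] : differentiable F one /\ forall i, cpartial i F one = a.
  apply: bound_row_form => e e0.
  have h : \forall z \near one, `|cpow ((z : 'rV[C]_1) 0 0) a - 1 - a * (z 0 0 - 1)|
      <= e * `|z 0 0 - 1|.
    have cc : (z : 'rV[C]_1) 0 0 @[z --> one] --> (1 : C).
      by rewrite -[X in _ --> X](_ : one 0 0 = 1); [exact: coord_continuous|rewrite mxE].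
    exact: (cc _ (cpow_bound1 a e0)).
  apply: (near_mono _ h) => z hz.
  rewrite /F big_ord1 !mxE cpow1 mulrC; apply: le_trans hz _.
  rewrite ler_wpM2l ?(ltW e0)//; apply: le_trans (ler_coord_norm _ 0).
  by rewrite !mxE.
have E : (fun u => const_mx (w u) : 'rV[C]_1) t = one by rewrite w1.
have dF' : differentiable F ((fun u => const_mx (w u) : 'rV[C]_1) t) by rewrite E.
have := @is_cderive_chain R V 1 F (fun u => const_mx (w u)) (const_mx d) t v dF'.
rewrite big_ord1 E dE mxE => h.
have : is_cderive t v (fun u => F (const_mx (w u))) (a * d).
  by apply: h => j; rewrite mxE (_ : (fun u => _) = w)//; apply/funext => u; rewrite mxE.
by rewrite (_ : (fun u => _) = (fun u => cpow (w u) a))//; apply/funext => u; rewrite /F mxE.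
Qed.

Section LogDerivative.
Variables (V : normedModType R) (t v : V).
Implicit Types (f g : V -> C) (d e : C).

(** The logarithmic derivative is kept multiplied out, so that products and powers are handled
    without dividing by f t. *)
Definition is_logder f d := is_cderive t v f (f t * d).

Lemma is_logder_cderive f d : f t != 0 -> is_cderive t v f d -> is_logder f (d / f t).
Proof. by move=> f0 fd; rewrite /is_logder mulrC divfK. Qed.

Lemma is_logderM f g d e : is_logder f d -> is_logder g e ->
  is_logder (fun u => f u * g u) (d + e).
Proof.
by move=> fd ge; apply: is_cderive_eq (is_cderiveM fd ge) _; ring.
Qed.

Lemma is_logder1 : is_logder (fun=> 1) 0.
Proof. by rewrite /is_logder mulr0; exact: is_cderive_cst. Qed.

Lemma is_logder_prod (I : Type) (r : seq I) (f : I -> V -> C) (d : I -> C) :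
  (forall i, is_logder (f i) (d i)) ->
  is_logder (fun u => \prod_(i <- r) f i u) (\sum_(i <- r) d i).
Proof.
move=> fd; elim: r => [|i r IH].
  rewrite big_nil (_ : (fun u => _) = (fun=> 1)); first exact: is_logder1.
  by apply/funext => u; rewrite big_nil.
rewrite big_cons (_ : (fun u => _) = (fun u => f i u * \prod_(i <- r) f i u)).
  by apply: is_logderM; [exact: fd|exact: IH].
by apply/funext => u; rewrite big_cons.
Qed.

Lemma is_logderX f d k : is_logder f d -> is_logder (fun u => f u ^+ k) (d *+ k).
Proof.
move=> fd; elim: k => [|k IH].
  rewrite (_ : (fun u => _) = (fun=> 1)); first exact: is_logder1.
  by apply/funext => u; rewrite expr0.
rewrite mulrS (_ : (fun u => _) = (fun u => f u * f u ^+ k)); first exact: is_logderM.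
by apply/funext => u; rewrite exprS.
Qed.

Lemma near_cderive f d : is_cderive t v f d -> forall e : C, 0 < e ->
  \forall h \near (0 : R)^', `|f t - f (h *: v + t)| < e.
Proof.
move=> /is_cderiveP fd e e0; have FF : Filter ((0 : R)^') by exact: dnbhs_filter.
have hc : h%:C @[h --> (0 : R)^'] --> (0 : C).
  apply: cvg_within_filter; exact: (@realC_continuous R 0).
have := @cvgM C _ _ FF _ _ _ _ hc fd; rewrite mul0r => /cvgrPdist_lt /(_ e e0) h1.
have n0 : \forall h \near (0 : R)^', h != 0 by exact: nbhs_dnbhs_neq.
apply: (filterS _ (filterI h1 n0)) => h [/= + h0].
by rewrite sub0r normrN mulrA -rmorphM/= divff// mul1r distrC.
Qed.

Lemma is_cderive_line_near f g d : f t = g t ->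
  (\forall h \near (0 : R)^', f (h *: v + t) = g (h *: v + t)) ->
  is_cderive t v f d -> is_cderive t v g d.
Proof.
move=> ft fg /is_cderiveP fd; apply/is_cderiveP; apply: cvg_trans fd.
apply: near_eq_cvg; have FF : Filter ((0 : R)^') by exact: dnbhs_filter.
by apply: (filterS _ fg) => h /= ->; rewrite ft.
Qed.

Lemma is_logderV f d : f t != 0 -> is_logder f d -> is_logder (fun u => (f u)^-1) (- d).
Proof.
move=> f0 fd; have FF : Filter ((0 : R)^') by exact: dnbhs_filter.
have ft : f (h *: v + t) @[h --> (0 : R)^'] --> f t.
  by apply/cvgrPdist_lt => e e0; exact: (near_cderive fd e0).
have n1 : \forall h \near (0 : R)^', f (h *: v + t) != 0.
  have nf : 0 < `|f t| by rewrite normr_gt0.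
  apply: (filterS _ (near_cderive fd nf)) => h /= hh; apply: contraTneq hh => ->.
  by rewrite subr0 ltxx.
rewrite /is_logder; apply/is_cderiveP.
have fV := @cvgV C _ _ FF _ _ f0 ft.
have := @cvgM C _ _ FF _ _ _ _ fV ((is_cderiveP _ _ _ _).1 fd) => H.
have H' := @cvgM C _ _ FF _ _ _ _ (@cvg_cst _ (- (f t)^-1) _ _ FF) H.
rewrite [X in _ --> X](_ : _ = - (f t)^-1 * ((f t)^-1 * (f t * d))); last by field.
move: H'; apply: cvg_trans; apply: near_eq_cvg; apply: (filterS _ n1) => h hn /=.
by move: (h^-1)%:C => x; field; rewrite f0 hn.
Qed.

(** Near t, f is f t times f / f t with all three in the half-plane, so the power splits and the
    derivative is needed at the base 1 only. *)
Lemma is_logder_cpow f d a : 0 < Re (f t) -> is_logder f d ->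
  is_logder (fun u => cpow (f u) a) (a * d).
Proof.
move=> f0 fd; have fn0 : f t != 0 by apply: contraTneq f0 => ->; rewrite ltxx.
have FF : Filter ((0 : R)^') by exact: dnbhs_filter.
have w1 : f t / f t = 1 by rewrite divff.
have dw : is_cderive t v (fun u => f u / f t) d.
  rewrite (_ : (fun u => _) = (fun u => (f t)^-1 * f u)).
    by apply: is_cderive_eq (is_cderiveZ _ fd) _; rewrite mulrA mulVf// mul1r.
  by apply/funext => u; rewrite mulrC.
have := is_cderiveZ (cpow (f t) a) (is_cderive_cpow1 a w1 dw).
rewrite /is_logder; apply: is_cderive_line_near; first by rewrite w1 cpow1 mulr1.
have ft : f (h *: v + t) @[h --> (0 : R)^'] --> f t.
  by apply/cvgrPdist_lt => e e0; exact: (near_cderive fd e0).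
have wt : f (h *: v + t) / f t @[h --> (0 : R)^'] --> (1 : C).
  by rewrite -w1; apply: (@cvgM C _ _ FF); [exact: ft|exact: cvg_cst].
have p1 : 0 < Re (1 : C) by rewrite /= ltr01.
have h1 : \forall h \near (0 : R)^', 0 < Re (f (h *: v + t)) := ft _ (near_Re_gt0 f0).
have h2 : \forall h \near (0 : R)^', 0 < Re (f (h *: v + t) / f t) := wt _ (near_Re_gt0 p1).
apply: (filterS _ (filterI h1 h2)) => h /= [k1 k2].
by rewrite -cpowM// [f t * _]mulrC divfK.
Qed.

End LogDerivative.

(** A first-order expansion at 0 of a function with value 1 there, kept in quantified form: it is
    applied at arguments that depend on the integration variable, with one bound for the whole
    simplex. *)
Definition expands1 m (f : 'rV[C]_m -> C) (l : 'I_m -> C) : Prop :=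
  forall e : C, 0 < e -> \forall z \near (0 : 'rV[C]_m),
    `|f z - 1 - \sum_i z 0 i * l i| <= e * `|z|.

Lemma expands1_bound m (f : 'rV[C]_m -> C) l : expands1 f l ->
  exists2 B : C, 0 < B & \forall z \near (0 : 'rV[C]_m), `|f z - 1| <= B * `|z|.
Proof.
move=> fl; exists (1 + \sum_i `|l i|); first by rewrite ltr_pwDl// sumr_ge0.
apply: (near_mono _ (fl 1 ltr01)) => z hz.
rewrite -[f z - 1](subrK (\sum_i z 0 i * l i)) (le_trans (ler_normD _ _))//.
rewrite mulrDl lerD// (le_trans (ler_norm_sum _ _ _))// mulr_suml ler_sum// => i _.
by rewrite normrM mulrC ler_wpM2l// ler_coord_norm.
Qed.

Lemma near0_norm m (e : C) : 0 < e -> \forall z \near (0 : 'rV[C]_m), `|z| <= e.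
Proof.
move=> e0; have : \forall z \near (0 : 'rV[C]_m), ball (0 : 'rV[C]_m) e z.
  exact: nbhsx_ballx.
by apply: near_mono => z; rewrite -ball_normE /= sub0r normrN => /ltW.
Qed.

Lemma expands1M m (f g : 'rV[C]_m -> C) l k : expands1 f l -> expands1 g k ->
  expands1 (fun z => f z * g z) (fun i => l i + k i).
Proof.
move=> fl gk e e0; have [B B0 hB] := expands1_bound fl; have [D D0 hD] := expands1_bound gk.
have e4 : 0 < e / 4 by rewrite divr_gt0.
have eBD : 0 < e / 2 / (B * D) by rewrite !divr_gt0// mulr_gt0.
apply: (near_mono _ (near_and (near_and (fl _ e4) (gk _ e4)) (near_and (near_and hB hD)
  (near0_norm m eBD)))) => z [[h1 h2] [[h3 h4] h5]].
have -> : f z * g z - 1 - \sum_i z 0 i * (l i + k i) =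
    (f z - 1 - \sum_i z 0 i * l i) + (g z - 1 - \sum_i z 0 i * k i) + (f z - 1) * (g z - 1).
  by under eq_bigr do rewrite mulrDr; rewrite big_split /=; ring.
apply: le_trans (ler_normD _ _) _.
have -> : e * `|z| = (e / 4 * `|z| + e / 4 * `|z|) + e / 2 * `|z| by field.
apply: lerD; first by apply: le_trans (ler_normD _ _) _; exact: lerD.
rewrite normrM; apply: le_trans (_ : (B * `|z|) * (D * `|z|) <= _).
  by apply: ler_pM.
have -> : (B * `|z|) * (D * `|z|) = (B * D * `|z|) * `|z| by ring.
rewrite ler_wpM2r//; move: h5; rewrite ler_pdivlMr ?mulr_gt0//.
by rewrite mulrC.
Qed.

Lemma expands1_1 m : expands1 (fun=> 1 : C) (fun _ : 'I_m => 0).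
Proof.
move=> e e0; apply: (@filterE _ _ (nbhs_filter (0 : 'rV[C]_m))) => z.
rewrite subrr sub0r normrN big1; last by move=> i _; rewrite mulr0.
by rewrite normr0 mulr_ge0 ?normr_ge0 ?(ltW e0).
Qed.

Lemma expands1_cpow m i a :
  expands1 (fun z : 'rV[C]_m => cpow (1 - z 0 i) a) (fun j => - a *+ (j == i)).
Proof.
move=> e e0; have c1 : 1 - (z : 'rV[C]_m) 0 i @[z --> (0 : 'rV[C]_m)] --> (1 : C).
  rewrite -[X in _ --> X]subr0; apply: (@cvgB _ C _ _ (nbhs_filter (0 : 'rV[C]_m))).
    exact: cvg_cst.
  rewrite -[X in _ --> X](_ : (0 : 'rV[C]_m) 0 i = 0); last by rewrite mxE.
  exact: coord_continuous.
have h : \forall z \near (0 : 'rV[C]_m),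
    `|cpow (1 - (z : 'rV[C]_m) 0 i) a - 1 - a * (1 - z 0 i - 1)| <= e * `|1 - z 0 i - 1|.
  exact: (c1 _ (cpow_bound1 a e0)).
apply: (near_mono _ h) => z; rewrite [1 - z 0 i - 1]addrAC subrr sub0r normrN.
rewrite (bigD1 i)//= eqxx mulr1n big1 ?addr0; last first.
  by move=> j /negbTE ->; rewrite mulr0n mulr0.
rewrite !mulrN [z 0 i * a]mulrC => /le_trans; apply.
by rewrite ler_wpM2l ?(ltW e0)// ler_coord_norm.
Qed.

Lemma expands1_prod_cpow m (a : 'I_m -> C) :
  expands1 (fun z => \prod_i cpow (1 - z 0 i) (a i)) (fun i => - a i).
Proof.
suff H (r : seq 'I_m) : expands1 (fun z => \prod_(i <- r) cpow (1 - z 0 i) (a i))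
    (fun j => \sum_(i <- r) (- a i *+ (j == i))).
  have := H (index_enum 'I_m); congr (expands1 _ _); apply/funext => j.
  by rewrite (bigD1 j)//= eqxx big1 ?addr0// => i; rewrite eq_sym => /negbTE ->.
elim: r => [|i r IH].
  have := @expands1_1 m; congr (expands1 _ _); apply/funext => z; by rewrite big_nil.
have := expands1M (expands1_cpow i (a i)) IH.
by congr (expands1 _ _); apply/funext => z; rewrite big_cons.
Qed.

Lemma cpowD (z a b : C) : cpow z (a + b) = cpow z a * cpow z b.
Proof. by rewrite /cpow mulrDl cexpD. Qed.

(** Lets a denominator of exponent e_i be absorbed into the power, as s_i - e_i. *)
Lemma cpowN_nat (z : C) k : 0 < Re z -> cpow z (- k%:R) = z^-1 ^+ k.
Proof.
move=> z0; have E : cpow z (-1) = z^-1.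
  have zn0 : z != 0 by apply: contraTneq z0 => ->; rewrite ltxx.
  apply: (mulIf zn0); rewrite mulVf// -{2}(clogK z0) /cpow mulN1r -cexpD.
  by rewrite addNr cexp0.
elim: k => [|k IH]; first by rewrite oppr0 expr0 /cpow mul0r cexp0.
by rewrite -[in LHS]addn1 natrD opprD cpowD IH E exprSr.
Qed.

End PowerCalculus.

Section CpowContinuity.
Variable R : realType.
Local Notation C := R[i].
Local Notation Re := (@complex.Re R).

Lemma cpow_continuous1 (a : C) : cpow z a @[z --> (1 : C)] --> (1 : C).
Proof.
have FF := nbhs_filter (1 : C).
apply/cvgrPdist_lt => e e0; have a1 : 0 < 1 + `|a| by rewrite ltr_pwDl.
have e2 : 0 < e / (1 + `|a|) by rewrite divr_gt0.
have h2 : \forall z \near (1 : C), `|z - 1| < e / (1 + `|a|).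
  by have := nbhsx_ballx (1 : C) _ e2; apply: near_mono => z; rewrite -ball_normE /= distrC.
apply: (near_mono _ (near_and h2 (cpow_bound1 a ltr01))) => z [z2 z3].
rewrite distrC -[cpow z a - 1](subrK (a * (z - 1))).
apply: le_lt_trans (ler_normD _ _) _; rewrite normrM.
by apply: le_lt_trans (lerD z3 (lexx _)) _; rewrite -mulrDl mulrC -ltr_pdivlMr.
Qed.

Lemma cpow_continuous (a z : C) : 0 < Re z -> {for z, continuous (fun w => cpow w a)}.
Proof.
move=> z0; have FF := nbhs_filter z.
have zn0 : z != 0 by apply: contraTneq z0 => ->; rewrite ltxx.
have q1 : w / z @[w --> z] --> (1 : C).
  rewrite -(divff zn0); apply: (@cvgM C _ _ FF); [exact: cvg_id|exact: cvg_cst].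
have p1 : 0 < Re (1 : C) by rewrite /= ltr01.
have h1 : \forall w \near z, 0 < Re (w / z) := q1 _ (near_Re_gt0 p1).
have c1 : cpow z a * cpow (w / z) a @[w --> z] --> cpow z a.
  rewrite -[X in _ --> X]mulr1; apply: (@cvgM C _ _ FF); first exact: cvg_cst.
  exact: (cvg_comp _ _ q1 (@cpow_continuous1 a)).
apply: cvg_trans c1; apply: near_eq_cvg.
apply: (near_mono _ (near_and h1 (near_Re_gt0 z0))) => w [k1 k2].
by rewrite -cpowM// [z * _]mulrC divfK.
Qed.
End CpowContinuity.

(** Exponents are plain functions with values in nat; [decr] truncates at 0 and is applied to
    positive exponents only. *)
Definition incr (I : eqType) (e : I -> nat) (i j : I) : nat := ((j == i) + e j)%N.
Definition decr (I : eqType) (e : I -> nat) (i j : I) : nat := (e j - (j == i))%N.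

Lemma decrK (I : eqType) (e : I -> nat) i : (0 < e i)%N -> incr (decr e i) i = e.
Proof.
move=> ei; apply/funext => j; rewrite /incr /decr.
by have [->|_] := eqVneq j i; rewrite /= ?subn0// subnKC.
Qed.

Lemma prod_incr (K : comNzRingType) (I : finType) (f : I -> K) (e : I -> nat) i :
  \prod_j f j ^+ incr e i j = f i * \prod_j f j ^+ e j.
Proof.
rewrite (bigD1 i)//= [in RHS](bigD1 i)//= mulrA -exprS /incr eqxx add1n.
by congr (_ * _); apply: eq_bigr => j /negbTE ->.
Qed.

Lemma corner_bary_simplex (R : realType) N (t : 'rV[R]_N) : corner 1 t -> std_simplex (bary t).
Proof.
rewrite baryE => -[t0 t1]; split; last by rewrite sum_vcons subrK.
move=> i; have [j ->|->] := unliftP ord0 i; first by rewrite vconsS.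
by rewrite vcons0 subr_ge0.
Qed.

(** * The integrand along one loaded simplex *)

Section LoadedSimplex.
Variables (R : realType) (m N : nat).
Local Notation C := R[i].
Local Notation Re := (@complex.Re R).
Local Notation n := N.+1.
Variables (A : 'M[C]_(n, m)) (s : 'rV[C]_m) (nu : 'rV[C]_n) (c : 'rV[C]_m).
Variable S : loaded_simplex R n.
Hypothesis loadedS : is_loaded_simplex A s nu c S.
Implicit Types (e : 'I_m -> nat) (k : 'I_n -> nat) (z : 'rV[C]_m) (t : 'rV[R]_n).

Definition chart t := ls_map S (bary t).
Definition affine i z t : C := ell A i (chart t) - z 0 i.

Lemma chart_smooth : exists2 U, open U /\ corner 1 `<=` U &
  forall j, complex_smooth_on U (fun t => chart t 0 j).
Proof.
have [[U [oU sU] dU] _ _] := loadedS; exists (@bary R n @^-1` U).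
  split; first by apply: open_comp oU => t _; exact: bary_continuous.
  by move=> t ct; exact/sU/corner_bary_simplex.
by move=> j; have [d1 d2] := dU j; split; [exact: (smooth_on_bary oU d1)|exact: (smooth_on_bary oU d2)].
Qed.

Lemma chart_complement t : corner 1 t -> complement A c (chart t).
Proof. by have [_ cS _] := loadedS; move=> ct; exact/cS/corner_bary_simplex. Qed.

Lemma chart_neq0 t j : corner 1 t -> chart t 0 j != 0.
Proof. by move=> /chart_complement[]. Qed.

Lemma affine_neq0 t i : corner 1 t -> affine i c t != 0.
Proof. by move=> /chart_complement[_ h]; rewrite subr_eq0. Qed.

Lemma chart_coord_continuous j : corner_continuous (fun t => chart t 0 j).
Proof. by have [U [_ cU] dU] := chart_smooth; exact: corner_continuous_smooth cU (dU j). Qed.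

Lemma affine_continuous i z : corner_continuous (affine i z).
Proof.
apply: corner_continuousB; last exact: corner_continuous_cst.
apply: corner_continuous_sum => j _; apply: corner_continuousM; first exact: corner_continuous_cst.
exact: chart_coord_continuous.
Qed.

Lemma chart_continuous t : corner 1 t -> {for t, continuous chart}.
Proof.
move=> ct; have [U [_ cU] dU] := chart_smooth.
apply: (@cvg_rV _ _ _ (nbhs_filter t)) => j.
exact: (complex_smooth_on_continuous (dU j) (cU _ ct)).
Qed.

Lemma section_local t : corner 1 t -> exists2 F, flat_near A s nu c (chart t) F &
  \forall u \near t, corner 1 u -> ls_sec S (bary u) = F (chart u).
Proof.
have [_ _ fS] := loadedS; move=> ct.
have [F F1 F2] := fS _ (corner_bary_simplex ct); exists F => //.
have h : \forall u \near t, std_simplex (bary u) ->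
    ls_sec S (bary u) = F (ls_map S (bary u)) := bary_continuous F2.
by apply: (near_mono _ h) => u hu /corner_bary_simplex.
Qed.

(** Near a point of the simplex the section is a flat function composed with the map, but only at
    points of the simplex; hence continuity relative to the corner. *)
Lemma section_continuous : corner_continuous (fun t => ls_sec S (bary t)).
Proof.
split=> t ct; have [F F1 F2] := section_local ct.
have FF : Filter (within (corner 1) (nbhs t)) by exact: within_filter.
have [/differentiable_continuous cF _] := nbhs_singleton F1.
rewrite (nbhs_singleton F2 ct).
have cFX : F (chart u) @[u --> t] --> F (chart t).
  exact: (cvg_comp _ _ (chart_continuous ct) cF).
have cFX' : F (chart u) @[u --> within (corner 1) (nbhs t)] --> F (chart t).
  exact: cvg_within_filter cFX.
apply: cvg_trans cFX'; apply: near_eq_cvg.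
by rewrite near_withinE; apply: (near_mono _ F2) => u /= hu cu; rewrite hu.
Qed.

Lemma jacobian_chart a l t : corner 1 t ->
  is_cderive t (delta_mx 0 l) (fun u => chart u 0 a) (jacobian_matrix chart t a l).
Proof.
move=> ct; have [U [_ cU] dU] := chart_smooth; rewrite mxE.
exact: (is_cderive_smooth l (dU a) (cU _ ct)).
Qed.

(** Around an interior point all points are in the simplex, so the section may be replaced by the
    flat function, whose partial derivatives are omega times itself. *)
Lemma is_logder_section l t : corner_int 1 t ->
  is_logder t (delta_mx 0 l) (fun u => ls_sec S (bary u))
    (\sum_j omega A s nu c j (chart t) * jacobian_matrix chart t j l).
Proof.
move=> it; have ct := corner_int_sub it; have [F F1 F2] := section_local ct.
have [dF oF] := nbhs_singleton F1.
have h := @is_cderive_chain R _ n F chart (\row_j jacobian_matrix chart t j l) t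
  (delta_mx 0 l) dF.
have {}h : is_cderive t (delta_mx 0 l) (fun u => F (chart u))
    (\sum_j cpartial j F (chart t) * (\row_j jacobian_matrix chart t j l) 0 j).
  by apply: h => j; rewrite mxE; exact: jacobian_chart.
apply: (is_cderive_near (f := fun u => F (chart u))).
  by apply: (near_mono _ (near_and F2 (near_corner_int it))) => u [h1 /corner_int_sub h2]; rewrite h1.
apply: is_cderive_eq h _; rewrite (nbhs_singleton F2 ct) mulr_sumr.
by apply: eq_bigr => j _; rewrite mxE oF [RHS]mulrA [_ * omega _ _ _ _ _ _]mulrC.
Qed.

Lemma is_logder_affine i z l t : corner_int 1 t -> affine i z t != 0 ->
  is_logder t (delta_mx 0 l) (affine i z)
    (\sum_j A j i * jacobian_matrix chart t j l / affine i z t).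
Proof.
move=> it a0; rewrite -mulr_suml; apply: is_logder_cderive => //.
rewrite -[X in is_cderive _ _ _ X]addr0 /affine; apply: is_cderiveD; last exact: is_cderive_cst.
apply: is_cderive_sum => j _; apply: is_cderiveZ; apply: jacobian_chart.
exact: corner_int_sub.
Qed.

(** Keeps every ratio, along the whole closed simplex, in the half-plane where [cpow] is continuous
    and equal to 1 at 1. *)
Definition admissible z := forall i t, corner 1 t -> 0 < Re (affine i z t / affine i c t).

Definition power_factor z t : C := \prod_i cpow (affine i z t / affine i c t) (s 0 i).

(** The integrand of Phi(e, k) in corner coordinates, without the Jacobian determinant. *)
Definition weight e k z t : C :=
  ls_sec S (bary t) * power_factor z t *
  (\prod_i (affine i z t)^-1 ^+ e i * \prod_j (chart t 0 j)^-1 ^+ k j).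

Lemma admissible_neq0 z i t : admissible z -> corner 1 t -> affine i z t != 0.
Proof.
move=> ac ct; have := ac i t ct; apply: contraTneq => ->.
by rewrite mul0r ltxx.
Qed.

Lemma weight_continuous e k z : admissible z -> corner_continuous (weight e k z).
Proof.
move=> ac; apply: corner_continuousM; last first.
  apply: corner_continuousM; apply: corner_continuous_prod => i _.
    apply: corner_continuousX; apply: corner_continuousV; first exact: affine_continuous.
    by move=> t ct; exact: admissible_neq0.
  apply: corner_continuousX; apply: corner_continuousV; first exact: chart_coord_continuous.
  by move=> t ct; exact: chart_neq0.
apply: corner_continuousM; first exact: section_continuous.
apply: corner_continuous_prod => i _.
apply: (@corner_continuous_comp R n C C (fun t => affine i z t / affine i c t)
  (fun w => cpow w (s 0 i))).
  apply: corner_continuousM; first exact: affine_continuous.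
  apply: corner_continuousV; first exact: affine_continuous.
  by move=> t ct; exact: affine_neq0.
by move=> t ct; apply: cpow_continuous; exact: ac.
Qed.

Lemma affine_weight i e k z t : admissible z -> corner 1 t -> (0 < e i)%N ->
  affine i z t * weight e k z t = weight (decr e i) k z t.
Proof.
move=> ac ct ei; rewrite /weight -[in LHS](decrK ei) prod_incr.
by field; exact: admissible_neq0.
Qed.

Lemma chart_weight j e k z t : corner 1 t -> (0 < k j)%N ->
  chart t 0 j * weight e k z t = weight e (decr k j) z t.
Proof.
move=> ct kj; rewrite /weight -[in LHS](decrK kj) prod_incr.
by field; exact: chart_neq0.
Qed.

Lemma weight_incr_affine i e k z t :
  weight (incr e i) k z t = weight e k z t / affine i z t.
Proof. by rewrite /weight prod_incr; ring. Qed.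

Lemma weight_incr_chart j e k z t :
  weight e (incr k j) z t = weight e k z t / chart t 0 j.
Proof. by rewrite /weight prod_incr; ring. Qed.

Lemma affine_shift i z (v : 'rV[C]_m) t : admissible z -> corner 1 t ->
  affine i (z + v) t = affine i z t * (1 - v 0 i / affine i z t).
Proof.
move=> ac ct; rewrite mulrBr mulr1 [_ * (_ / _)]mulrC divfK; last exact: admissible_neq0.
by rewrite /affine mxE opprD addrA.
Qed.

(** A displacement v multiplies the weight by powers of 1 - v_i / affine_i, in which the exponents
    s_i of the branch and - e_i of the denominators merge. The last hypothesis places these bases
    where [cpow] is multiplicative. *)
Lemma weight_shift e k z v t : admissible z -> admissible (z + v) -> corner 1 t ->
  (forall i, 0 < Re (1 - v 0 i / affine i z t)) ->
  weight e k (z + v) t =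
  weight e k z t * \prod_i cpow (1 - v 0 i / affine i z t) (s 0 i - (e i)%:R).
Proof.
move=> ac acv ct v0.
have -> : \prod_i cpow (1 - v 0 i / affine i z t) (s 0 i - (e i)%:R) =
    \prod_i cpow (1 - v 0 i / affine i z t) (s 0 i) *
    \prod_i (1 - v 0 i / affine i z t)^-1 ^+ e i.
  by rewrite -big_split; apply: eq_bigr => i _; rewrite cpowD cpowN_nat.
have E1 : power_factor (z + v) t = power_factor z t *
    \prod_i cpow (1 - v 0 i / affine i z t) (s 0 i).
  rewrite /power_factor -big_split; apply: eq_bigr => i _ /=.
  have E : affine i (z + v) t / affine i c t =
      affine i z t / affine i c t * (1 - v 0 i / affine i z t).
    by rewrite (affine_shift _ _ ac ct) mulrAC.
  by rewrite E cpowM//; [exact: ac|rewrite -E; exact: acv].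
have E2 : \prod_i (affine i (z + v) t)^-1 ^+ e i = \prod_i (affine i z t)^-1 ^+ e i *
    \prod_i (1 - v 0 i / affine i z t)^-1 ^+ e i.
  rewrite -big_split; apply: eq_bigr => i _ /=.
  by rewrite (affine_shift _ _ ac ct) invfM exprMn.
by rewrite /weight E1 E2; ring.
Qed.

(** The section contributes omega at c, and the powers of ratios contribute the difference of the
    terms at z and at c. What comes from c cancels, and the factors x_j lower nu_j by k_j. *)
Lemma is_logder_weight k z l t : admissible z -> corner_int 1 t ->
  is_logder t (delta_mx 0 l) (weight (fun=> 0%N) k z)
    (\sum_j ((nu 0 j - (k j)%:R) / chart t 0 j + \sum_i s 0 i * A j i / affine i z t)
       * jacobian_matrix chart t j l).
Proof.
move=> ac it; have ct := corner_int_sub it.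
pose J j := jacobian_matrix chart t j l.
have E : weight (fun=> 0%N) k z = (fun u => ls_sec S (bary u) * power_factor z u *
    \prod_j (chart u 0 j)^-1 ^+ k j).
  by apply/funext => u; rewrite /weight (eq_bigr (fun=> 1)) ?big1_eq ?mul1r.
rewrite E; have h1 := is_logder_section l it.
have h2 : is_logder t (delta_mx 0 l) (power_factor z) (\sum_i s 0 i *
    (\sum_j A j i * J j / affine i z t - \sum_j A j i * J j / affine i c t)).
  apply: is_logder_prod => i; apply: is_logder_cpow; first exact: ac.
  apply: is_logderM; first by apply: is_logder_affine => //; exact: admissible_neq0.
  apply: is_logderV; first exact: affine_neq0.
  by apply: is_logder_affine => //; exact: affine_neq0.
have h3 : is_logder t (delta_mx 0 l) (fun u => \prod_j (chart u 0 j)^-1 ^+ k j)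
    (\sum_j - (J j / chart t 0 j) *+ k j).
  apply: is_logder_prod => j; apply: is_logderX; apply: is_logderV; first exact: chart_neq0.
  apply: is_logder_cderive; first exact: chart_neq0.
  exact: jacobian_chart.
have := is_logderM (is_logderM h1 h2) h3; congr is_logder.
under [X in _ + X + _]eq_bigr do rewrite -sumrB mulr_sumr.
rewrite [X in _ + X + _]exchange_big -!big_split /=; apply: eq_bigr => j _.
pose Sz := \sum_i s 0 i * A j i / affine i z t; pose Sc := \sum_i s 0 i * A j i / affine i c t.
have -> : \sum_i s 0 i * (A j i * J j / affine i z t - A j i * J j / affine i c t) =
    (Sz - Sc) * J j.
  by rewrite -sumrB mulr_suml; apply: eq_bigr => i _; ring.
by rewrite /omega -/(J j) -/Sz -/Sc -[_ *+ k j]mulr_natr; ring.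
Qed.

End LoadedSimplex.

(** * Functions with a given gradient *)

Section Holomorphy.
Variables (R : realType) (m : nat).
Local Notation C := R[i].
Implicit Types (f g : 'rV[C]_m -> C) (x : 'rV[C]_m) (d : 'I_m -> C).

Definition has_gradient x f d := differentiable f x /\ forall i, cpartial i f x = d i.

Lemma has_gradient_eq x f d1 d2 : has_gradient x f d1 -> (forall i, d1 i = d2 i) ->
  has_gradient x f d2.
Proof. by move=> [df fd] dd; split => // i; rewrite fd. Qed.

Lemma has_gradient_ext x f g d1 d2 : has_gradient x f d1 -> (forall y, g y = f y) ->
  (forall i, d2 i = d1 i) -> has_gradient x g d2.
Proof. by move=> fd /funext -> dd; split => [|i]; [case: fd|rewrite dd; case: fd]. Qed.

Lemma has_gradientP x f d : has_gradient x f d <->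
  (forall e : C, 0 < e -> \forall y \near x,
    `|f y - f x - \sum_i (y - x) 0 i * d i| <= e * `|y - x|).
Proof.
split=> [[df fd] e e0|]; last exact: bound_row_form.
apply: (near_mono _ (differentiable_bound df e0)) => y.
have -> // : 'd f x (y - x) = \sum_i (y - x) 0 i * d i.
rewrite {1}(row_sum_delta (y - x)) linear_sum; apply: eq_bigr => i _.
by rewrite linearZ -fd /cpartial deriveE.
Qed.

Lemma has_gradient_cst x (k : C) : has_gradient x (fun=> k) (fun=> 0).
Proof.
apply/has_gradientP => e e0; apply: (@filterE _ _ (nbhs_filter x)) => y.
rewrite subrr sub0r normrN big1; last by move=> i _; rewrite mulr0.
by rewrite normr0 mulr_ge0 ?normr_ge0 ?(ltW e0).
Qed.

Lemma has_gradientD x f g d1 d2 : has_gradient x f d1 -> has_gradient x g d2 ->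
  has_gradient x (fun y => f y + g y) (fun i => d1 i + d2 i).
Proof.
move=> /has_gradientP h1 /has_gradientP h2; apply/has_gradientP => e e0.
have e2 : 0 < e / 2 by rewrite divr_gt0.
apply: (near_mono _ (near_and (h1 _ e2) (h2 _ e2))) => y [k1 k2].
have -> : f y + g y - (f x + g x) - \sum_i (y - x) 0 i * (d1 i + d2 i) =
    (f y - f x - \sum_i (y - x) 0 i * d1 i) + (g y - g x - \sum_i (y - x) 0 i * d2 i).
  by under eq_bigr do rewrite mulrDr; rewrite big_split /=; ring.
apply: le_trans (ler_normD _ _) _; apply: le_trans (lerD k1 k2) _.
by rewrite -mulrDl -splitr.
Qed.

Lemma has_gradient_sum x (I : Type) (r : seq I) (f : I -> 'rV[C]_m -> C) (d : I -> 'I_m -> C) :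
  (forall a, has_gradient x (f a) (d a)) ->
  has_gradient x (fun y => \sum_(a <- r) f a y) (fun i => \sum_(a <- r) d a i).
Proof.
move=> fd; elim: r => [|a r IH].
  have := has_gradient_cst x 0; congr has_gradient; apply/funext => y; by rewrite big_nil.
have := has_gradientD (fd a) IH.
by congr has_gradient; apply/funext => y; rewrite big_cons.
Qed.

End Holomorphy.

(** * Periods over one simplex and differentiation under the integral *)

Section Moments.
Variables (R : realType) (m N : nat).
Local Notation C := R[i].
Local Notation Re := (@complex.Re R).
Local Notation n := N.+1.
Variables (A : 'M[C]_(n, m)) (s : 'rV[C]_m) (nu : 'rV[C]_n) (c : 'rV[C]_m).
Variable S : loaded_simplex R n.
Hypothesis loadedS : is_loaded_simplex A s nu c S.
Implicit Types (e : 'I_m -> nat) (k : 'I_n -> nat) (z : 'rV[C]_m) (t : 'rV[R]_n).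
Local Notation aff := (affine A S).
Local Notation adm := (admissible A c S).
Local Notation wt := (weight A s c S).
Local Notation jac t := (\det (jacobian_matrix (chart S) t)).

Definition moment e k z := simplex_integral (fun t => wt e k z t * jac t).

Lemma jacobian_continuous : corner_continuous (fun t => jac t).
Proof.
apply: corner_continuous_det => a b; have [U [oU cU] dU] := chart_smooth loadedS.
exact: (corner_continuous_jacobian cU dU a b).
Qed.

Lemma integrand_continuous e k z : adm z -> corner_continuous (fun t => wt e k z t * jac t).
Proof.
by move=> az; exact: corner_continuousM (weight_continuous loadedS e k az) jacobian_continuous.
Qed.

Lemma Re_sub1_gt0 (w : C) : `|w| < 1 -> 0 < Re (1 - w).
Proof.
move=> w1; rewrite raddfB /= subr_gt0; apply: le_lt_trans (ler_norm _) _.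
have := le_lt_trans (ReIm_norm w).1 w1.
by rewrite -[1 : C]/(1%:C) ltcR.
Qed.

(** The ratio is 1 - (z - c)_i / affine_i. Since 1 / affine_i is bounded by M on the compact corner,
    |z - c| < 1 / M keeps the ratio at distance less than 1 from 1. *)
Lemma near_admissible : \forall z \near c, adm z.
Proof.
suff h i : \forall z \near c, forall t, corner 1 t -> 0 < Re (aff i z t / aff i c t).
  by apply: (near_mono _ (filter_forall (nbhs_filter c) h)) => z hz i t; exact: hz.
have [M M0 hM] : exists2 M : R, 0 < M & forall t, corner 1 t -> `|(aff i c t)^-1| <= M%:C.
  apply: corner_continuous_bounded; apply: corner_continuousV; first exact: (affine_continuous loadedS).
  by move=> t ct; exact: (affine_neq0 loadedS).
have MC : 0 < M%:C :> C by rewrite ltcR.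
have MV : 0 < M%:C^-1 :> C by rewrite invr_gt0.
have h : \forall z \near c, `|c - z| < M%:C^-1.
  by have := nbhsx_ballx c _ MV; apply: near_mono => z; rewrite -ball_normE.
apply: (near_mono _ h) => z hz t ct; have a0 := affine_neq0 loadedS i ct.
have -> : aff i z t / aff i c t = 1 - (z - c) 0 i / aff i c t.
  by rewrite !mxE; move: a0; rewrite /affine => a0; field.
apply: Re_sub1_gt0; rewrite normrM; apply: le_lt_trans (_ : `|z - c| * M%:C < _).
  by apply: ler_pM => //; [exact: ler_coord_norm|exact: hM].
by rewrite -ltr_pdivlMr// div1r distrC.
Qed.

(** By [weight_shift] the increment of the integrand is the integrand times the increment of one
    fixed function at w = v / affine, and |w| <= K |v| on the whole simplex; the expansion of that
    function is therefore uniform and can be integrated. *)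
Lemma moment_gradient e k z : (\forall y \near z, adm y) ->
  has_gradient z (moment e k) (fun i => - (s 0 i - (e i)%:R) * moment (incr e i) k z).
Proof.
move=> nz; have az := nbhs_singleton nz; pose l i := - (s 0 i - (e i)%:R).
have [M M0 hM] := corner_continuous_bounded (integrand_continuous e k az).
have [K K0 hK] : exists2 K : R, 0 < K &
    forall i t, corner 1 t -> `|(aff i z t)^-1| <= K%:C.
  have /choice[B hB] : forall i, exists B : R, 0 < B /\
      forall t, corner 1 t -> `|(aff i z t)^-1| <= B%:C.
    move=> i; have [B B0 hB] : exists2 B : R, 0 < B &
        forall t, corner 1 t -> `|(aff i z t)^-1| <= B%:C.
      apply: corner_continuous_bounded; apply: corner_continuousV; first exact: (affine_continuous loadedS).
      by move=> t ct; exact: (admissible_neq0 _ az).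
    by exists B.
  (* The sum dominates each [B i]; the 1 gives positivity for an empty sum as well. *)
  exists (1 + \sum_i B i).
    by rewrite ltr_pwDl// sumr_ge0// => i _; rewrite ltW//; case: (hB i).
  move=> i t ct; apply: le_trans ((hB i).2 _ ct) _; rewrite lecR (bigD1 i)//= addrCA.
  rewrite lerDl addr_ge0// sumr_ge0// => j _; rewrite ltW//; exact: (hB j).1.
have KC : 0 < K%:C :> C by rewrite ltcR.
have MC : 0 < M%:C :> C by rewrite ltcR.
apply/has_gradientP => eps eps0.
(* M bounds the integrand, K converts |w| into |v|, and the 2 absorbs the doubled constant of
   [ler_norm_simplex_integral]. *)
pose e' := eps / 2 / (M%:C * K%:C).
have e'0 : 0 < e' by rewrite !divr_gt0// mulr_gt0.
(* The second condition, |w| <= 1/2, keeps each 1 - w_i in the right half-plane. *)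
have := near_and (@expands1_prod_cpow R m (fun i => s 0 i - (e i)%:R) e' e'0)
  (near0_norm m (divr_gt0 ltr01 (ltr0Sn C 1))).
move=> /nbhs_ballP[rho /= rho0 hrho].
have rK : 0 < rho / K%:C by rewrite divr_gt0.
have nb : \forall y \near z, `|y - z| < rho / K%:C.
  by have := nbhsx_ballx z _ rK; apply: near_mono => y; rewrite -ball_normE /= distrC.
apply: (near_mono _ (near_and nz nb)) => y [ay yz].
pose v := y - z; pose w t : 'rV[C]_m := \row_i (v 0 i / aff i z t).
have wv t : corner 1 t -> `|w t| <= K%:C * `|v|.
  move=> ct; apply: row_norm_le; first by rewrite mulr_ge0// ltW.
  move=> j; rewrite mxE normrM mulrC; apply: ler_pM => //; first exact: hK.
  exact: ler_coord_norm.
have [hw1 hw2] : (forall t, corner 1 t ->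
      `|\prod_i cpow (1 - w t 0 i) (s 0 i - (e i)%:R) - 1 - \sum_i w t 0 i * l i|
        <= e' * `|w t|) /\
    (forall t, corner 1 t -> `|w t| <= 1 / 2).
  have hw t : corner 1 t -> ball (0 : 'rV[C]_m) rho (w t).
    move=> ct; rewrite -ball_normE /= sub0r normrN; apply: le_lt_trans (wv _ ct) _.
    by rewrite mulrC -ltr_pdivlMr.
  by split=> t ct; have [h1 h2] := hrho _ (hw t ct).
have yE : y = z + v by rewrite /v addrC subrK.
have shift t : corner 1 t -> wt e k y t =
    wt e k z t * \prod_i cpow (1 - w t 0 i) (s 0 i - (e i)%:R).
  move=> ct; have ayv : adm (z + v) by rewrite -yE.
  rewrite {1}yE (weight_shift s e k az ayv ct).
    by under [in RHS]eq_bigr do rewrite mxE.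
  move=> i; apply: Re_sub1_gt0; have := ler_coord_norm (w t) i; rewrite mxE => /le_lt_trans; apply.
  apply: le_lt_trans (hw2 t ct) _; rewrite ltr_pdivrMr//; by rewrite mul1r ltr1n.
pose dif t := wt e k y t * jac t - wt e k z t * jac t -
  \sum_i v 0 i * l i * (wt (incr e i) k z t * jac t).
have cs i : corner_continuous (fun t => v 0 i * l i * (wt (incr e i) k z t * jac t)).
  by apply: corner_continuousM; [exact: corner_continuous_cst|exact: integrand_continuous].
have cy := integrand_continuous e k ay; have cz := integrand_continuous e k az.
have csum : corner_continuous (fun t => \sum_i v 0 i * l i * (wt (incr e i) k z t * jac t)).
  by apply: corner_continuous_sum => i _; exact: cs.
have cyz : corner_continuous (fun t => wt e k y t * jac t - wt e k z t * jac t).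
  exact: corner_continuousB.
have E : moment e k y - moment e k z - \sum_i v 0 i * (l i * moment (incr e i) k z) =
    simplex_integral dif.
  rewrite /dif (simplex_integralB cyz csum) (simplex_integralB cy cz).
  congr (_ - _); rewrite simplex_integral_sum; last by move=> i _; exact: cs.
  apply: eq_bigr => i _; rewrite mulrA simplex_integralZ//.
  exact: integrand_continuous.
rewrite -/v E; have [r r0 rE] := norm_realC v; have [q q0 qE] := gt0_realC eps0.
have -> : eps * `|v| = (q * r / 2 + q * r / 2)%:C by rewrite -splitr qE rE rmorphM.
apply: ler_norm_simplex_integral; first exact: corner_continuousB.
move=> t ct; have -> : dif t = (wt e k z t * jac t) *
    (\prod_i cpow (1 - w t 0 i) (s 0 i - (e i)%:R) - 1 - \sum_i w t 0 i * l i).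
  have -> : dif t = wt e k y t * jac t - wt e k z t * jac t -
      wt e k z t * jac t * \sum_i w t 0 i * l i.
    rewrite /dif mulr_sumr; apply: (congr1 (fun x => _ - x)); apply: eq_bigr => i _.
    have -> : w t 0 i = v 0 i / aff i z t by rewrite mxE.
    rewrite weight_incr_affine; move: (v 0 i) (l i) (jac t) (aff i z t)^-1 (wt e k z t) => a b d f g.
    by ring.
  by rewrite (shift t ct); ring.
rewrite normrM; apply: le_trans (_ : M%:C * (e' * (K%:C * `|v|)) <= _).
  apply: ler_pM => //; first exact: hM.
  by apply: le_trans (hw1 t ct) _; rewrite ler_wpM2l ?(ltW e'0)//; exact: wv.
rewrite rE /e' qE rmorphM/= rmorphM/= fmorphV/=.
rewrite le_eqVlt; apply/orP; left; apply/eqP.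
by rewrite rmorph_nat; field; rewrite !gt_eqF.
Qed.

(** Apart from Stokes' theorem, the relations between periods come in this way from pointwise
    relations between weights. *)
Lemma moment_linear (I : Type) (r : seq I) (q : I -> C) (e : I -> 'I_m -> nat)
    (k : I -> 'I_n -> nat) z : adm z ->
  (forall t, corner 1 t -> \sum_(a <- r) q a * wt (e a) (k a) z t = 0) ->
  \sum_(a <- r) q a * moment (e a) (k a) z = 0.
Proof.
move=> az h; apply: etrans (_ : simplex_integral (fun=> 0 : C) = 0); last exact: simplex_integral0.
transitivity (simplex_integral (fun t => \sum_(a <- r) q a * (wt (e a) (k a) z t * jac t))).
  rewrite simplex_integral_sum; last first.
    by move=> a _; apply: corner_continuousM; [exact: corner_continuous_cst|exact: integrand_continuous].
  apply: eq_bigr => a _; rewrite simplex_integralZ//.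
  exact: integrand_continuous.
apply: eq_simplex_integral_corner => t ct.
by under eq_bigr do rewrite mulrA; rewrite -mulr_suml h// mul0r.
Qed.

(** The exponents k_j = 1 account for the denominators x_j of [dlog_form]. *)
Lemma moment_phi z : moment (fun=> 0%N) (fun=> 1%N) z =
  simplex_integral (fun t => branch A s c S z (bary t) * dlog_form S t).
Proof.
apply: eq_simplex_integral_corner => t ct; rewrite /weight /branch /dlog_form -/(power_factor _ _ _ _ _ _).
rewrite (eq_bigr (fun=> 1)) ?big1_eq ?mul1r// prodfV mulrA mulrAC.
by rewrite /jacobian_matrix.
Qed.

End Moments.

(** * Faces and the cancellation of boundary terms *)

(** On each class the [val] add up to 0 and [h] is constant. To sum over classes without choosing
    representatives, the term of p is spread evenly over all q equivalent to p, whence the class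
    size [w], and the summations are exchanged. *)
Lemma sum_class_cancel (K : numFieldType) (P : finType) (e : rel P) (val h : P -> K) :
  reflexive e -> symmetric e -> transitive e ->
  (forall p, \sum_q (if e q p then val q else 0) = 0) ->
  (forall p q, e p q -> h p = h q) -> \sum_p val p * h p = 0.
Proof.
move=> er es et e0 eh; pose w p : K := #|[pred q | e q p]|%:R.
have w0 p : w p != 0.
  by rewrite pnatr_eq0 -lt0n; apply/card_gt0P; exists p; rewrite inE er.
have ew p q : e p q -> w p = w q.
  move=> pq; congr (_%:R); apply: eq_card => x; rewrite !inE.
  by apply/idP/idP => xp; apply: et xp _; rewrite // es.
transitivity (\sum_p \sum_q if e q p then val p * (h p / w p) else 0).
  apply: eq_bigr => p _; rewrite -big_mkcond sumr_const -[_ *+ _]mulr_natr -mulrA.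
  by rewrite divfK.
rewrite exchange_big /=; apply: big1 => q _.
transitivity (\sum_p (if e p q then val p else 0) * (h q / w q)).
  apply: eq_bigr => p _; rewrite es; case: ifP => [pq|_]; last by rewrite mul0r.
  by rewrite (eh _ _ pq) (ew _ _ pq).
by rewrite -mulr_suml e0 mul0r.
Qed.

Section FaceMaps.
Variables (R : realType) (N : nat).
Local Notation C := R[i].

Lemma corner_continuous_ext (T : topologicalType) (f g : 'rV[R]_N -> T) :
  (forall t, corner 1 t -> f t = g t) -> corner_continuous f -> corner_continuous g.
Proof.
move=> fg cf; split=> t ct; rewrite -(fg t ct).
have FF : Filter (within (corner 1) (nbhs t)) by exact: within_filter.
apply: cvg_trans (corner_cvg cf ct); apply: near_eq_cvg.
by rewrite near_withinE; apply: (@filterE _ _ (nbhs_filter t)) => u /fg.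
Qed.

Lemma sum_vins (k : 'I_N.+1) (x : R) (y : 'rV[R]_N) : \sum_j vins k x y 0 j = x + \sum_j y 0 j.
Proof.
rewrite (bigD1_ord k)//= vinsE; congr (_ + _).
by apply: eq_bigr => j _; rewrite vinsS.
Qed.

(** In corner coordinates the slanted face is face 0; the next lemma identifies t_k = 0 with face k
    + 1. *)
Lemma bary_bary (y : 'rV[R]_N) : bary (bary y) = face ord0 (bary y).
Proof.
rewrite -[face _ _]/(vins ord0 0 (bary y)) vins0 baryE; congr vcons.
by rewrite baryE sum_vcons subrK subrr.
Qed.

Lemma bary_vins k (y : 'rV[R]_N) : bary (vins k 0 y) = face (lift ord0 k) (bary y).
Proof.
rewrite -[face _ _]/(vins (lift ord0 k) 0 (bary y)) !baryE vins_cons; congr vcons.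
by rewrite sum_vins add0r.
Qed.

Lemma rpartial_near M k (f g : 'rV[R]_M -> C) (t : 'rV[R]_M) : (\forall u \near t, f u = g u) ->
  rpartial k f t = rpartial k g t.
Proof.
move=> fg; congr (_ +i* _); apply: near_eq_derive; first by apply: (near_mono _ fg) => u ->.
by apply: (near_mono _ fg) => u ->.
Qed.

End FaceMaps.

Section StokesFaces.
Variables (R : realType) (N : nat).
Local Notation C := R[i].
Variables (U : set 'rV[R]_N.+1) (X : 'rV[R]_N.+2 -> 'rV[C]_N.+1).
Hypothesis oU : open U.
Hypothesis cornerU : corner 1 `<=` U.
Hypothesis smoothX : forall a, complex_smooth_on U (fun t => X (bary t) 0 a).

(** Up to sign the minor is a cofactor of the Jacobian matrix at the point of the face, or a sum of
    cofactors for face 0, and cofactors are continuous on the closed corner. *)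
Lemma minor_face_continuous j p :
  corner_continuous (minor j (fun v : 'rV[R]_N => X (face p (bary v)))).
Proof.
have cof k := corner_continuous_cofactor cornerU smoothX j k.
have sgn2 i : (-1) ^+ i * (-1) ^+ i = 1 :> C by rewrite -exprD addnn -signr_odd odd_double.
have [k ->|->] := unliftP ord0 p.
  have -> : (fun v : 'rV[R]_N => X (face (lift ord0 k) (bary v))) = (fun v => X (bary (vins k 0 v))).
    by apply/funext => v; rewrite bary_vins.
  apply: (corner_continuous_ext (f := fun y => (-1) ^+ (j + k) *
    cofactor (jacobian_matrix (fun t => X (bary t)) (vins k 0 y)) j k)).
    by move=> y cy; rewrite (minor_vins cornerU smoothX j k cy) mulrA sgn2 mul1r.
  apply: corner_continuousM; first exact: corner_continuous_cst.
  exact: (corner_continuous_reparam (cof k) (@vins_continuous R N k 0) (@corner_vins R N k)).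
have -> : (fun v : 'rV[R]_N => X (face ord0 (bary v))) = (fun v => X (bary (bary v))).
  by apply/funext => v; rewrite bary_bary.
apply: (corner_continuous_ext (f := fun y => (-1) ^+ j *
  \sum_k cofactor (jacobian_matrix (fun t => X (bary t)) (bary y)) j k)).
  by move=> y cy; rewrite (minor_bary cornerU smoothX j cy) mulrA sgn2 mul1r.
apply: corner_continuousM; first exact: corner_continuous_cst.
apply: corner_continuous_sum => k _.
exact: (corner_continuous_reparam (cof k) (@bary_continuous R N) (@corner_bary R N)).
Qed.

(** The slanted face has sign +1 and the face t_k = 0 has sign -(-1)^k; with p = 0 and p = k + 1
    both are (-1)^p. *)
Lemma stokes_faces (u : 'rV[R]_N.+2 -> C) (g : 'I_N.+1 -> 'rV[R]_N.+1 -> C) j :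
  corner_continuous (fun t => u (bary t)) -> (forall a, corner_continuous (g a)) ->
  (forall k t, corner_int 1 t -> is_cderive t (delta_mx 0 k) (fun t => u (bary t))
    (\sum_a g a t * jacobian_matrix (fun t => X (bary t)) t a k)) ->
  simplex_integral (fun t => g j t * \det (jacobian_matrix (fun t => X (bary t)) t)) =
  (-1) ^+ j * \sum_(p < N.+2) simplex_integral (fun y : 'rV[R]_N =>
    (-1) ^+ p * u (face p (bary y)) * minor j (fun v => X (face p (bary v))) y).
Proof.
move=> cu cg du; rewrite (stokes_simplex oU cornerU smoothX cu cg du); congr (_ * _).
have cb p : corner_continuous (fun y : 'rV[R]_N => u (face p (bary y))).
  have [k ->|->] := unliftP ord0 p.
    apply: (corner_continuous_ext (f := fun y => u (bary (vins k 0 y)))).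
      by move=> y _; rewrite bary_vins.
    exact: (corner_continuous_reparam cu (@vins_continuous R N k 0) (@corner_vins R N k)).
  apply: (corner_continuous_ext (f := fun y => u (bary (bary y)))).
    by move=> y _; rewrite bary_bary.
  exact: (corner_continuous_reparam cu (@bary_continuous R N) (@corner_bary R N)).
have cm p : corner_continuous (fun y : 'rV[R]_N => u (face p (bary y)) *
    minor j (fun v => X (face p (bary v))) y).
  exact: corner_continuousM (cb p) (minor_face_continuous j p).
have E (p : 'I_N.+2) : simplex_integral (fun y : 'rV[R]_N => (-1) ^+ p * u (face p (bary y)) *
      minor j (fun v => X (face p (bary v))) y) =
    (-1) ^+ p * simplex_integral (fun y : 'rV[R]_N => u (face p (bary y)) *
      minor j (fun v => X (face p (bary v))) y).
  rewrite -simplex_integralZ; last exact: cm.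
  by apply: eq_simplex_integral_corner => y _; rewrite mulrA.
under [RHS]eq_bigr do rewrite E.
have Eb : (fun v : 'rV[R]_N => X (bary (bary v))) = (fun v => X (face ord0 (bary v))).
  by apply/funext => v; rewrite bary_bary.
have Ev k : (fun v : 'rV[R]_N => X (bary (vins k 0 v))) = (fun v => X (face (lift ord0 k) (bary v))).
  by apply/funext => v; rewrite bary_vins.
have ub : (fun v : 'rV[R]_N => u (bary (bary v))) = (fun v => u (face ord0 (bary v))).
  by apply/funext => v; rewrite bary_bary.
have uv k : (fun v : 'rV[R]_N => u (bary (vins k 0 v))) = (fun v => u (face (lift ord0 k) (bary v))).
  by apply/funext => v; rewrite bary_vins.
rewrite [RHS]big_ord_recl expr0 mul1r -Eb; congr (_ + _).
  by apply: eq_simplex_integral_corner => y _; rewrite -[u (face _ _)](congr1 (fun f => f y) ub).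
rewrite -sumrN; apply: eq_bigr => k _; rewrite -Ev -mulNr -[- _ ^+ k]mulN1r -exprS.
apply: (congr1 (fun x => _ * x)); apply: eq_simplex_integral_corner => y _.
by rewrite -[u (face _ _)](congr1 (fun f => f y) (uv k)).
Qed.

End StokesFaces.

(** * Periods over a twisted cycle *)

Section Periods.
Variables (R : realType) (m N : nat).
Local Notation C := R[i].
Local Notation n := N.+1.
Variables (A : 'M[C]_(n, m)) (s : 'rV[C]_m) (nu : 'rV[C]_n) (c : 'rV[C]_m).
Variables (M : nat) (G : 'I_M -> loaded_simplex R n).
Hypothesis cycleG : twisted_cycle A s nu c G.
Implicit Types (e : 'I_m -> nat) (k : 'I_n -> nat) (z : 'rV[C]_m).

Let loadedG q : is_loaded_simplex A s nu c (G q). Proof. by have [h _] := cycleG. Qed.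

Definition period e k z := \sum_q moment A s c (G q) e k z.
Definition all_admissible z := forall q, admissible A c (G q) z.

Lemma near_all_admissible : \forall z \near c, all_admissible z.
Proof. by apply: (filter_forall (nbhs_filter c)) => q; exact: near_admissible. Qed.

Lemma period_gradient e k z : (\forall y \near z, all_admissible y) ->
  has_gradient z (period e k) (fun i => - (s 0 i - (e i)%:R) * period (incr e i) k z).
Proof.
move=> nz; have h q : has_gradient z (moment A s c (G q) e k)
    (fun i => - (s 0 i - (e i)%:R) * moment A s c (G q) (incr e i) k z).
  by apply: moment_gradient => //; apply: (near_mono _ nz) => y; exact.
have := has_gradient_sum (index_enum 'I_M) h.
by move=> hs; apply: has_gradient_eq hs _ => i; rewrite -mulr_sumr.
Qed.

Lemma period_linear (I : Type) (r : seq I) (a : I -> C) (e : I -> 'I_m -> nat)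
    (k : I -> 'I_n -> nat) z : all_admissible z ->
  (forall q t, corner 1 t -> \sum_(b <- r) a b * weight A s c (G q) (e b) (k b) z t = 0) ->
  \sum_(b <- r) a b * period (e b) (k b) z = 0.
Proof.
move=> az h; under eq_bigr do rewrite mulr_sumr; rewrite exchange_big big1// => q _.
exact: (moment_linear (loadedG q) (az q) (h q)).
Qed.

Lemma period_phi z : period (fun=> 0%N) (fun=> 1%N) z = phi A s c G z.
Proof. by apply: eq_bigr => q _; exact: moment_phi. Qed.

(* The weight at e = 0 is the section times this function of the point. *)
Let point_factor k z (x : 'rV[C]_n) : C :=
  \prod_i cpow ((ell A i x - z 0 i) / (ell A i x - c 0 i)) (s 0 i)
  * (\prod_i (ell A i x - z 0 i)^-1 ^+ 0%N * \prod_j (x 0 j)^-1 ^+ k j).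

Let glued_weight k z q (t : 'rV[R]_n.+1) : C :=
  ls_sec (G q) t * point_factor k z (ls_map (G q) t).

Let face_minor j q p (y : 'rV[R]_N) : C :=
  minor j (fun v => ls_map (G q) (face p (bary v))) y.

Let glued_weight_bary k z q t :
  glued_weight k z q (bary t) = weight A s c (G q) (fun=> 0%N) k z t.
Proof. by rewrite /glued_weight /point_factor mulrA. Qed.

(** Faces are grouped by the map they induce on the standard simplex. In each group the signed
    sections add up to zero by the cycle condition, while the power factor and the minor depend on
    the map alone. The point is interior because the maps agree on the simplex only and derivatives
    need a neighbourhood. *)
Let boundary_cancel j k z y : corner_int 1 y ->
  \sum_(q < M) \sum_(p < N.+2)
    (-1) ^+ p * glued_weight k z q (face p (bary y)) * face_minor j q p y = 0.
Proof.
move=> iy; have sy := corner_bary_simplex (corner_int_sub iy).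
pose T (x : 'I_M * 'I_N.+2) (u : 'rV[R]_N.+1) := ls_map (G x.1) (face x.2 u).
pose e (x x' : 'I_M * 'I_N.+2) := `[< forall u, std_simplex u -> T x u = T x' u >].
pose val (x : 'I_M * 'I_N.+2) := (-1) ^+ x.2 * ls_sec (G x.1) (face x.2 (bary y)).
pose h x := point_factor k z (T x (bary y)) * minor j (fun v => T x (bary v)) y.
rewrite pair_big /=; transitivity (\sum_x val x * h x).
  by apply: eq_bigr => x _; rewrite /glued_weight /val /h !mulrA.
apply: (@sum_class_cancel _ _ e).
- by move=> x; apply/asboolP.
- by move=> x x'; apply/asboolP/asboolP => h' u su; rewrite h'.
- by move=> x1 x2 x3 /asboolP h1 /asboolP h2; apply/asboolP => u su; rewrite h1// h2.
(* With tau the face map of x itself, the indicator in [boundary_coef] is the relation [e]. *)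
- move=> x; have [_ /(_ (T x) _ sy)] := cycleG.
  by rewrite /boundary_coef pair_big.
move=> x x' /asboolP xx'; rewrite /h xx'//.
apply: (congr1 (fun d => _ * d)); congr (\det _); apply/matrixP => a l; rewrite !mxE; apply: rpartial_near.
by apply: (near_mono _ (near_corner_int iy)) => u /corner_int_sub/corner_bary_simplex/xx' ->.
Qed.

(** Stokes' theorem is applied to the weight at e = 0: by [is_logder_weight] the component [g q j]
    of its differential is the combination of weights on the left. The boundary integrals are first
    added up, since they cancel under the integral sign. *)
Lemma period_stokes k j z : all_admissible z ->
  (nu 0 j - (k j)%:R) * period (fun=> 0%N) (incr k j) z +
  \sum_i s 0 i * A j i * period (incr (fun=> 0%N) i) k z = 0.
Proof.
move=> az; pose wt q := weight A s c (G q).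
pose g q a t := (nu 0 a - (k a)%:R) * wt q (fun=> 0%N) (incr k a) z t +
  \sum_i s 0 i * A a i * wt q (incr (fun=> 0%N) i) k z t.
have cw q e k' : corner_continuous (wt q e k' z).
  exact: (weight_continuous (loadedG q) e k' (az q)).
have cwi q a i : corner_continuous (fun t => s 0 i * A a i * wt q (incr (fun=> 0%N) i) k z t).
  by apply: corner_continuousM; [exact: corner_continuous_cst|exact: cw].
have cg q a : corner_continuous (g q a).
  apply: corner_continuousD; last by apply: corner_continuous_sum => i _; exact: cwi.
  by apply: corner_continuousM; [exact: corner_continuous_cst|exact: cw].
have cu q : corner_continuous (fun t => glued_weight k z q (bary t)).
  rewrite (_ : (fun t => _) = wt q (fun=> 0%N) k z); first exact: cw.
  by apply/funext => t; rewrite glued_weight_bary.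
have du q l t : corner_int 1 t -> is_cderive t (delta_mx 0 l)
    (fun t => glued_weight k z q (bary t)) (\sum_a g q a t * jacobian_matrix (chart (G q)) t a l).
  move=> it; have := is_logder_weight (loadedG q) k l (az q) it.
  rewrite /is_logder (_ : weight _ _ _ _ _ _ _ = fun t => glued_weight k z q (bary t)).
    move=> h; apply: is_cderive_eq h _; rewrite mulr_sumr; apply: eq_bigr => a _.
    rewrite mulrA; congr (_ * _); rewrite /g /wt glued_weight_bary weight_incr_chart mulrDr.
    congr (_ + _); first by rewrite mulrCA mulrA.
    by rewrite mulr_sumr; apply: eq_bigr => i _; rewrite weight_incr_affine mulrCA mulrA.
  by apply/funext => t'; rewrite glued_weight_bary.
have E : (nu 0 j - (k j)%:R) * period (fun=> 0%N) (incr k j) z +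
    \sum_i s 0 i * A j i * period (incr (fun=> 0%N) i) k z =
    \sum_q simplex_integral (fun t => g q j t * \det (jacobian_matrix (chart (G q)) t)).
  under [in LHS]eq_bigr do rewrite mulr_sumr.
  rewrite mulr_sumr exchange_big -big_split /=; apply: eq_bigr => q _.
  pose J t := \det (jacobian_matrix (chart (G q)) t).
  have cJ e k' : corner_continuous (fun t => wt q e k' z t * J t).
    exact: (integrand_continuous (loadedG q)).
  have cZ a e k' : corner_continuous (fun t => a * (wt q e k' z t * J t)).
    by apply: corner_continuousM; [exact: corner_continuous_cst|exact: cJ].
  transitivity (simplex_integral (fun t => (nu 0 j - (k j)%:R) *
      (wt q (fun=> 0%N) (incr k j) z t * J t) +
      \sum_i s 0 i * A j i * (wt q (incr (fun=> 0%N) i) k z t * J t))).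
    rewrite simplex_integralD; [|exact: cZ|by apply: corner_continuous_sum => i _; exact: cZ].
    congr (_ + _); first by rewrite simplex_integralZ; [|exact: cJ].
    rewrite simplex_integral_sum; last by move=> i _; exact: cZ.
    by apply: eq_bigr => i _; rewrite simplex_integralZ; [|exact: cJ].
  apply: eq_simplex_integral_corner => t _; rewrite -/(J t) /g; move: (J t) => x.
  rewrite [RHS]mulrDl mulr_suml -[in RHS]mulrA; congr (_ + _).
  by apply: eq_bigr => i _; rewrite mulrA.
rewrite E; have st q : simplex_integral (fun t => g q j t * \det (jacobian_matrix (chart (G q)) t))
    = (-1) ^+ j * \sum_(p < N.+2) simplex_integral (fun y : 'rV[R]_N =>
    (-1) ^+ p * glued_weight k z q (face p (bary y)) * face_minor j q p y).
  have [U [oU cU] dU] := chart_smooth (loadedG q).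
  exact: (stokes_faces oU cU dU j (cu q) (cg q) (du q)).
under eq_bigr do rewrite st; rewrite -mulr_sumr.
have ct q (p : 'I_N.+2) : corner_continuous (fun y : 'rV[R]_N =>
    (-1) ^+ p * glued_weight k z q (face p (bary y)) * face_minor j q p y).
  have [U [oU cU] dU] := chart_smooth (loadedG q).
  apply: corner_continuousM; last exact: (minor_face_continuous cU dU).
  apply: corner_continuousM; first exact: corner_continuous_cst.
  have [l ->|->] := unliftP ord0 p.
    apply: (corner_continuous_ext (f := fun y => glued_weight k z q (bary (vins l 0 y)))).
      by move=> y _; rewrite bary_vins.
    exact: (corner_continuous_reparam (cu q) (@vins_continuous R N l 0) (@corner_vins R N l)).
  apply: (corner_continuous_ext (f := fun y => glued_weight k z q (bary (bary y)))).
    by move=> y _; rewrite bary_bary.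
  exact: (corner_continuous_reparam (cu q) (@bary_continuous R N) (@corner_bary R N)).
rewrite (_ : \sum_q _ = 0) ?mulr0//.
apply: etrans (_ : simplex_integral (fun=> 0 : C) = 0); last exact: simplex_integral0.
transitivity (simplex_integral (fun y : 'rV[R]_N => \sum_(q < M) \sum_(p < N.+2)
    (-1) ^+ p * glued_weight k z q (face p (bary y)) * face_minor j q p y)).
  rewrite simplex_integral_sum; last by move=> q _; apply: corner_continuous_sum => p _; exact: ct.
  by apply: eq_bigr => q _; rewrite simplex_integral_sum; [|move=> p _; exact: ct].
(* Cancellation is known on the open corner, which suffices for continuous integrands. *)
apply: eq_simplex_integral; last by move=> y; exact: boundary_cancel.
  by apply: corner_continuous_sum => q _; apply: corner_continuous_sum => p _; exact: ct.
exact: corner_continuous_cst.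
Qed.

End Periods.

(** * Gradients of products and of polynomial functions *)

Section MoreHolomorphy.
Variables (R : realType) (m : nat).
Local Notation C := R[i].
Implicit Types (f g : 'rV[C]_m -> C) (z : 'rV[C]_m) (d : 'I_m -> C).

Lemma has_gradientM z f g d1 d2 : has_gradient z f d1 -> has_gradient z g d2 ->
  has_gradient z (fun y => f y * g y) (fun i => d1 i * g z + f z * d2 i).
Proof.
move=> [df fd] [dg gd]; split; first exact: differentiableM.
move=> i; have hf : derivable f z (delta_mx 0 i) by exact: diff_derivable.
have hg : derivable g z (delta_mx 0 i) by exact: diff_derivable.
rewrite -fd -gd addrC [cpartial i f z * _]mulrC; exact: (deriveM hf hg).
Qed.

Lemma has_gradient_coord z i : has_gradient z (fun y => y 0 i) (fun j => (j == i)%:R).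
Proof.
have := @bound_row_form R m (fun y => y 0 i) z (fun j => (j == i)%:R); apply => e e0.
apply: (@filterE _ _ (nbhs_filter z)) => y.
rewrite (bigD1 i)//= eqxx mulr1 big1 ?addr0; last by move=> j /negbTE ->; rewrite mulr0.
by rewrite !mxE subrr normr0 mulr_ge0 ?normr_ge0 ?(ltW e0).
Qed.

Section Meval.
Import -(notations) mpoly.

Lemma has_gradient_meval z (p : mpoly m C) :
  has_gradient z (fun y => meval (y 0) p) (fun i => meval (z 0) (mderiv i p)).
Proof.
pose Q (p : mpoly m C) :=
  has_gradient z (fun y => meval (y 0) p) (fun i => meval (z 0) (mderiv i p)).
have QC a : Q (mpolyC m a).
  by apply: has_gradient_ext (has_gradient_cst z a) _ _ => *; rewrite ?mderivC ?meval0 ?mevalC.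
have QD p1 p2 : Q p1 -> Q p2 -> Q (p1 + p2).
  move=> h1 h2; apply: has_gradient_ext (has_gradientD h1 h2) _ _ => *.
    by rewrite mevalD.
  by rewrite mderivD mevalD.
have QM p1 p2 : Q p1 -> Q p2 -> Q (p1 * p2).
  move=> h1 h2; apply: has_gradient_ext (has_gradientM h1 h2) _ _ => *.
    by rewrite mevalM.
  by rewrite mderivM mevalD !mevalM.
have QX i : Q (mpolyX C (mnm1 i)).
  apply: has_gradient_ext (has_gradient_coord z i) _ _ => [y|j]; first by rewrite mevalXU.
  rewrite mderivX mnm1E eq_sym; have [->|_] := eqVneq i j; last by rewrite scale0r meval0.
  by rewrite -{1}[mnm1 j]add0m addmK mpolyX0 scale1r meval1.
have QXm b : Q (mpolyX C b).
  elim/mnm_ind: b => [|i b IH]; first by rewrite mpolyX0; exact: (QC 1).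
  by rewrite mpolyXD; exact: (QM _ _ (QX i) IH).
rewrite -/(Q p) [p]mpolyE; elim: (msupp p : seq _) => [|b r IH].
  by rewrite big_nil -(mpolyC0 m); exact: (QC 0).
by rewrite big_cons -mul_mpolyC; exact: (QD _ _ (QM _ _ (QC _) (QXm b)) IH).
Qed.
End Meval.
End MoreHolomorphy.

(** * Operators acting on the germ *)

Section Acts.
Import -(notations) mpoly.
Variables (R : realType) (m N : nat).
Local Notation C := R[i].
Local Notation n := N.+1.
Variables (A : 'M[C]_(n, m)) (s : 'rV[C]_m) (nu : 'rV[C]_n) (c : 'rV[C]_m).
Variables (M : nat) (G : 'I_M -> loaded_simplex R n).
Hypothesis cycleG : twisted_cycle A s nu c G.
Local Notation x := (row_mx s nu 0 : 'I_(m + n) -> C).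
Local Notation K := (param_field C m n).
Local Notation W := (weyl K m).
Local Notation Phi := (period A s c G).
Implicit Types (z : 'rV[C]_m) (b : multinom m) (T U : W) (h : 'rV[C]_m -> C).

(** The interior of the set of admissible points: being open, it allows identities on it to be
    differentiated. *)
Definition period_domain z := \forall y \near z, all_admissible A c G y.
Local Notation dom := period_domain.

Lemma near_period_domain : \forall z \near c, dom z.
Proof. exact: (nbhs_interior (near_all_admissible cycleG)). Qed.

Lemma period_domain_open z : dom z -> \forall y \near z, dom y.
Proof. exact: nbhs_interior. Qed.

(** The closed form of the partial derivative of order b: an application of del_i after l earlier
    ones brings out -(s_i - l) and raises e_i. *)
Definition phi_partials b z : C :=
  (\prod_i \prod_(l < b i) - (s 0 i - l%:R)) * Phi b (fun=> 1%N) z.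

Lemma mnmU_incr i b : (mnm_add (mnm1 i) b : 'I_m -> nat) = incr b i.
Proof. by apply/funext => j; rewrite mnmDE mnm1E /incr eq_sym. Qed.

Lemma phi_partials_gradient b z : dom z ->
  has_gradient z (phi_partials b) (fun i => phi_partials (mnm_add (mnm1 i) b) z).
Proof.
move=> dz; have h := period_gradient cycleG b (fun=> 1%N) dz.
have h' := has_gradientM (has_gradient_cst z (\prod_i \prod_(l < b i) - (s 0 i - l%:R))) h.
apply: has_gradient_eq h' _ => i; rewrite mul0r add0r /phi_partials mnmU_incr mulrA; congr (_ * _).
rewrite (bigD1 i)//= [in RHS](bigD1 i)//= /incr eqxx add1n big_ord_recr /= mulrAC; congr (_ * _).
by apply: eq_bigr => j /negbTE ->.
Qed.

Lemma phi_partials0 z : phi_partials (@mnm0 m) z = phi A s c G z.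
Proof.
rewrite -period_phi /phi_partials big1 ?mul1r; last first.
  by move=> i _; rewrite mnm0E big_ord0.
have -> : (mnm0 : 'I_m -> nat) = (fun=> 0%N) by apply/funext => i; rewrite mnm0E.
by [].
Qed.

(** Both inductions are over all points of the domain, since each further derivative needs the
    identity in a neighbourhood. *)
Lemma cpartials_phi b z : dom z -> cpartials b (phi A s c G) z = phi_partials b z.
Proof.
move=> dz; pose B (r : seq 'I_m) := \big[@mnm_add m/@mnm0 m]_(i <- r) mnm_muln (mnm1 i) (b i).
suff H r : forall z, dom z -> foldr (fun i => iter (b i) (@cpartial R m i)) (phi A s c G) r z =
    phi_partials (B r) z.
  rewrite /cpartials H//; congr (phi_partials _ _); rewrite /B big_enum /=.
  exact/esym/multinomUE_id.
elim: r => [|i r IH] {}z {}dz /=; first by rewrite /B big_nil phi_partials0.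
rewrite /B big_cons -/(B r).
elim: (b i) z dz => [|l IHl] z dz; first by rewrite /= mulm0n add0m IH.
rewrite iterS mulmS -addmA.
have /= [_ <-] := phi_partials_gradient (mnm_add (mnm_muln (mnm1 i) l) (B r)) dz.
by apply: near_eq_derive; apply: (near_mono _ (period_domain_open dz)) => y; exact: IHl.
Qed.

(* At the parameters (s, nu), T maps phi to h on the domain. *)
Definition acts T h := exists2 t, op_specializes x T t &
  forall z, dom z -> h z = op_value (phi_partials^~ z) (z 0) t.

Lemma acts_ext T h1 h2 : (forall z, dom z -> h1 z = h2 z) -> acts T h1 -> acts T h2.
Proof. by move=> h12 [t Tt th]; exists t => // z dz; rewrite -h12// th. Qed.

Lemma acts1 : acts 1 (Phi (fun=> 0%N) (fun=> 1%N)).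
Proof.
exists 1; first exact: op_specializes1.
by move=> z dz; rewrite op_value1 phi_partials0 -period_phi.
Qed.

Lemma acts0 : acts 0 (fun=> 0).
Proof.
by exists 0 => [|z dz]; [exact: op_specializes0|rewrite op_value0].
Qed.

Lemma actsD T U h1 h2 : acts T h1 -> acts U h2 -> acts (T + U) (fun z => h1 z + h2 z).
Proof.
move=> [t Tt th] [u Uu uh]; exists (t + u); first exact: op_specializesD.
by move=> z dz; rewrite op_valueD th// uh.
Qed.

Lemma acts_poly P p T h : poly_specializes x P p -> acts T h ->
  acts (weyl_poly P * T) (fun z => meval (z 0) p * h z).
Proof.
move=> Pp [t Tt th]; exists (p *: t); first exact: op_specializes_poly.
by move=> z dz; rewrite op_valueZ th.
Qed.

Lemma actsC k v T h : specializes x k v -> acts T h ->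
  acts (weyl_const m k * T) (fun z => v * h z).
Proof.
move=> kv Th; apply: acts_ext (acts_poly (poly_specializesC kv) Th) => z dz.
by rewrite mevalC.
Qed.

Lemma acts_c i T h : acts T h -> acts (weyl_c K i * T) (fun z => z 0 i * h z).
Proof.
move=> Th; apply: acts_ext (acts_poly (poly_specializesX x i) Th) => z dz.
by rewrite mevalXU.
Qed.

Lemma actsN T h : acts T h -> acts (- T) (fun z => - h z).
Proof.
move=> Th; have := actsC (specializesN (specializes1 x)) Th.
rewrite /weyl_const mpolyCN mpolyC1 weyl_polyN1.
by rewrite mulN1r; apply: acts_ext => z _; rewrite mulN1r.
Qed.

Lemma acts_sum (I : Type) (r : seq I) (P : pred I) (T : I -> W) (h : I -> 'rV[C]_m -> C) :
  (forall i, P i -> acts (T i) (h i)) ->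
  acts (\sum_(i <- r | P i) T i) (fun z => \sum_(i <- r | P i) h i z).
Proof.
move=> Th; elim: r => [|i r IH].
  by rewrite big_nil; apply: acts_ext acts0 => z _; rewrite big_nil.
rewrite big_cons; case: ifP => Pi.
  by apply: acts_ext (actsD (Th _ Pi) IH) => z _; rewrite big_cons Pi.
by apply: acts_ext IH => z _; rewrite big_cons Pi.
Qed.

Lemma op_value_gradient t z : dom z ->
  has_gradient z (fun y => op_value (phi_partials^~ y) (y 0) t)
    (fun i => op_value (phi_partials^~ z) (z 0) (partial_op i t)).
Proof.
move=> dz; have h b := has_gradientM (has_gradient_meval z (mcoeff b t)) (phi_partials_gradient b dz).
by apply: has_gradient_eq (has_gradient_sum (msupp t) h) _ => i; rewrite op_value_partial.
Qed.

(** On the open domain h coincides with the value of an operator on the jet of the germ, so the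
    partial derivatives coincide as well; those of the operator value are given by [partial_op]. *)
Lemma acts_d i T h (d : 'I_m -> 'rV[C]_m -> C) : acts T h ->
  (forall z, dom z -> has_gradient z h (d^~ z)) -> acts (weyl_d K i * T) (d i).
Proof.
move=> [t Tt th] hd; exists (partial_op i t); first exact: op_specializes_d.
move=> z dz; have [_ <-] := hd z dz; have [_ <-] := op_value_gradient t dz.
by apply: near_eq_derive; apply: (near_mono _ (period_domain_open dz)) => y; exact: th.
Qed.

Lemma acts0_d i T : acts T (fun=> 0) -> acts (weyl_d K i * T) (fun=> 0).
Proof.
move=> T0; apply: (@acts_d i T (fun=> 0) (fun _ _ => 0) T0) => z dz.
exact: has_gradient_cst.
Qed.

(** By [weyl_mulE] only derivatives and polynomial multiples of the zero function occur. The
    condition on the denominators of [a] gives its coefficients a value. *)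
Lemma acts0_mul (a T : W) : meval x (op_denominator a) != 0 ->
  acts T (fun=> 0) -> acts (a * T) (fun=> 0).
Proof.
move=> a0 T0; rewrite weyl_mulE.
suff h b : acts (weyl_poly (mcoeff b (a : mpoly m _)) *
    foldr (fun i => iter (b i) ( *%R (weyl_d K i))) T (enum 'I_m)) (fun=> 0).
  apply: acts_ext (acts_sum (P := xpredT) (msupp (a : mpoly m _)) (fun b _ => h b)) => z _.
  by rewrite big1.
have [p Pp] : exists p, poly_specializes x (mcoeff b (a : mpoly m _)) p.
  by apply: poly_specializes_exists => b'; eexists; exact: specializes_coef.
have h : acts (foldr (fun i => iter (b i) ( *%R (weyl_d K i))) T (enum 'I_m)) (fun=> 0).
  elim: (enum _) => //= i r IH; elim: (b i) => //= l; exact: acts0_d.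
by apply: acts_ext (acts_poly Pp h) => z _; rewrite mulr0.
Qed.

(** The witness of [acts] may come from a computation with generators, whereas [weyl_act] evaluates
    representatives of the coefficients of [T]; uniqueness of values identifies the two. *)
Lemma acts_annihilates T : meval x (op_denominator T) != 0 -> acts T (fun=> 0) ->
  annihilates_near s nu T (phi A s c G) c.
Proof.
move=> T0 [t Tt th]; apply: (near_mono _ near_period_domain) => z dz; split.
  have [d _] := phi_partials_gradient (@mnm0 m) dz.
  by move: d; rewrite (_ : phi_partials (@mnm0 m) = phi A s c G)//; apply/funext => y; exact: phi_partials0.
rewrite /weyl_act; under eq_bigr do rewrite (cpartials_phi _ dz).
apply: etrans (esym (th z dz)); apply: (op_value_weyl _ _ Tt) => b b'; rewrite /par_eval.
by apply: specializes_fun (Tt b b'); exact: specializes_coef.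
Qed.

End Acts.

Lemma decr_incr (I : eqType) (e : I -> nat) i : decr (incr e i) i = e.
Proof. by apply/funext => j; rewrite /decr /incr addKn. Qed.

(** * Linear relations between periods *)

Section PeriodRelations.
Variables (R : realType) (m N : nat).
Local Notation C := R[i].
Local Notation n := N.+1.
Variables (A : 'M[C]_(n, m)) (s : 'rV[C]_m) (nu : 'rV[C]_n) (c : 'rV[C]_m).
Variables (M : nat) (G : 'I_M -> loaded_simplex R n).
Hypothesis cycleG : twisted_cycle A s nu c G.
Local Notation Phi := (period A s c G).
Implicit Types (e : 'I_m -> nat) (k : 'I_n -> nat) (z : 'rV[C]_m).

(** Under the integral this is 1 = (l_i - z_i) / (l_i - z_i), with the numerator expanded in the
    coordinates x_j. *)
Lemma period_contiguity i e k z : all_admissible A c G z -> (forall j, 0 < k j)%N ->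
  Phi e k z = \sum_j A j i * Phi (incr e i) (decr k j) z - z 0 i * Phi (incr e i) k z.
Proof.
(* The relation is passed to [period_linear] as a list of triples: coefficient, e, k. *)
move=> az k0; pose r := [:: (-1, e, k); (- z 0 i, incr e i, k)] ++
  [seq (A j i, incr e i, decr k j) | j <- index_enum 'I_n].
have := @period_linear _ _ _ _ _ _ _ _ _ cycleG _ r (fun b => b.1.1) (fun b => b.1.2) (fun b => b.2)
  _ az.
rewrite /r !big_cons big_map /= => h; apply/eqP; rewrite -subr_eq0 -oppr_eq0; apply/eqP.
rewrite -{}[RHS]h; first by ring.
move=> q t ct; rewrite !big_cons big_map /=.
rewrite (eq_bigr (fun j => A j i * chart (G q) t 0 j * weight A s c (G q) (incr e i) k z t)).
  rewrite -mulr_suml -{1}(decr_incr e i) -(affine_weight s k (az q) ct); last by rewrite /incr eqxx.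
  by rewrite /affine /ell; ring.
have lq : is_loaded_simplex A s nu c (G q) by have [] := cycleG.
by move=> j _; rewrite -mulrA (chart_weight lq).
Qed.

(** Lowering the exponent of an affine form multiplies the integrand by it. The operators P and Q
    both reduce to this, with q independent of the integration variable. *)
Lemma period_relation (I : Type) (r : seq I) (p : I -> C) (v : I -> 'I_m) (q : C) e k z :
  all_admissible A c G z -> (forall b, 0 < e (v b))%N ->
  (forall y, \sum_(b <- r) p b * (ell A (v b) y - z 0 (v b)) = q) ->
  \sum_(b <- r) p b * Phi (decr e (v b)) k z = q * Phi e k z.
Proof.
move=> az ev hq; apply/eqP; rewrite -subr_eq0; apply/eqP.
pose r' := (- q, e, k) :: [seq (p b, decr e (v b), k) | b <- r].
have := @period_linear _ _ _ _ _ _ _ _ _ cycleG _ r' (fun b => b.1.1) (fun b => b.1.2) (fun b => b.2)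
  _ az.
rewrite /r' !big_cons big_map /= => h; rewrite addrC -mulNr; apply: h => a t ct.
rewrite big_cons big_map /=.
rewrite (eq_bigr (fun b => p b * (ell A (v b) (chart (G a) t) - z 0 (v b)) * weight A s c (G a) e k z t)).
  by rewrite -mulr_suml hq mulNr addNr.
by move=> b _; rewrite -(affine_weight s k (az a) ct (ev b)) mulrA.
Qed.

End PeriodRelations.

(** * The generators annihilate the germ *)

Section Generators.
Import -(notations) mpoly.
Variables (R : realType) (m N : nat).
Local Notation C := R[i].
Local Notation n := N.+1.
Variables (A : 'M[C]_(n, m)) (s : 'rV[C]_m) (nu : 'rV[C]_n) (c : 'rV[C]_m).
Variables (M : nat) (G : 'I_M -> loaded_simplex R n).
Hypothesis cycleG : twisted_cycle A s nu c G.
Hypotheses (s0 : forall i, s 0 i != 0) (nu1 : forall j, nu 0 j != 1).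
Local Notation x := (row_mx s nu 0 : 'I_(m + n) -> C).
Local Notation K := (param_field C m n).
Local Notation W := (weyl K m).
Local Notation Phi := (period A s c G).
Local Notation dom := (period_domain A c G).
Local Notation acts := (acts A s nu c G).
Implicit Types (T : W) (e : 'I_m -> nat) (k : 'I_n -> nat) (z : 'rV[C]_m).

Lemma period_domain_admissible z : dom z -> all_admissible A c G z.
Proof. exact: nbhs_singleton. Qed.

Lemma specializes_s i : specializes x (par_s C n i) (s 0 i).
Proof. by have := specializes_par x (mpolyX C (mnm1 (lshift n i))); rewrite mevalXU row_mxEl. Qed.

Lemma specializes_nu j : specializes x (par_nu C m j) (nu 0 j).
Proof. by have := specializes_par x (mpolyX C (mnm1 (rshift m j))); rewrite mevalXU row_mxEr. Qed.

Lemma specializes_cst (a : C) : specializes x (par_cst m n a) a.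
Proof. by have := specializes_par x (mpolyC (m + n) a); rewrite mevalC. Qed.

Lemma acts_d_sum (I : Type) (r : seq I) (P : pred I) (a : I -> C) (k : I -> 'I_n -> nat) i e T :
  acts T (fun z => \sum_(b <- r | P b) a b * Phi e (k b) z) ->
  acts (weyl_d K i * T)
    (fun z => \sum_(b <- r | P b) a b * (- (s 0 i - (e i)%:R) * Phi (incr e i) (k b) z)).
Proof.
move=> Th; apply: (acts_d cycleG (d := fun i z =>
  \sum_(b <- r | P b) a b * (- (s 0 i - (e i)%:R) * Phi (incr e i) (k b) z)) i Th) => z dz.
rewrite (_ : (fun y => _) = fun y => \sum_(b <- [seq b <- r | P b]) a b * Phi e (k b) y); last first.
  by apply/funext => y; rewrite big_filter.
have h b := has_gradientM (has_gradient_cst z (a b)) (period_gradient cycleG e (k b) dz).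
apply: has_gradient_eq (has_gradient_sum [seq b <- r | P b] h) _ => j.
by rewrite big_filter; apply: eq_bigr => b _; rewrite mul0r add0r.
Qed.

Lemma acts_d_period i e k T (a : C) : acts T (fun z => a * Phi e k z) ->
  acts (weyl_d K i * T) (fun z => a * (- (s 0 i - (e i)%:R) * Phi (incr e i) k z)).
Proof.
move=> Th; have := @acts_d_sum _ [:: tt] xpredT (fun=> a) (fun=> k) i e T.
move=> h; apply: acts_ext (h _) => [z _|]; first by rewrite big_seq1.
by apply: acts_ext Th => z _; rewrite big_seq1.
Qed.

Lemma acts_d_period1 i e k T : acts T (Phi e k) ->
  acts (weyl_d K i * T) (fun z => - (s 0 i - (e i)%:R) * Phi (incr e i) k z).
Proof.
move=> Th; have h : acts T (fun z => 1 * Phi e k z).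
  by apply: acts_ext Th => z _; rewrite mul1r.
by apply: acts_ext (acts_d_period i h) => z _; rewrite mul1r.
Qed.

(** From e = 0, del_i gives - s_i Phi(1_i, k); the combination over i with coefficients a^(i)_j is
    evaluated by [period_stokes]. *)
Lemma acts_D j k T : acts T (Phi (fun=> 0%N) k) ->
  acts (op_D A j * T) (fun z => (nu 0 j - (k j)%:R) * Phi (fun=> 0%N) (incr k j) z).
Proof.
move=> Th; rewrite /op_D mulr_suml.
have h i : acts (weyl_const m (par_cst m n (A j i)) * weyl_d K i * T)
    (fun z => A j i * (- (s 0 i - 0%:R) * Phi (incr (fun=> 0%N) i) k z)).
  rewrite -mulrA; apply: actsC; first exact: specializes_cst.
  exact: acts_d_period1.
apply: acts_ext (acts_sum (P := xpredT) (index_enum 'I_m) (fun i _ => h i)) => z dz.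
have /eqP := period_stokes cycleG k j (period_domain_admissible dz).
rewrite addr_eq0 => /eqP ->; rewrite -sumrN; apply: eq_bigr => i _.
by rewrite subr0; ring.
Qed.

(** At k_j = 1 the factor nu_j - k_j of [acts_D] cancels the denominator of [op_E]. *)
Lemma acts_E j k T : k j = 1%N -> acts T (Phi (fun=> 0%N) k) ->
  acts (op_E A j * T) (Phi (fun=> 0%N) (incr k j)).
Proof.
move=> kj Th; rewrite /op_E -mulrA.
have n1 : nu 0 j - 1 != 0 by rewrite subr_eq0.
have sp : specializes x (par_nu C m j - 1)^-1 (nu 0 j - 1)^-1.
  apply: specializesV => //; apply: specializesD; first exact: specializes_nu.
  exact/specializesN/specializes1.
apply: acts_ext (actsC sp (acts_D j Th)) => z _.
by rewrite kj mulKf.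
Qed.

(** The list has no repetition, so k_l is still 1 when the turn of l comes. *)
Lemma acts_prod_E (r : seq 'I_n) : uniq r ->
  acts (\prod_(l <- r) op_E A l) (Phi (fun=> 0%N) (fun j => (count_mem j r).+1)).
Proof.
elim: r => [|l r IH] /=; first by move=> _; rewrite big_nil; exact: acts1.
move=> /andP[lr ur]; rewrite big_cons.
have E : (fun j => ((l == j) + count_mem j r).+1) = incr (fun j => (count_mem j r).+1) l.
  by apply/funext => j; rewrite /incr addnS eq_sym.
rewrite E; apply: acts_E; last exact: IH.
by congr _.+1; apply/eqP; rewrite -leqn0 leqNgt -has_count has_pred1.
Qed.

Lemma acts_prod_E_all : acts (\prod_l op_E A l) (Phi (fun=> 0%N) (fun=> 2%N)).
Proof.
have := acts_prod_E (index_enum_uniq 'I_n); congr (acts _ (Phi _ _)).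
by apply/funext => j; rewrite count_uniq_mem ?index_enum_uniq// mem_index_enum.
Qed.

Lemma acts_prod_E_omit j :
  acts (\prod_(l < n | l != j) op_E A l) (Phi (fun=> 0%N) (decr (fun=> 2%N) j)).
Proof.
rewrite -big_filter; have := acts_prod_E (filter_uniq (fun l => l != j) (index_enum_uniq 'I_n)).
congr (acts _ (Phi _ _)); apply/funext => l.
rewrite count_uniq_mem ?filter_uniq ?index_enum_uniq// mem_filter mem_index_enum andbT /decr.
by case: (l == j).
Qed.

(** The variables are distinct, so each derivation finds the exponent 0 and brings out just -
    s_i. *)
Lemma acts_prod_d (I : eqType) (v : I -> 'I_m) (r : seq I) : uniq (map v r) ->
  acts (\prod_(l <- r) weyl_d K (v l))
    (fun z => (\prod_(l <- r) - s 0 (v l)) * Phi (fun i => count_mem i (map v r)) (fun=> 1%N) z).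
Proof.
elim: r => [|l r IH] /=.
  by move=> _; rewrite big_nil; apply: acts_ext (acts1 A s nu c G) => z _; rewrite big_nil mul1r.
move=> /andP[lr ur]; rewrite big_cons.
have c0 : count_mem (v l) (map v r) = 0%N.
  by apply/eqP; rewrite -leqn0 leqNgt -has_count has_pred1.
have E : (fun i => ((v l == i) + count_mem i (map v r))%N) =
    incr (fun i => count_mem i (map v r)) (v l).
  by apply/funext => i; rewrite /incr eq_sym.
apply: acts_ext (acts_d_period (v l) (IH ur)) => z _.
by rewrite c0 subr0 -E big_cons mulrCA mulrA.
Qed.

(** Contiguity rewrites c_i del_i phi as s_i phi minus terms in which some x_j is multiplied in;
    summed over i, those with a given j add up to - nu_j phi by the Stokes relation. *)
Lemma acts_H : acts (op_H C m n) (fun=> 0).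
Proof.
have h1 i : acts (weyl_c K i * weyl_d K i)
    (fun z => z 0 i * (- (s 0 i - 0%:R) * Phi (incr (fun=> 0%N) i) (fun=> 1%N) z)).
  by rewrite -[weyl_d K i]mulr1; apply: acts_c; apply: acts_d_period1; exact: acts1.
have sp : specializes x (\sum_(j < n) par_nu C m j + \sum_(i < m) par_s C n i)
    (\sum_j nu 0 j + \sum_i s 0 i).
  by apply: specializesD; apply: specializes_sum => i; [exact: specializes_nu|exact: specializes_s].
have h2 := actsN (actsC sp (acts1 A s nu c G)); rewrite mulr1 in h2.
apply: acts_ext (actsD (acts_sum (P := xpredT) (index_enum 'I_m) (fun i _ => h1 i)) h2) => z dz.
have az := period_domain_admissible dz.
pose e i := incr (fun _ : 'I_m => 0%N) i; pose k0 := fun _ : 'I_n => 1%N.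
pose P0 := Phi (fun=> 0%N) k0 z.
have E i : z 0 i * (- (s 0 i - 0%:R) * Phi (e i) k0 z) =
    s 0 i * P0 - \sum_j s 0 i * A j i * Phi (e i) (decr k0 j) z.
  rewrite /P0 (period_contiguity cycleG i (fun=> 0%N) az (fun=> isT : (0 < 1)%N)).
  have -> : \sum_j s 0 i * A j i * Phi (e i) (decr k0 j) z =
      s 0 i * \sum_j A j i * Phi (e i) (decr k0 j) z.
    by rewrite mulr_sumr; apply: eq_bigr => j _; rewrite mulrA.
  by rewrite -/(e i) subr0; ring.
rewrite (eq_bigr _ (fun i _ => E i)) sumrB -mulr_suml exchange_big /=.
have F j : \sum_i s 0 i * A j i * Phi (e i) (decr k0 j) z = - (nu 0 j * P0).
  (* Here k_j = 0, so the Stokes coefficient is nu_j, and incrementing k_j returns to phi. *)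
  have /eqP := period_stokes cycleG (decr k0 j) j az.
  rewrite decrK// addrC addr_eq0 => /eqP ->.
  by rewrite /decr eqxx subn1 subr0.
rewrite (eq_bigr _ (fun j _ => F j)) sumrN -mulr_suml /P0 /k0; ring.
Qed.

(** The products of [op_E] raise every k_l to 2, except the omitted one, which stays at 1; the three
    terms then form the contiguity relation at e = 0 and k = 2. *)
Lemma acts_L i : acts (op_L A i) (fun=> 0).
Proof.
pose k2 := fun _ : 'I_n => 2%N; pose e := incr (fun _ : 'I_m => 0%N) i.
have sV : specializes x (par_s C n i)^-1 (s 0 i)^-1 by apply: specializesV; [exact: s0|exact: specializes_s].
have h1 : acts (- (weyl_const m (par_s C n i)^-1 * weyl_d K i *
      \sum_(j < n) weyl_const m (par_cst m n (A j i)) * \prod_(l < n | l != j) op_E A l))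
    (fun z => - ((s 0 i)^-1 * \sum_j A j i * (- (s 0 i - 0%:R) * Phi e (decr k2 j) z))).
  rewrite -mulrA; apply: actsN; apply: actsC sV _.
  apply: acts_d_sum; apply: acts_sum => j _.
  by apply: actsC; [exact: specializes_cst|exact: acts_prod_E_omit].
have h2 : acts (weyl_c K i * (weyl_const m (par_s C n i)^-1 * weyl_d K i) * \prod_(l < n) op_E A l)
    (fun z => z 0 i * ((s 0 i)^-1 * (- (s 0 i - 0%:R) * Phi e k2 z))).
  rewrite -!mulrA; apply: acts_c; apply: actsC sV _; apply: acts_d_period1.
  exact: acts_prod_E_all.
have h3 := actsN acts_prod_E_all.
apply: acts_ext (actsD (actsD h1 h2) h3) => z dz.
have az := period_domain_admissible dz.
rewrite (period_contiguity cycleG i (fun=> 0%N) az (fun=> isT : (0 < 2)%N)) -/e -/k2.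
rewrite (eq_bigr (fun j => - s 0 i * (A j i * Phi e (decr k2 j) z))); last first.
  by move=> j _; rewrite subr0 mulrCA.
by rewrite -mulr_sumr subr0; field; exact: s0.
Qed.

Section Subset.
Variable I : {set 'I_m}.
Let v (l : 'I_#|I|) : 'I_m := enum_val l.

Let uniq_v (r : seq 'I_#|I|) : uniq r -> uniq (map v r).
Proof. by move=> ur; rewrite map_inj_uniq//; exact: enum_val_inj. Qed.

(** The indicator function of [I], in the form in which [acts_prod_d] produces it. *)
Let eI : 'I_m -> nat := fun i => count_mem i (map v (index_enum 'I_#|I|)).

Let eI_gt0 j : (0 < eI (v j))%N.
Proof.
by rewrite /eI -has_count has_pred1; apply: map_f; rewrite mem_index_enum.
Qed.

Lemma acts_del_all : acts (\prod_(l < #|I|) weyl_d K (enum_val l))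
  (fun z => (\prod_l - s 0 (v l)) * Phi eI (fun=> 1%N) z).
Proof. exact: acts_prod_d (uniq_v (index_enum_uniq _)). Qed.

Lemma acts_del_omit j : acts (del_omit C n j)
  (fun z => (\prod_(l | l != j) - s 0 (v l)) * Phi (decr eI (v j)) (fun=> 1%N) z).
Proof.
pose r := [seq l <- index_enum 'I_#|I| | l != j].
have ur : uniq r by rewrite filter_uniq// index_enum_uniq.
have E : (fun i => count_mem i (map v r)) = decr eI (v j).
  apply/funext => i; rewrite /decr /eI !count_uniq_mem ?uniq_v ?index_enum_uniq//.
  have [->|ij] := eqVneq i (v j).
    rewrite (map_f v (mem_index_enum j)) (_ : v j \in _ = false)//.
    apply/negbTE/mapP => -[l]; rewrite mem_filter => /andP[/eqP lj _] /enum_val_inj/esym.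
    exact.
  rewrite subn0; congr nat_of_bool; apply/mapP/mapP => -[l lr il]; exists l => //.
    by rewrite mem_index_enum.
  by rewrite mem_filter mem_index_enum andbT; apply: contraNneq ij => <-; apply/eqP.
have := acts_prod_d (uniq_v ur); rewrite E big_filter; apply: acts_ext => z _.
by rewrite big_filter.
Qed.

Let S := \prod_(l < #|I|) - s 0 (v l).

(** The coefficient s_i completes the omitted product up to sign, so all terms of P and of Q share
    one constant. *)
Let S_omit j : s 0 (v j) * \prod_(l | l != j) - s 0 (v l) = - S.
Proof. by rewrite /S [in RHS](bigD1 j)//= mulNr opprK. Qed.

(** Along a kernel vector the linear forms drop out, and the affine forms combine to the constant -
    sum_j p_j z_j, which the second term of P compensates. *)
Lemma acts_P (p : 'cV[C]_#|I|) : subcols A I *m p = 0 -> acts (op_P n p) (fun=> 0).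
Proof.
move=> Ap; have h1 j : acts (weyl_const m (par_cst m n (p j 0) * par_s C n (v j)) * del_omit C n j)
    (fun z => p j 0 * s 0 (v j) *
      ((\prod_(l | l != j) - s 0 (v l)) * Phi (decr eI (v j)) (fun=> 1%N) z)).
  apply: actsC; last exact: acts_del_omit.
  by apply: specializesM; [exact: specializes_cst|exact: specializes_s].
have h2 : acts ((\sum_(j < #|I|) weyl_const m (par_cst m n (p j 0)) * weyl_c K (enum_val j))
      * \prod_(l < #|I|) weyl_d K (enum_val l))
    (fun z => \sum_j p j 0 * (z 0 (v j) * (S * Phi eI (fun=> 1%N) z))).
  rewrite mulr_suml; apply: acts_sum => j _; rewrite -mulrA.
  by apply: actsC; [exact: specializes_cst|apply: acts_c; exact: acts_del_all].
apply: acts_ext (actsD (acts_sum (P := xpredT) (index_enum 'I_#|I|) (fun j _ => h1 j)) (actsN h2))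
  => z dz.
rewrite (eq_bigr (fun j => - S * (p j 0 * Phi (decr eI (v j)) (fun=> 1%N) z))); last first.
  by move=> j _; rewrite -(S_omit j); ring.
rewrite -mulr_sumr (period_relation cycleG (q := - \sum_j p j 0 * z 0 (v j)) _
  (period_domain_admissible dz) eI_gt0).
  by under [X in _ - X]eq_bigr do rewrite mulrA; rewrite -mulr_suml; ring.
move=> y; under eq_bigr do rewrite mulrBr; rewrite sumrB -[RHS]add0r; congr (_ - _).
rewrite /ell; under eq_bigr do rewrite mulr_sumr; rewrite exchange_big big1// => a _.
have /matrixP/(_ a 0) := Ap; rewrite !mxE => Ap0.
transitivity ((\sum_j subcols A I a j * p j 0) * y 0 a); last by rewrite Ap0 mul0r.
by rewrite mulr_suml; apply: eq_bigr => j _; rewrite mxE; ring.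
Qed.

(** The polynomial identity, evaluated at c = z and x = y, is a relation with q = 0. *)
Lemma acts_Q (p : 'I_#|I| -> mpoly m C) : is_relation A p -> acts (op_Q n p) (fun=> 0).
Proof.
move=> rel; have h j : acts (weyl_poly (map_mpoly (par_cst m n) (p j)) *
      weyl_const m (par_s C n (v j)) * del_omit C n j)
    (fun z => meval (z 0) (p j) * (s 0 (v j) *
      ((\prod_(l | l != j) - s 0 (v l)) * Phi (decr eI (v j)) (fun=> 1%N) z))).
  rewrite -mulrA; apply: acts_poly; first exact: poly_specializes_map.
  by apply: actsC; [exact: specializes_s|exact: acts_del_omit].
apply: acts_ext (acts_sum (P := xpredT) (index_enum 'I_#|I|) (fun j _ => h j)) => z dz.
rewrite (eq_bigr (fun j => - S * (meval (z 0) (p j) * Phi (decr eI (v j)) (fun=> 1%N) z))); last first.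
  by move=> j _; rewrite -(S_omit j); ring.
rewrite -mulr_sumr (period_relation cycleG (q := 0) _ (period_domain_admissible dz) eI_gt0).
  by rewrite mul0r mulr0.
move=> y; have := congr1 (fun P => meval (z 0) (meval (fun a => mpolyC m (y 0 a)) P)) rel.
rewrite !meval0 => h0; apply: etrans _ h0.
have meval_sum (B : comNzRingType) l (w : 'I_l -> B) (J : finType) (F : J -> mpoly l B) :
  meval w (\sum_j F j) = \sum_j meval w (F j) by exact: raddf_sum.
rewrite !meval_sum; apply: eq_bigr => j _.
rewrite !mevalM mevalC !mevalB mevalC mevalXU; congr (_ * (_ - _)).
rewrite /ell /lin_form !meval_sum; apply: eq_bigr => a _.
by rewrite !mevalM mevalC mevalXU !mevalC.
Qed.

End Subset.

Lemma acts_generator T : generator A T -> acts T (fun=> 0).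
Proof.
case=> [|i|I p _ Ap|I p rel]; [exact: acts_H|exact: acts_L|exact: acts_P|exact: acts_Q].
Qed.

End Generators.

(** * Generic parameters and the left ideal *)

Section Genericity.
Import -(notations) mpoly.

(** The excluded hypersurface collects the denominators of the sum, which [weyl_act] evaluates, and
    those of the multipliers, which must act before being summed. The denominators s_i and nu_j - 1
    of the generators are nonzero by the conditions on the parameters. *)
Lemma generator_ideal_annihilates (R : realType) (m N : nat) (A : 'M[R[i]]_(N.+1, m)) :
  left_ideal (generator A) `<=` Ann A.
Proof.
move=> T [r [a [g [gen_g ->]]]].
exists (op_denominator (\sum_(k < r) a k * g k) * \prod_(k < r) op_denominator (a k)).
  rewrite mulf_neq0 ?op_denominator_neq0// prodf_seq_neq0.
  by apply/allP => k _; exact: op_denominator_neq0.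
move=> s nu s0 nu1; rewrite mevalM mulf_eq0 negb_or => /andP[dT da] c M G cycleG.
apply: (acts_annihilates cycleG dT).
have h k : acts A s nu c G (a k * g k) (fun=> 0).
  apply: (acts0_mul cycleG); last exact: (acts_generator cycleG s0 nu1 (gen_g k)).
  move: da; rewrite rmorph_prod /= prodf_seq_neq0 => /allP; apply.
  by rewrite mem_index_enum.
apply: acts_ext (acts_sum (P := xpredT) (index_enum 'I_r) (fun k _ => h k)) => z _.
by rewrite big1.
Qed.
End Genericity.

Theorem theorem3p2 (R : realType) (m n : nat) (hm : (0 < m)%N) (hn : (0 < n)%N)
  (A : 'M[R[i]]_(n, m)) :
  (left_ideal (generator A) `<=` Ann A)%classic.
Proof.
by case: n hn A => // n _ A; exact: generator_ideal_annihilates.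
Qed.
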